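(* Let $m,d\ge 0$ be integers with $d\ge \frac{3m}{2}$, let $l$ be an integer with $0\le l\le 2d$, and let $\mathcal{L}^m_h[\cdot]$ and $Z(s)$ be as defined in the context. Then the converged Wigner-type limit $$\mathcal{L}^m\big[u^{2d-l}v^l\big]:=\lim_{h\to0^+}\mathcal{L}^m_h\big[u^{2d-l}v^l\big]$$ satisfies $$\mathcal{L}^m\big[u^{2d-l}v^l\big]=\begin{cases}\displaystyle \frac{1}{d!\,\binom{d-m-\frac12}{d}}\left(\frac{\partial}{\partial E}\right)^{d-l}\left(\frac12\frac{\partial}{\partial F}\right)^{l} Z\big(2(m-d)+1\big), & l\le d,\\[12pt] \displaystyle \frac{1}{d!\,\binom{d-m-\frac12}{d}}\left(\frac12\frac{\partial}{\partial F}\right)^{2d-l}\left(\frac{\partial}{\partial G}\right)^{l-d} Z\big(2(m-d)+1\big), & l>d.\end{cases}$$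
   Context: Notation: $\mathbf{u}=(u,v)\in\mathbb{R}^2$, $\mathbf{i}=(i,j)\in\mathbb{Z}^2$, $d\mathbf{u}=du\,dv$; $|\mathbf{u}|=\max(|u|,|v|)$, $|\mathbf{i}|=\max(|i|,|j|)$, and a prime on a sum means that $(0,0)$ is omitted. $E,F,G$ are real parameters with $E>0$, $G>0$, $EG-F^2>0$, and $Q(\mathbf{u})=Eu^2+2Fuv+Gv^2$. $Z(s)=Z(s;E,F,G)$ is the two-dimensional Epstein zeta function: the analytic continuation to $\mathbb{C}\setminus\{2\}$ of $\sum'_{(i,j)\in\mathbb{Z}^2}(Ei^2+2Fij+Gj^2)^{-s/2}$ (convergent for $\mathrm{Re}\,s>2$), regarded as a function of the parameters $(E,F,G)$; the partial derivatives $\partial/\partial E,\partial/\partial F,\partial/\partial G$ are taken with respect to these parameters at the fixed value of $s$. $\eta$ is a smooth function on $\mathbb{R}^2$ with compact support contained in $[-a,a]^2$ (for some $a>0$), satisfying $\eta(\mathbf{0})=1$ and $\eta(\mathbf{u})=\eta(-\mathbf{u})$ for all $\mathbf{u}$. For $h>0$ and a polynomial $f$, $$\mathcal{L}^m_h[f]:=\lim_{N\to\infty}\left(\sum_{|\mathbf{i}|<N}{}^{'}\frac{f(\mathbf{i})}{Q(\mathbf{i})^{m+\frac12}}\eta(\mathbf{i}h)-\int_{|\mathbf{u}|<N+\frac12}\frac{f(\mathbf{u})}{Q(\mathbf{u})^{m+\frac12}}\eta(\mathbf{u}h)\,d\mathbf{u}\right).$$ For real $x$ and integer $d\ge0$,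 $\binom{x}{d}=\frac{x(x-1)\cdots(x-d+1)}{d!}$. *)

(* Defs.v *)
(* MathComp-Analysis; complex numbers are [R[i]] from mathcomp-real-closed. *)
From mathcomp Require Import all_boot all_order all_algebra.
From mathcomp Require Import complex.
From mathcomp Require Import all_classical all_reals all_analysis.

Set Implicit Arguments.
Unset Strict Implicit.
Unset Printing Implicit Defensive.

Import Order.TTheory GRing.Theory Num.Theory.
Import numFieldNormedType.Exports.

Local Open Scope classical_set_scope.
Local Open Scope ring_scope.
Local Open Scope complex_scope.

Section Defs.
Context {R : realType}.

(* [R * R] carries the sup norm: [`|u| = max `|u.1| `|u.2|]. *)
Implicit Types (E F G h : R) (u : R * R) (f eta : R * R -> R).

Definition qform E F G u : R :=
  E * u.1 ^+ 2 + 2 * F * u.1 * u.2 + G * u.2 ^+ 2.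

Definition posdef E F G : Prop := [/\ 0 < E, 0 < G & 0 < E * G - F ^+ 2].

Definition lattice_pt (i : int * int) : R * R := (i.1%:~R, i.2%:~R).

Definition punctured_square (N : nat) : set (int * int) :=
  [set i | `|i.1| < N%:Z /\ `|i.2| < N%:Z /\ i != (0, 0)].

(* [x ^ (a + ib) = x ^ a * exp (i b ln x)], for [0 < x] *)
Definition cpow (x : R) (s : R[i]) : R[i] :=
  (x `^ complex.Re s)%:C *
  (cos (complex.Im s * ln x) +i* sin (complex.Im s * ln x)).

(* [Z E F G s] is required to be holomorphic in [s] on the connected set
   C \ {2} and to agree there with the lattice series when [Re s > 2], which
   determines it uniquely on positive definite [(E, F, G)].  The series
   converges absolutely, so that summing it over growing squares is no
   restriction.  The topology on [R[i]] is found through its regular module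
   [R[i]^o]. *)
Definition is_epstein_zeta (Z : R -> R -> R -> R[i] -> R[i]) : Prop :=
  forall E F G, posdef E F G ->
    (forall s : R[i], s != 2 -> derivable (Z E F G : R[i]^o -> R[i]^o) s 1) /\
    (forall s : R[i], 2 < complex.Re s ->
       (\sum_(i \in punctured_square N)
          cpow (qform E F G (lattice_pt i)) (- s / 2) : R[i]^o) @[N --> \oo]
         --> (Z E F G s : R[i]^o)).

Definition cderive1 (g : R -> R[i]) (x : R) : R[i] :=
  derive1 (fun t => complex.Re (g t)) x +i*
  derive1 (fun t => complex.Im (g t)) x.

Implicit Type W : R -> R -> R -> R[i].

Definition dE W : R -> R -> R -> R[i] :=
  fun E F G => cderive1 (fun x => W x F G) E.
Definition half_dF W : R -> R -> R -> R[i] :=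
  fun E F G => 2^-1 * cderive1 (fun x => W E x G) F.
Definition dG W : R -> R -> R -> R[i] :=
  fun E F G => cderive1 (fun x => W E F x) G.

(* C^oo: every iterated directional derivative is (Frechet) differentiable *)
Definition smooth f : Prop :=
  forall (vs : seq (R * R)) u,
    differentiable (foldr (fun v g => 'D_v g) f vs) u.

Definition leb2 := ((@lebesgue_measure R) \x (@lebesgue_measure R))%E.

(* The value at [u = 0] is junk, but [{0}] is a null set and the lattice sum
   omits it. *)
Definition wigner_integrand E F G eta (m : nat) h f u : R :=
  f u / qform E F G u `^ (m%:R + 2^-1) * eta (h *: u).

Definition wigner_seq E F G eta (m : nat) f h (N : nat) : R :=
  (\sum_(i \in punctured_square N)
      wigner_integrand E F G eta m h f (lattice_pt i)) -
  \int[leb2]_(u in [set u | `|u| < N%:R + 2^-1])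
      wigner_integrand E F G eta m h f u.

Definition wigner_h E F G eta (m : nat) f h : R :=
  lim (wigner_seq E F G eta m f h N @[N --> \oo]).

Definition wigner E F G eta (m : nat) f : R :=
  lim (wigner_h E F G eta m f h @[h --> 0^'+]).

Definition gbinom (x : R) (d : nat) : R :=
  (\prod_(k < d) (x - k%:R)) / d`!%:R.

End Defs.

(* Main.v *)
(* Fix [M] prime to [1, ..., n] and compare, for [G i = f i * Q i ^ (- s / 2) *
   eta (h i)], the sum of [G] over the lattice with [M ^ 2] times its sum over the
   multiples of [M].  Collecting residue classes modulo [M] writes this defect as a
   sum of [n]-th differences of [G], so it stays bounded as [h -> 0], locally
   uniformly in [s] and in the form.  For large real [s] and [f = 1] it tends to
   [(1 - M ^ (2 - s)) Z s] by homogeneity.  The two-constants theorem, along an entire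
   path avoiding the pole, carries this limit to [s = 2 (m - d) + 1].  Differentiating
   the defect in [E], [F], [G] multiplies its terms by monomials, and as the second
   derivatives are bounded, Landau's inequality lets the limit pass to the
   derivatives.  Finally, by homogeneity the lattice sum minus the integral is a
   geometric series of defects at the scales [h / M ^ j], the sums at these scales
   being Riemann sums, so it tends to the limit of the defect over [1 - M ^ k]. *)

(* The defect replaces the sum because its continuous analogue, the integral of
   [G u - M ^ 2 * G (M u)], vanishes by a change of variable. Estimates, continuation in [s] and
   differentiation in the form can thus be carried out on finite sums, and the plane integral enters
   only at the end. To the left of the pole the series diverges and [Z] is known only to be
   holomorphic, so the limit of the defect cannot be identified there directly; a bound uniform in
   [h], with convergence on a stretch of the real axis, forces it. Reaching the plane without [2]
   through an entire function turns this into a statement about a single rectangle, for which a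
   Cauchy estimate at its centre is enough. The continuation identifies the limit for [f = 1] only.
   Each derivation in the form lowers the exponent of [Q] by one and brings out a monomial of degree
   [2]; to end at [- m - 1/2] after [d] of them one starts at [b = d - m - 1/2]. Hence the point
   [- 2 b = 2 (m - d) + 1], and the falling factorial [b (b - 1) ... (b - d + 1)] in the
   denominator. *)
Require Import Defs.
From mathcomp Require Import all_boot all_order all_algebra.
From mathcomp Require Import complex.
From mathcomp Require Import all_classical all_reals all_analysis.
From mathcomp Require Import measurable_realfun.
From mathcomp Require Import ring lra zify.
Import Order.TTheory GRing.Theory Num.Theory.
Import numFieldNormedType.Exports.
Local Open Scope classical_set_scope.
Local Open Scope ring_scope.
Local Open Scope complex_scope.
Set Implicit Arguments.
Unset Strict Implicit.
Unset Printing Implicit Defensive.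

(** * Goursat's theorem on rectangles *)

Section SegmentIntegral.
Context {R : realType}.
Implicit Types (f g : R -> R) (a b c e : R).
Local Notation mu := (@lebesgue_measure R).

Definition segint f a b : R := \int[mu]_(x in `[a, b]) f x.

Lemma segint_integrable f a b : continuous f -> mu.-integrable `[a, b] (EFin \o f).
Proof.
move=> cf; apply: continuous_compact_integrable; first exact: segment_compact.
exact: continuous_subspaceT.
Qed.

Lemma eq_segint f g a b : (forall x, a <= x <= b -> f x = g x) ->
  segint f a b = segint g a b.
Proof. by move=> fg; apply: eq_Rintegral => x; rewrite inE/= in_itv/= => /fg. Qed.

Lemma segintB f g a b : continuous f -> continuous g ->
  segint (fun x => f x - g x) a b = segint f a b - segint g a b.
Proof. by move=> cf cg; rewrite /segint RintegralB//; exact: segint_integrable. Qed.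

Lemma segint_cst c a b : a <= b -> segint (fun=> c) a b = c * (b - a).
Proof.
move=> ab; rewrite /segint Rintegral_cst//= lebesgue_measure_itv/= lte_fin.
case: ltP => [//|ba]; have -> : a = b by apply/eqP; rewrite eq_le ab ba.
by rewrite subrr.
Qed.

Lemma segint_split f a c b : continuous f -> a <= c -> c <= b ->
  segint f a b = segint f a c + segint f c b.
Proof.
move=> cf ac cb; rewrite /segint.
have := @Rintegral_itvB R f (BLeft a) (BRight b) c (segint_integrable a b cf).
rewrite !bnd_simp => /(_ ac cb) /eqP; rewrite subr_eq => /eqP ->.
rewrite addrC; congr (_ + _); rewrite Rintegral_itv_obnd_cbnd//.
apply: (@integrableS _ _ _ mu `[c, b]) => //; last exact: segint_integrable.
by apply: subset_itvr; rewrite bnd_simp.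
Qed.

Lemma le_segint f g a b : continuous f -> continuous g ->
  (forall x, a <= x <= b -> f x <= g x) -> segint f a b <= segint g a b.
Proof.
move=> cf cg fg; apply: le_Rintegral => //.
- exact: (segint_integrable a b cf).
- exact: (segint_integrable a b cg).
Qed.

Lemma norm_segint_le f a b e : continuous f -> a <= b ->
  (forall x, a <= x <= b -> `|f x| <= e) -> `|segint f a b| <= e * (b - a).
Proof.
move=> cf ab fe; rewrite ler_norml -mulNr -!segint_cst//.
apply/andP; split; apply: le_segint => //; try exact: cst_continuous.
- by move=> x xab; have := fe x xab; rewrite ler_norml => /andP[].
- by move=> x xab; have := fe x xab; rewrite ler_norml => /andP[].
Qed.

End SegmentIntegral.

(** * Circulation of a differential form around a rectangle *)

Section ClosedForm.
Context {R : realType}.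
Implicit Types (P Q : R -> R -> R) (x y w h a b e : R).

(* The real part of the integral of [(P + i Q) dz] along the boundary. *)
Definition circulation P Q x y w h : R :=
  segint (fun t => P t y - P t (y + h)) x (x + w)
  - segint (fun t => Q (x + w) t - Q x t) y (y + h).

Definition continuous2 P := forall x y e, 0 < e -> exists2 d : R, 0 < d &
  forall x' y', `|x' - x| < d -> `|y' - y| < d -> `|P x' y' - P x y| < e.

Definition differentiable2 P x y a b := forall e, 0 < e -> exists2 d : R, 0 < d &
  forall x' y', `|x' - x| < d -> `|y' - y| < d ->
    `|P x' y' - P x y - a * (x' - x) - b * (y' - y)|
      <= e * (`|x' - x| + `|y' - y|).

Lemma continuous2_1 P y : continuous2 P -> continuous (fun t => P t y).
Proof.
move=> cP x; apply/cvgrPdist_lt => e e0.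
have [d d0 H] := cP x y e e0.
near=> t; rewrite distrC; apply: H; last by rewrite subrr normr0.
by near: t; apply/nbhs_normP; exists d => // t /=; rewrite distrC.
Unshelve. all: by end_near. Qed.

Lemma continuous2_2 P x : continuous2 P -> continuous (fun t => P x t).
Proof.
move=> cP; apply: (@continuous2_1 (fun a b => P b a)) => a b e e0.
by have [d d0 H] := cP b a e e0; exists d => // x' y' ? ?; exact: H.
Qed.

Lemma continuous_sub2 (f g : R -> R) : continuous f -> continuous g ->
  continuous (fun t => f t - g t).
Proof. by move=> cf cg x; apply: continuousB; [exact: cf|exact: cg]. Qed.

Section Fixed.
Variables P Q : R -> R -> R.
Hypotheses (cP : continuous2 P) (cQ : continuous2 Q).

Let cP1 y : continuous (fun t => P t y). Proof. exact: continuous2_1. Qed.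
Let cQ2 x : continuous (fun t => Q x t). Proof. exact: continuous2_2. Qed.

Lemma circulation_splitx x y w1 w2 h : 0 <= w1 -> 0 <= w2 ->
  circulation P Q x y (w1 + w2) h =
  circulation P Q x y w1 h + circulation P Q (x + w1) y w2 h.
Proof.
move=> w1p w2p; rewrite /circulation addrA.
rewrite (@segint_split _ _ x (x + w1)) ?lerDl//; last exact: continuous_sub2.
rewrite !segintB//; ring.
Qed.

Lemma circulation_splity x y w h1 h2 : 0 <= h1 -> 0 <= h2 ->
  circulation P Q x y w (h1 + h2) =
  circulation P Q x y w h1 + circulation P Q x (y + h1) w h2.
Proof.
move=> w1p w2p; rewrite /circulation addrA.
rewrite (@segint_split _ (fun t => Q (x + w) t - Q x t) y (y + h1)) ?lerDl//; last first.
  exact: continuous_sub2.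
rewrite !segintB//; ring.
Qed.

Lemma norm_circulation_le x y w h e : 0 <= w -> 0 <= h ->
  (forall x' y', x <= x' <= x + w -> y <= y' <= y + h ->
     `|P x' y'| <= e /\ `|Q x' y'| <= e) ->
  `|circulation P Q x y w h| <= 2 * e * (w + h).
Proof.
move=> w0 h0 H; rewrite /circulation mulrDr.
have E (u v : R) : `|u| <= e -> `|v| <= e -> `|u - v| <= 2 * e.
  by move=> ue ve; rewrite (le_trans (ler_normB _ _))// mulrDl mul1r lerD.
apply: le_trans (ler_normB _ _) _; apply: lerD.
- rewrite (_ : 2 * e * w = 2 * e * (x + w - x)); last by ring.
  apply: norm_segint_le.
  + exact: continuous_sub2.
  + by rewrite lerDl.
  + by move=> t txw; apply: E; [apply: (proj1 (H _ _ _ _))..] => //; rewrite lexx lerDl ?h0.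
- rewrite (_ : 2 * e * h = 2 * e * (y + h - y)); last by ring.
  apply: norm_segint_le.
  + exact: continuous_sub2.
  + by rewrite lerDl.
  + by move=> t txw; apply: E; [apply: (proj2 (H _ _ _ _))..] => //; rewrite lexx lerDl ?w0.
Qed.

(* Subtracting the affine part of a closed form does not change its
   circulation. *)
Lemma circulation_local x y w h x0 y0 a b c e : 0 <= w -> 0 <= h ->
  (forall x' y', x <= x' <= x + w -> y <= y' <= y + h ->
     `|P x' y' - P x0 y0 - a * (x' - x0) + b * (y' - y0)| <= e /\
     `|Q x' y' - Q x0 y0 - b * (x' - x0) - c * (y' - y0)| <= e) ->
  `|circulation P Q x y w h| <= 2 * e * (w + h).
Proof.
move=> w0 h0 H; rewrite /circulation mulrDr.
have E (u v : R) : `|u| <= e -> `|v| <= e -> `|u - v| <= 2 * e.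
  by move=> ue ve; rewrite (le_trans (ler_normB _ _))// mulrDl mul1r lerD.
have -> : segint (fun t => P t y - P t (y + h)) x (x + w) =
   segint (fun t => P t y - P t (y + h) - b * h) x (x + w) + b * h * w.
  rewrite [in RHS]segintB; [|exact: continuous_sub2|exact: cst_continuous].
  by rewrite segint_cst ?lerDl//; ring.
have -> : segint (fun t => Q (x + w) t - Q x t) y (y + h) =
   segint (fun t => Q (x + w) t - Q x t - b * w) y (y + h) + b * w * h.
  rewrite [in RHS]segintB; [|exact: continuous_sub2|exact: cst_continuous].
  by rewrite segint_cst ?lerDl//; ring.
rewrite (_ : forall u v, u + b * h * w - (v + b * w * h) = u - v); last by move=> *; ring.
apply: le_trans (ler_normB _ _) _; apply: lerD.
- rewrite (_ : 2 * e * w = 2 * e * (x + w - x)); last by ring.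
  apply: norm_segint_le.
  + by apply: continuous_sub2; [exact: continuous_sub2|exact: cst_continuous].
  + by rewrite lerDl.
  + move=> t txw; have [|A _] := H t y txw _; first by rewrite lexx lerDl.
    have [|B _] := H t (y + h) txw _; first by rewrite lerDl h0 lexx.
    by have := E _ _ A B; congr (is_true (`| _ | <= _)); ring.
- rewrite (_ : 2 * e * h = 2 * e * (y + h - y)); last by ring.
  apply: norm_segint_le.
  + by apply: continuous_sub2; [exact: continuous_sub2|exact: cst_continuous].
  + by rewrite lerDl.
  + move=> t txw; have [|_ A] := H (x + w) t _ txw; first by rewrite lerDl w0 lexx.
    have [|_ B] := H x t _ txw; first by rewrite lexx lerDl.
    by have := E _ _ A B; congr (is_true (`| _ | <= _)); ring.
Qed.

End Fixed.
End ClosedForm.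

(** * Vanishing of the circulation by bisection *)

Section Goursat.
Context {R : realType}.
Implicit Types (P Q : R -> R -> R) (x y w h a b e : R).

(** The left endpoints increase and the right ones decrease, so every left endpoint lies below every
    right one; the supremum of the former is the common point. *)
Lemma nested_intervals (a : nat -> R) (w : R) : 0 <= w ->
  (forall n, a n <= a n.+1 <= a n + w * 2^-1 ^+ n.+1) ->
  exists p, forall n, a n <= p <= a n + w * 2^-1 ^+ n.
Proof.
move=> w0 H; pose b n := a n + w * 2^-1 ^+ n.
have a_nd : {homo a : m n / (m <= n)%N >-> m <= n}.
  by apply/nondecreasing_seqP => n; have /andP[] := H n.
have b_ni : {homo b : m n / (m <= n)%N >-> n <= m}.
  apply/nonincreasing_seqP => n; have /andP[_ H2] := H n; rewrite /b.
  apply: le_trans (lerD H2 (lexx _)) _; rewrite exprS -addrA lerD2l.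
  by rewrite le_eqVlt; apply/orP; left; apply/eqP; field.
have ab n : a n <= b n by rewrite lerDl mulr_ge0// exprn_ge0.
have amb m n : a m <= b n.
  case: (leqP m n) => mn; first exact: le_trans (a_nd _ _ mn) (ab _).
  exact: le_trans (ab _) (b_ni _ _ (ltnW mn)).
exists (sup (range a)) => n; apply/andP; split.
- apply: ub_le_sup; last by exists n.
  by exists (b 0%N) => _ [m _ <-]; exact: amb.
- by apply: ge_sup; [exists (a 0%N), 0%N|move=> _ [m _ <-]; exact: amb].
Qed.

Section Bisection.
Variables (P Q : R -> R -> R) (w h e : R).
Hypotheses (cP : continuous2 P) (cQ : continuous2 Q) (w0 : 0 < w) (h0 : 0 < h).

(** The circulation exceeds [e] times the area; [s] is the scale reached by halving. *)
Let bad (p : R * R) (s : R) :=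
  e * (w * s) * (h * s) < `|circulation P Q p.1 p.2 (w * s) (h * s)|.

(** Circulation and area are both additive over the four quarters: if all of these were good, so
    would be the whole. *)
Let bad_quarter p s : 0 < s -> bad p s -> exists q,
  [/\ bad q (s / 2), p.1 <= q.1 <= p.1 + w * (s / 2)
    & p.2 <= q.2 <= p.2 + h * (s / 2)].
Proof.
move=> s0 bps; apply: contrapT => nbad.
have ws : 0 <= w * (s / 2) by rewrite !mulr_ge0// ltW.
have hs : 0 <= h * (s / 2) by rewrite !mulr_ge0// ltW.
pose x1 := p.1 + w * (s / 2); pose y1 := p.2 + h * (s / 2).
have good q : q.1 \in [:: p.1; x1] -> q.2 \in [:: p.2; y1] ->
    `|circulation P Q q.1 q.2 (w * (s / 2)) (h * (s / 2))| <=
    e * (w * (s / 2)) * (h * (s / 2)).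
  move=> q1 q2; rewrite leNgt; apply/negP => bq; apply: nbad; exists q; split => //.
    by move: q1; rewrite !inE => /orP[]/eqP->; rewrite lexx ?lerDl ?ws.
  by move: q2; rewrite !inE => /orP[]/eqP->; rewrite lexx ?lerDl ?hs.
move: bps; rewrite /bad ltNge => /negP; apply.
have -> : w * s = w * (s / 2) + w * (s / 2) by field.
have -> : h * s = h * (s / 2) + h * (s / 2) by field.
rewrite circulation_splitx// !circulation_splity//.
have := good p; have := good (p.1, y1); have := good (x1, p.2); have := good (x1, y1).
rewrite !inE !eqxx ?orbT => /(_ isT isT) A /(_ isT isT) B /(_ isT isT) C /(_ isT isT) D.
move: A B C D; rewrite /x1 /y1 /=.
move: (circulation _ _ _ _ _ _) (circulation _ _ _ _ _ _) (circulation _ _ _ _ _ _)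
  (circulation _ _ _ _ _ _) => c1 c2 c3 c4.
move: (w * _) (h * _) => w' h' A B C D.
rewrite [leRHS](_ : _ = (e * w' * h' + e * w' * h') + (e * w' * h' + e * w' * h')); last by ring.
by apply: le_trans (ler_normD _ _) _; apply: lerD;
   apply: le_trans (ler_normD _ _) _; apply: lerD.
Qed.

Lemma bisection x y : e * w * h < `|circulation P Q x y w h| ->
  exists x0 y0, [/\ x <= x0 <= x + w, y <= y0 <= y + h &
   forall n, exists p, [/\ bad p (2^-1 ^+ n), p.1 <= x0 <= p.1 + w * 2^-1 ^+ n &
     p.2 <= y0 <= p.2 + h * 2^-1 ^+ n]].
Proof.
move=> b0.
have /choice[step stepP] : forall ps : (R * R) * R, exists q, 0 < ps.2 -> bad ps.1 ps.2 ->
  [/\ bad q (ps.2 / 2), ps.1.1 <= q.1 <= ps.1.1 + w * (ps.2 / 2)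
    & ps.1.2 <= q.2 <= ps.1.2 + h * (ps.2 / 2)].
  move=> [p s] /=; have [[s0 b]|nb] := pselect (0 < s /\ bad p s).
    by have [q Hq] := bad_quarter s0 b; exists q.
  by exists p => s0 b; exfalso; apply: nb.
pose fix ps n : R * R := if n is n'.+1 then step (ps n', 2^-1 ^+ n') else (x, y).
have hp n : 0 < 2^-1 ^+ n :> R by rewrite exprn_gt0.
have hS n : 2^-1 ^+ n / 2 = 2^-1 ^+ n.+1 :> R by rewrite exprSr.
have bn n : bad (ps n) (2^-1 ^+ n).
  elim: n => [|n IH]; first by rewrite /bad expr0 !mulr1.
  by have [+ _ _] := stepP (ps n, 2^-1 ^+ n) (hp n) IH; rewrite /= hS.
have [x0 Hx] : exists p, forall n, (ps n).1 <= p <= (ps n).1 + w * 2^-1 ^+ n.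
  apply: nested_intervals; first exact: ltW.
  by move=> n; have [_ + _] := stepP (ps n, 2^-1 ^+ n) (hp n) (bn n); rewrite /= hS.
have [y0 Hy] : exists p, forall n, (ps n).2 <= p <= (ps n).2 + h * 2^-1 ^+ n.
  apply: (@nested_intervals (fun n => (ps n).2)); first exact: ltW.
  by move=> n; have [_ _ +] := stepP (ps n, 2^-1 ^+ n) (hp n) (bn n); rewrite /= hS.
exists x0, y0; split; [by have := Hx 0%N; rewrite expr0 mulr1|by have := Hy 0%N; rewrite expr0 mulr1|].
by move=> n; exists (ps n).
Qed.

End Bisection.

(** Were the circulation non-zero, bisection would give similar rectangles shrinking to a point,
    with circulation above a fixed multiple of their area. Near that point the form is affine and
    closed up to [o] of the distance, so the circulation is [o] of the area. *)
Theorem circulation_eq0 P Q x y w h :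
  continuous2 P -> continuous2 Q -> 0 < w -> 0 < h ->
  (forall x' y', x <= x' <= x + w -> y <= y' <= y + h ->
    exists a b c, differentiable2 P x' y' a (- b) /\ differentiable2 Q x' y' b c) ->
  circulation P Q x y w h = 0.
Proof.
move=> cP cQ w0 h0 diffPQ; apply/eqP; rewrite -normr_le0 leNgt; apply/negP => cgt0.
have wh0 : 0 < w + h by rewrite addr_gt0.
(* Half the circulation per unit of area, which makes the whole rectangle bad. *)
pose e := `|circulation P Q x y w h| / (2 * w * h).
have e0 : 0 < e by rewrite divr_gt0 ?mulr_gt0.
have /(bisection cP cQ w0 h0)[x0 [y0 [Hx Hy H]]] : e * w * h < `|circulation P Q x y w h|.
  rewrite (_ : e * w * h = `|circulation P Q x y w h| / 2); last first.
    by rewrite /e; field; rewrite !gt_eqF.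
  by rewrite ltr_pdivrMr// mulr_natr mulr2n ltrDl.
have [a [b [c [dP dQ]]]] := diffPQ _ _ Hx Hy.
(* With [r = (w + h) * s], the local estimate [2 * (e' * r) * r] is exactly [e] times the area of
   the rectangle at scale [s]. *)
pose e' := e * w * h / (2 * (w + h) ^+ 2).
have e'0 : 0 < e'.
  by apply: divr_gt0; [apply: mulr_gt0 => //; exact: mulr_gt0|apply: mulr_gt0 => //; exact: exprn_gt0].
have [d1 d10 {}dP] := dP _ e'0; have [d2 d20 {}dQ] := dQ _ e'0.
have [n Hn] : exists n, (w + h) * 2^-1 ^+ n < Num.min d1 d2.
  have d0 : 0 < Num.min d1 d2 / (w + h) by rewrite divr_gt0// lt_min d10.
  have [n Hn] : exists n, 2^-1 ^+ n < Num.min d1 d2 / (w + h).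
    have /cvgrPdist_lt/(_ _ d0)[n _ /(_ n (leqnn n))] :=
      @cvg_expr R 2^-1 ltac:(by rewrite ger0_norm// invf_lt1// ltr1n).
    by rewrite sub0r normrN ger0_norm ?exprn_ge0// => ?; exists n.
  by exists n; rewrite mulrC -ltr_pdivlMr.
have [p [bp Hp1 Hp2]] := H n.
move: bp; set s := 2^-1 ^+ n in Hn Hp1 Hp2 *; rewrite ltNge => /negP; apply.
have s0 : 0 < s by rewrite exprn_gt0.
have ws : 0 < w * s by rewrite mulr_gt0.
have hs : 0 < h * s by rewrite mulr_gt0.
rewrite (_ : e * (w * s) * (h * s) = 2 * (e' * (w * s + h * s)) * (w * s + h * s)); last first.
  by rewrite /e'; field; rewrite gt_eqF.
move: Hn; rewrite lt_min mulrDl => /andP[Hn1 Hn2].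
apply: (@circulation_local _ P Q cP cQ _ _ _ _ x0 y0 a b c); try exact: ltW.
move=> x' y' Hx' Hy'.
have X : `|x' - x0| <= w * s by rewrite ler_norml; lra.
have Y : `|y' - y0| <= h * s by rewrite ler_norml; lra.
have XY : e' * (`|x' - x0| + `|y' - y0|) <= e' * (w * s + h * s).
  by rewrite ler_pM2l// lerD.
split; apply: le_trans _ XY.
- by have := dP x' y'; rewrite mulNr opprK; apply; lra.
- by apply: dQ; lra.
Qed.

(* A bounded isolated singularity is harmless: the circulation around a small
   square centred at it tends to [0] with the side. *)
Theorem circulation_eq0_except P Q x0 y0 x y w h :
  continuous2 P -> continuous2 Q ->
  x < x0 < x + w -> y < y0 < y + h ->
  (forall x' y', (x', y') != (x0, y0) ->
    exists a b c, differentiable2 P x' y' a (- b) /\ differentiable2 Q x' y' b c) ->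
  circulation P Q x y w h = 0.
Proof.
move=> cP cQ /andP[Hx1 Hx2] /andP[Hy1 Hy2] diffPQ.
have [d1 d10 bP] := cP x0 y0 1 ltr01; have [d2 d20 bQ] := cQ x0 y0 1 ltr01.
pose M := `|P x0 y0| + `|Q x0 y0| + 1.
have M0 : 0 < M by rewrite ltr_wpDl// addr_ge0.
pose d0 := Num.min (Num.min d1 d2) (Num.min (Num.min (x0 - x) (x + w - x0)) (Num.min (y0 - y) (y + h - y0))).
have d00 : 0 < d0 by rewrite !lt_min; lra.
have key d : 0 < d < d0 -> `|circulation P Q x y w h| <= 8 * M * d.
  rewrite !lt_min => /andP[dp] /andP[/andP[dd1 dd2]].
  move=> /andP[/andP[dx1 dx2] /andP[dy1 dy2]].
  (* Four cuts isolate the square of half side [d] about the singular point; the pieces to the left,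
     to the right, below and above miss that point and contribute nothing. *)
  have zero x1 y1 w1 h1 : 0 < w1 -> 0 < h1 ->
      [|| x0 < x1, x1 + w1 < x0, y0 < y1 | y1 + h1 < y0] ->
      circulation P Q x1 y1 w1 h1 = 0.
    move=> w10 h10 out; apply: circulation_eq0 => // x' y' Hx' Hy'.
    apply: diffPQ; apply/eqP => -[xE yE].
    by case/or4P: out => ?; lra.
  have -> : w = (x0 - d - x) + (2 * d + (x + w - (x0 + d))) by lra.
  rewrite circulation_splitx//; [|lra..]; rewrite zero ?add0r; [|lra..|by apply/or4P; constructor 2; lra].
  rewrite circulation_splitx//; [|lra..]; rewrite (_ : x + (x0 - d - x) = x0 - d); last by lra.
  rewrite [X in _ + X]zero ?addr0; [|lra..|by apply/or4P; constructor 1; lra].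
  have -> : h = (y0 - d - y) + (2 * d + (y + h - (y0 + d))) by lra.
  rewrite circulation_splity//; [|lra..]; rewrite zero ?add0r; [|lra..|by apply/or4P; constructor 4; lra].
  rewrite circulation_splity//; [|lra..]; rewrite (_ : y + (y0 - d - y) = y0 - d); last by lra.
  rewrite [X in _ + X]zero ?addr0; [|lra..|by apply/or4P; constructor 3; lra].
  rewrite (_ : 8 * M * d = 2 * M * (2 * d + 2 * d)); last by ring.
  apply: norm_circulation_le => //; [lra..|move=> x' y' Hx' Hy'].
  have X : `|x' - x0| <= d by rewrite ler_norml; lra.
  have Y : `|y' - y0| <= d by rewrite ler_norml; lra.
  have := bP x' y' (le_lt_trans X dd1) (le_lt_trans Y dd1).
  have := bQ x' y' (le_lt_trans X dd2) (le_lt_trans Y dd2).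
  have := ler_distD 0 (P x' y') (P x0 y0).
  have A := lerB_dist (P x' y') (P x0 y0).
  have B := lerB_dist (Q x' y') (Q x0 y0).
  have := normr_ge0 (P x0 y0); have := normr_ge0 (Q x0 y0).
  by rewrite /M => *; split; lra.
apply/eqP; rewrite -normr_le0; apply/ler_addgt0Pr => e e0; rewrite add0r.
pose d := Num.min (d0 / 2) (e / (8 * M)).
have dp : 0 < d by rewrite lt_min !divr_gt0// mulr_gt0.
have dd0 : d < d0.
  by apply: le_lt_trans (_ : d <= d0 / 2) _; [rewrite ge_min lexx|lra].
have := key d; rewrite dp dd0 => /(_ isT) /le_trans; apply.
by rewrite mulrC -ler_pdivlMr ?mulr_gt0// ge_min lexx orbT.
Qed.

End Goursat.

(** * Complex differentiation *)

Section ComplexDifferentiation.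
Context {R : realType}.
Local Notation C := R[i].
Implicit Types (f g : C -> C) (z w c : C) (e d : R).

(** The norm [|z|] takes its values in [R[i]]; this equivalent one is real-valued, free of square
    roots and still submultiplicative. *)
Definition norm1 z : R := `|complex.Re z| + `|complex.Im z|.

Lemma norm1_ge0 z : 0 <= norm1 z. Proof. by rewrite addr_ge0. Qed.

Lemma norm1_0 : norm1 0 = 0. Proof. by rewrite /norm1/= normr0 addr0. Qed.

Lemma norm1_eq0 z : norm1 z <= 0 -> z = 0.
Proof.
move=> z0; have : norm1 z == 0 by rewrite eq_le z0 norm1_ge0.
rewrite paddr_eq0//= !normr_eq0; case: z {z0} => a b /=.
by move=> /andP[/eqP-> /eqP->].
Qed.

Lemma norm1_gt0 z : z != 0 -> 0 < norm1 z.
Proof. by apply: contra_neqT; rewrite -leNgt => /norm1_eq0. Qed.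

Lemma norm1D z w : norm1 (z + w) <= norm1 z + norm1 w.
Proof.
case: z w => [a b] [c d]; rewrite /norm1/=.
by have := ler_normD a c; have := ler_normD b d; lra.
Qed.

Lemma norm1N z : norm1 (- z) = norm1 z.
Proof. by case: z => a b; rewrite /norm1/= !normrN. Qed.

Lemma norm1B z w : norm1 (z - w) <= norm1 z + norm1 w.
Proof. by rewrite -(norm1N w); exact: norm1D. Qed.

Lemma norm1_distC z w : norm1 (z - w) = norm1 (w - z).
Proof. by rewrite -norm1N opprB. Qed.

Lemma norm1M z w : norm1 (z * w) <= norm1 z * norm1 w.
Proof.
case: z w => [a b] [c d]; rewrite /norm1/=.
have := ler_normB (a * c) (b * d); have := ler_normD (a * d) (b * c).
by rewrite !normrM; nra.
Qed.

Lemma norm1_real (x : R) : norm1 x%:C = `|x|.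
Proof. by rewrite /norm1/= normr0 addr0. Qed.

Lemma norm1_realM (x : R) z : norm1 (x%:C * z) = `|x| * norm1 z.
Proof. by case: z => a b; rewrite /norm1/= !mul0r subr0 addr0 !normrM mulrDr. Qed.

Lemma norm1_iM z : norm1 ('i%C * z) = norm1 z.
Proof. by case: z => a b; rewrite /norm1/= !mul0r !mul1r sub0r add0r normrN addrC. Qed.

Definition ccontinuous_at f z := forall e, 0 < e -> exists2 d : R, 0 < d &
  forall z', norm1 (z' - z) < d -> norm1 (f z' - f z) < e.

Definition cdiff f z c := forall e, 0 < e -> exists2 d : R, 0 < d &
  forall z', norm1 (z' - z) < d ->
    norm1 (f z' - f z - c * (z' - z)) <= e * norm1 (z' - z).

Lemma cdiff_lipschitz f z c : cdiff f z c -> exists2 d : R, 0 < d &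
  forall z', norm1 (z' - z) < d -> norm1 (f z' - f z) <= (norm1 c + 1) * norm1 (z' - z).
Proof.
move=> /(_ 1 ltr01)[d d0 H]; exists d => // z' /H A.
rewrite (_ : f z' - f z = (f z' - f z - c * (z' - z)) + c * (z' - z)); last by ring.
apply: le_trans (norm1D _ _) _; have := norm1M c (z' - z); nra.
Qed.

Lemma cdiff_continuous f z c : cdiff f z c -> ccontinuous_at f z.
Proof.
move=> /cdiff_lipschitz[d d0 H] e e0.
have c0 : 0 < norm1 c + 1 by rewrite ltr_wpDl// norm1_ge0.
exists (Num.min d (e / (norm1 c + 1))); first by rewrite lt_min d0 divr_gt0.
move=> z'; rewrite lt_min ltr_pdivlMr// => /andP[/H A B].
by apply: le_lt_trans A _; rewrite mulrC.
Qed.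

Lemma cdiff_near f g z c e : 0 < e ->
  (forall z', norm1 (z' - z) < e -> f z' = g z') -> cdiff f z c -> cdiff g z c.
Proof.
move=> e0 fg df e' e'0; have [d d0 H] := df e' e'0.
exists (Num.min d e); first by rewrite lt_min d0.
move=> z'; rewrite lt_min => /andP[/H A B].
by rewrite -!fg// subrr norm1_0.
Qed.

Lemma cdiff_cst c z : cdiff (fun=> c) z 0.
Proof.
by move=> e e0; exists 1 => // z' _; rewrite subrr mul0r subr0 norm1_0 mulr_ge0 ?norm1_ge0 ?ltW.
Qed.

Lemma cdiff_id z : cdiff id z 1.
Proof.
by move=> e e0; exists 1 => // z' _; rewrite mul1r subrr norm1_0 mulr_ge0 ?norm1_ge0 ?ltW.
Qed.

Lemma cdiffD f g z a b : cdiff f z a -> cdiff g z b ->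
  cdiff (fun w => f w + g w) z (a + b).
Proof.
move=> df dg e e0; have e2 : 0 < e / 2 by rewrite divr_gt0.
have [d1 d10 H1] := df _ e2; have [d2 d20 H2] := dg _ e2.
exists (Num.min d1 d2); first by rewrite lt_min d10.
move=> z'; rewrite lt_min => /andP[/H1 A /H2 B].
rewrite (_ : f z' + g z' - (f z + g z) - (a + b) * (z' - z) =
  (f z' - f z - a * (z' - z)) + (g z' - g z - b * (z' - z))); last by ring.
by apply: le_trans (norm1D _ _) _; lra.
Qed.

Lemma cdiffM f g z a b : cdiff f z a -> cdiff g z b ->
  cdiff (fun w => f w * g w) z (a * g z + f z * b).
Proof.
move=> df dg e e0.
have [d0 d00 Hg] := cdiff_lipschitz dg.
pose K := norm1 (g z) + 1 + norm1 (f z) + norm1 a * (norm1 b + 1) + 1.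
have Ka : 0 <= norm1 a * (norm1 b + 1) by rewrite mulr_ge0 ?addr_ge0 ?norm1_ge0.
have K0 : 0 < K by rewrite /K; have := norm1_ge0 (g z); have := norm1_ge0 (f z); lra.
pose e' := e / K; have e'0 : 0 < e' by rewrite divr_gt0.
have [d1 d10 H1] := df _ e'0; have [d2 d20 H2] := dg _ e'0.
have [d3 d30 H3] := cdiff_continuous dg ltr01.
exists (Num.min (Num.min d0 d1) (Num.min (Num.min d2 d3) e')).
  by rewrite !lt_min d00 d10 d20 d30 e'0.
move=> z'; rewrite !lt_min => /andP[/andP[/Hg A /H1 B] /andP[/andP[/H2 D /H3 E] F]].
rewrite (_ : _ - _ = (f z' - f z - a * (z' - z)) * g z' +
   (f z * (g z' - g z - b * (z' - z)) + a * (z' - z) * (g z' - g z))); last by ring.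
apply: le_trans (norm1D _ _) _.
apply: le_trans (lerD (norm1M _ _) (norm1D _ _)) _.
apply: le_trans (lerD (lexx _) (lerD (norm1M _ _) (norm1M _ _))) _.
have Gz : norm1 (g z') <= norm1 (g z) + 1.
  by rewrite -[g z'](subrK (g z)); apply: le_trans (norm1D _ _) _; lra.
have AA := norm1M a (z' - z).
set t := norm1 (z' - z) in A B D F AA *.
have t0 : 0 <= t := norm1_ge0 _.
have -> : e * t = e' * t * (norm1 (g z) + 1) + (norm1 (f z) * (e' * t) + norm1 a * t * ((norm1 b + 1) * e')) + e' * t.
  have {1}-> : e = e' * K by rewrite divfK// gt_eqF.
  by rewrite /K; ring.
rewrite -[X in X <= _]addr0 lerD//; last by rewrite mulr_ge0// ltW.
apply: lerD; last apply: lerD.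
- by apply: ler_pM => //; exact: norm1_ge0.
- by rewrite ler_wpM2l// norm1_ge0.
- apply: ler_pM => //; try exact: norm1_ge0.
  apply: le_trans A _; rewrite ler_wpM2l ?addr_ge0 ?norm1_ge0//; exact: ltW.
Qed.

Lemma cdiffZ f z c k : cdiff f z c -> cdiff (fun w => k * f w) z (k * c).
Proof.
by move=> df; have := cdiffM (cdiff_cst k z) df; rewrite mul0r add0r.
Qed.

Lemma cdiffN f z c : cdiff f z c -> cdiff (fun w => - f w) z (- c).
Proof.
move=> df e e0; have [d d0 H] := df e e0; exists d => // z' /H.
by rewrite -norm1N; congr (is_true (norm1 _ <= _)); ring.
Qed.

Lemma cdiffB f g z a b : cdiff f z a -> cdiff g z b ->
  cdiff (fun w => f w - g w) z (a - b).
Proof. by move=> df dg; apply: cdiffD => //; exact: cdiffN. Qed.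

Lemma cdiff_sum (I : Type) (r : seq I) (F : I -> C -> C) (F' : I -> C) z :
  (forall i, cdiff (F i) z (F' i)) ->
  cdiff (fun w => \sum_(i <- r) F i w) z (\sum_(i <- r) F' i).
Proof.
move=> dF; elim: r => [|i r IH].
  rewrite big_nil; apply: (cdiff_near ltr01 _ (cdiff_cst 0 z)) => z' _.
  by rewrite big_nil.
rewrite big_cons; apply: (cdiff_near ltr01 _ (cdiffD (dF i) IH)) => z' _.
by rewrite big_cons.
Qed.

Lemma cdiff_comp f g z a b : cdiff g z a -> cdiff f (g z) b ->
  cdiff (fun w => f (g w)) z (b * a).
Proof.
move=> dg df e e0.
have [d0 d00 Hg] := cdiff_lipschitz dg.
have b0 : 0 < norm1 b + 1 by rewrite ltr_wpDl// norm1_ge0.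
have a0 : 0 < norm1 a + 1 by rewrite ltr_wpDl// norm1_ge0.
pose e1 := e / 2 / (norm1 a + 1); have e10 : 0 < e1 by rewrite !divr_gt0.
pose e2 := e / 2 / (norm1 b + 1); have e20 : 0 < e2 by rewrite !divr_gt0.
have [d1 d10 H1] := df _ e10; have [d2 d20 H2] := dg _ e20.
exists (Num.min (Num.min d0 d2) (d1 / (norm1 a + 1))).
  by rewrite !lt_min d00 d20 divr_gt0.
move=> z'; rewrite !lt_min ltr_pdivlMr// => /andP[/andP[/Hg A /H2 B] D].
have /H1 E : norm1 (g z' - g z) < d1 by apply: le_lt_trans A _; rewrite mulrC.
rewrite (_ : _ - _ = (f (g z') - f (g z) - b * (g z' - g z)) +
   b * (g z' - g z - a * (z' - z))); last by ring.
apply: le_trans (norm1D _ _) _; apply: le_trans (lerD (lexx _) (norm1M _ _)) _.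
set t := norm1 (z' - z) in A B D E *.
have t0 : 0 <= t := norm1_ge0 _.
rewrite (_ : e * t = e1 * ((norm1 a + 1) * t) + (norm1 b + 1) * (e2 * t)); last first.
  by rewrite /e1 /e2; field; rewrite !gt_eqF.
apply: lerD; first by apply: le_trans E _; rewrite ler_pM2l.
by apply: ler_pM => //; rewrite ?norm1_ge0// lerDl.
Qed.

Lemma cdiffV z : z != 0 -> cdiff (fun w => w^-1) z (- z ^- 2).
Proof.
move=> z0 e e0; pose A := norm1 z^-1.
have A0 : 0 < A by rewrite norm1_gt0// invr_eq0.
have nz : 0 < norm1 z := norm1_gt0 z0.
(* The first two radii keep [z'] off [0] and [z'^-1] below [2 * A]; the third makes the remainder
   [z^-2 * z'^-1 * (z' - z)^2] small enough. *)
exists (Num.min (norm1 z) (Num.min ((2 * A)^-1) (e / (2 * A ^+ 3)))).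
  by rewrite !lt_min nz invr_gt0 divr_gt0 ?mulr_gt0 ?exprn_gt0.
move=> z'; rewrite !lt_min => /andP[D0 /andP[D1 D2]].
have z'0 : z' != 0.
  by apply: contraTneq D0 => ->; rewrite sub0r norm1N ltxx.
have inv2 : norm1 z'^-1 <= 2 * A.
  have : norm1 z'^-1 <= A + A * norm1 (z' - z) * norm1 z'^-1.
    rewrite {1}(_ : z'^-1 = z^-1 - z^-1 * (z' - z) * z'^-1); last first.
      by field; rewrite ?z0 ?z'0.
    apply: le_trans (norm1B _ _) _; rewrite lerD2l.
    apply: le_trans (norm1M _ _) _; rewrite ler_wpM2r ?norm1_ge0//.
    exact: norm1M.
  have : A * norm1 (z' - z) <= 2^-1.
    by rewrite mulrC -ler_pdivlMr// -invfM ltW.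
  have := norm1_ge0 z'^-1; nra.
rewrite (_ : _ - _ = z^-1 * z^-1 * z'^-1 * (z' - z) * (z' - z)); last first.
  by field; rewrite ?z0 ?z'0.
apply: le_trans (norm1M _ _) _; rewrite ler_wpM2r ?norm1_ge0//.
apply: le_trans (norm1M _ _) _; apply: le_trans (_ : 2 * A ^+ 3 * norm1 (z' - z) <= _).
  rewrite ler_wpM2r ?norm1_ge0//; apply: le_trans (norm1M _ _) _.
  rewrite (_ : 2 * A ^+ 3 = A * A * (2 * A)); last by ring.
  by apply: ler_pM => //; rewrite ?norm1_ge0//; exact: norm1M.
by rewrite mulrC -ler_pdivlMr ?mulr_gt0 ?exprn_gt0// ltW.
Qed.

Lemma is_derive_le (f : R -> R) (x c : R) : is_derive x 1 f c -> forall e, 0 < e ->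
  exists2 d : R, 0 < d & forall y, `|y - x| < d -> `|f y - f x - c * (y - x)| <= e * `|y - x|.
Proof.
move=> [df dc] e e0.
have /cvgrPdist_le/(_ e e0) : (fun h => h^-1 *: (f (h *: 1 + x) - f x)) @ 0^' --> c.
  by rewrite -dc; exact: df.
move=> /nbhs_normP[d d0 H]; exists d => // y yx.
have [->|yNx] := eqVneq y x; first by rewrite !subrr mulr0 subr0 normr0 mulr0.
have yx0 : y - x != 0 by rewrite subr_eq0.
have := H (y - x); rewrite /= sub0r normrN => /(_ yx yx0).
rewrite (_ : (y - x) *: 1 + x = y); last by rewrite [_ *: _]mulr1 subrK.
rewrite [_ *: _]/(_ * _) => A.
rewrite -normrN -ler_pdivrMr ?normr_gt0// -normrV ?unitfE// -normrM.
suff -> : - (f y - f x - c * (y - x)) / (y - x) = c - (y - x)^-1 * (f y - f x) by [].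
by field.
Qed.

Definition cexp z : C :=
  (expR (complex.Re z) * cos (complex.Im z)) +i*
  (expR (complex.Re z) * sin (complex.Im z)).

Lemma cexpD z w : cexp (z + w) = cexp z * cexp w.
Proof.
case: z w => [a b] [c d]; rewrite /cexp/= expRD cosD sinD.
by congr (_ +i* _); ring.
Qed.

Lemma cexp_real (x : R) : cexp x%:C = (expR x)%:C.
Proof. by rewrite /cexp/= cos0 sin0 mulr1 mulr0. Qed.

Lemma norm1_cexp z : norm1 (cexp z) <= 2 * expR (complex.Re z).
Proof.
have A := expR_ge0 (complex.Re z).
rewrite /norm1/= !normrM ger0_norm// -mulrDr mulrC ler_wpM2r//.
have -> : 2 = 1 + 1 :> R by [].
by apply: lerD; rewrite ler_norml ?cos_geN1 ?cos_le1 ?sin_geN1 ?sin_le1.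
Qed.

Lemma cexp_neq0 z : cexp z != 0.
Proof.
apply/eqP => z0; have : cexp (z + (- z)) = 0 by rewrite cexpD z0 mul0r.
rewrite subrr (_ : 0 = 0%:C)// cexp_real expR0 => -[/eqP].
by rewrite oner_eq0.
Qed.

(** At [0] the real derivatives of [expR], [cos] and [sin] suffice; the addition formula then
    reaches every other point. *)
Lemma cdiff_cexp0 : cdiff cexp 0 1.
Proof.
move=> e e0.
have e8 : 0 < Num.min 1 (e / 8) by rewrite lt_min ltr01 divr_gt0.
have e81 : Num.min 1 (e / 8) <= 1 by rewrite ge_min lexx.
have e82 : Num.min 1 (e / 8) <= e / 8 by rewrite ge_min lexx orbT.
have [d1 d10 H1] := is_derive_le (is_derive_expR 0) e8.
have [d2 d20 H2] := is_derive_le (is_derive_cos 0) e8.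
have [d3 d30 H3] := is_derive_le (is_derive_sin 0) e8.
exists (Num.min (Num.min d1 d2) (Num.min d3 (Num.min 1 (e / 8)))).
  by rewrite !lt_min d10 d20 d30 ltr01 divr_gt0.
case=> x y; rewrite subr0 mul1r !lt_min.
have -> : cexp (x +i* y) - cexp 0 - (x +i* y) =
    (expR x * cos y - 1 - x) +i* (expR x * sin y - y).
  rewrite (_ : 0 = 0%:C)// cexp_real expR0 /cexp/=.
  by apply/eqP; rewrite eq_complex/= subr0 !eqxx.
rewrite /norm1/= => /andP[/andP[L1 L2] /andP[L3 /andP[L4 L5]]].
have X0 := normr_ge0 x; have Y0 := normr_ge0 y.
have := H1 x; have := H2 y; have := H3 y.
rewrite expR0 cos0 sin0 !subr0 oppr0 mul0r subr0 !mul1r.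
set m := Num.min 1 _ in e8 e81 e82 *.
move=> /(_ ltac:(lra)) S /(_ ltac:(lra)) Co /(_ ltac:(lra)) E.
have E' : `|expR x - 1| <= 2 * `|x|.
  rewrite -[expR x - 1](subrK x); apply: le_trans (ler_normD _ _) _; nra.
have Eb : `|expR x| <= 3.
  rewrite -[expR x](subrK 1); apply: le_trans (ler_normD _ _) _; rewrite normr1; lra.
have Sb : `|sin y| <= 1 by rewrite ler_norml sin_geN1 sin_le1.
have P1 : `|expR x * cos y - 1 - x| <= e / 2 * (`|x| + `|y|).
  rewrite (_ : _ - x = expR x * (cos y - 1) + (expR x - 1 - x)); last by ring.
  apply: le_trans (ler_normD _ _) _; rewrite normrM.
  apply: le_trans (_ : 3 * (m * `|y|) + m * `|x| <= _); last by nra.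
  by apply: lerD => //; apply: ler_pM.
have P2 : `|expR x * sin y - y| <= e / 2 * (`|x| + `|y|).
  rewrite (_ : _ - y = (expR x - 1) * sin y + (sin y - y)); last by ring.
  have Sy : `|sin y| <= 2 * `|y|.
    by rewrite -[sin y](subrK y); apply: le_trans (ler_normD _ _) _; nra.
  apply: le_trans (ler_normD _ _) _; rewrite normrM.
  apply: le_trans (_ : 2 * `|x| * (2 * `|y|) + m * `|y| <= _); last by nra.
  by apply: lerD => //; apply: ler_pM.
lra.
Qed.

Lemma cdiff_cexp z : cdiff cexp z (cexp z).
Proof.
have d0 : cdiff (fun w => w - z) z 1.
  by have := cdiffB (cdiff_id z) (cdiff_cst z z); rewrite subr0.
have d1 : cdiff cexp (z - z) 1 by rewrite subrr; exact: cdiff_cexp0.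
have := cdiffZ (cexp z) (cdiff_comp d0 d1); rewrite !mulr1.
by apply: (cdiff_near ltr01) => w _; rewrite -cexpD addrC subrK.
Qed.

Lemma derivable_cdiff (f : C -> C) z :
  derivable (f : C^o -> C^o) z 1 -> exists c, cdiff f z c.
Proof.
move=> df; pose D : C := 'D_1 (f : C^o -> C^o) z; exists D => e e0.
have dfD : (fun h : C => (h^-1 *: (f (h *: (1 : C^o) + z) - f z) : C^o)) @ (0 : C^o)^' --> (D : C^o).
  exact: df.
have e2 : 0 < (e / 2)%:C by rewrite ltcR divr_gt0.
have /cvgrPdist_le/(_ _ e2)/nbhs_normP[[d d'] /= d0 H] := dfD.
(* The radius is a positive element of [R[i]], hence has no imaginary part. *)
move: d0; rewrite ltcE/= => /andP[/eqP d'0 d0]; rewrite {d'}d'0 in H.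
have normE (w : C) : `|w| = (Num.sqrt (complex.Re w ^+ 2 + complex.Im w ^+ 2))%:C.
  by rewrite normc_def.
have le2 (w : C) : norm1 w <= 2 * Num.sqrt (complex.Re w ^+ 2 + complex.Im w ^+ 2).
  have A : `|complex.Re w| <= Num.sqrt (complex.Re w ^+ 2 + complex.Im w ^+ 2).
    by rewrite -sqrtr_sqr ler_sqrt ?addr_ge0 ?sqr_ge0// lerDl sqr_ge0.
  have B : `|complex.Im w| <= Num.sqrt (complex.Re w ^+ 2 + complex.Im w ^+ 2).
    by rewrite -[`|complex.Im w|]sqrtr_sqr ler_sqrt ?addr_ge0 ?sqr_ge0// lerDr sqr_ge0.
  by rewrite /norm1; lra.
have ge2 (w : C) : Num.sqrt (complex.Re w ^+ 2 + complex.Im w ^+ 2) <= norm1 w.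
  rewrite -[leRHS]ger0_norm ?norm1_ge0// -sqrtr_sqr ler_sqrt ?sqr_ge0//.
  rewrite -(real_normK (num_real (complex.Re w))) -(real_normK (num_real (complex.Im w))).
  have := normr_ge0 (complex.Re w); have := normr_ge0 (complex.Im w).
  by rewrite /norm1; nra.
exists d => // z' z'd.
have [->|zz] := eqVneq z' z; first by rewrite !subrr mulr0 subr0 norm1_0 mulr0.
have zz0 : z' - z != 0 by rewrite subr_eq0.
have /= := H (z' - z); rewrite sub0r normrN => /(_ _ zz0).
rewrite (_ : @GRing.scale _ C^o (z' - z) 1 + z = z'); last first.
  by rewrite [_ *: _]mulr1 subrK.
rewrite [_ *: _]/(_ * _) {1}normE ltcR => /(_ (le_lt_trans (ge2 _) z'd)) A.
have -> : f z' - f z - D * (z' - z) = - (D - (z' - z)^-1 * (f z' - f z)) * (z' - z).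
  by field.
apply: le_trans (norm1M _ _) _; rewrite ler_wpM2r ?norm1_ge0// norm1N.
apply: le_trans (le2 _) _; rewrite mulrC -ler_pdivlMr//.
by move: A; rewrite normE lecR.
Qed.

End ComplexDifferentiation.

(** * The two-constants theorem *)

Section CauchyEstimate.
Context {R : realType}.
Local Notation C := R[i].
Implicit Types (f F : C -> C) (z w c : C) (x y e d : R).

Definition entire f := forall z, exists c, cdiff f z c.

Let repart f x y := complex.Re (f (x +i* y)).
Let impart f x y := complex.Im (f (x +i* y)).

Lemma Re_le_norm1 z : `|complex.Re z| <= norm1 z.
Proof. by rewrite lerDl. Qed.

Lemma Im_le_norm1 z : `|complex.Im z| <= norm1 z.
Proof. by rewrite lerDr. Qed.

Lemma ccontinuous_at_continuous2 f : (forall z, ccontinuous_at f z) ->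
  continuous2 (repart f) /\ continuous2 (impart f).
Proof.
move=> cf.
have H x y e : 0 < e -> exists2 d : R, 0 < d & forall x' y', `|x' - x| < d ->
    `|y' - y| < d -> norm1 (f (x' +i* y') - f (x +i* y)) < e.
  move=> e0; have [d d0 H] := cf (x +i* y) e e0.
  exists (d / 2); first by rewrite divr_gt0.
  by move=> x' y' Hx Hy; apply: H; rewrite /norm1/=; lra.
split=> x y e /(H x y)[d d0 {}H]; exists d => // x' y' Hx Hy.
- apply: le_lt_trans (H x' y' Hx Hy); rewrite /repart -raddfB/=.
  exact: Re_le_norm1.
- apply: le_lt_trans (H x' y' Hx Hy); rewrite /impart -raddfB/=.
  exact: Im_le_norm1.
Qed.

(** The Cauchy-Riemann equations, arranged as the closedness condition of [circulation_eq0]. *)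
Lemma cdiff_differentiable2 f x y c : cdiff f (x +i* y) c ->
  differentiable2 (repart f) x y (complex.Re c) (- complex.Im c) /\
  differentiable2 (impart f) x y (complex.Im c) (complex.Re c).
Proof.
move=> df.
have H e : 0 < e -> exists2 d : R, 0 < d & forall x' y', `|x' - x| < d ->
    `|y' - y| < d -> norm1 (f (x' +i* y') - f (x +i* y) - c * ((x' - x) +i* (y' - y)))
       <= e * (`|x' - x| + `|y' - y|).
  move=> e0; have [d d0 H] := df e e0.
  exists (d / 2); first by rewrite divr_gt0.
  by move=> x' y' Hx Hy; apply: (H (x' +i* y')); rewrite /norm1/=; lra.
split=> e /H[d d0 {}H]; exists d => // x' y' Hx Hy; apply: le_trans (H x' y' Hx Hy).
- apply: le_trans (Re_le_norm1 _); rewrite /repart.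
  case: (f _) => a b; case: (f _) => a' b'; case: c {df H} => p q /=.
  by rewrite le_eqVlt; apply/orP; left; apply/eqP; congr (`| _ |); ring.
- apply: le_trans (Im_le_norm1 _); rewrite /impart.
  case: (f _) => a b; case: (f _) => a' b'; case: c {df H} => p q /=.
  by rewrite le_eqVlt; apply/orP; left; apply/eqP; congr (`| _ |); ring.
Qed.

Lemma circulation_holomorphic f z0 x y (w h : R) :
  (forall z, ccontinuous_at f z) -> (forall z, z != z0 -> exists c, cdiff f z c) ->
  x < complex.Re z0 < x + w -> y < complex.Im z0 < y + h ->
  circulation (repart f) (impart f) x y w h = 0.
Proof.
move=> cf df Hx Hy; have [cP cQ] := ccontinuous_at_continuous2 cf.
apply: (circulation_eq0_except cP cQ Hx Hy) => x' y' nz.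
have [|c /cdiff_differentiable2 dc] := df (x' +i* y').
  by apply: contra nz => /eqP <-.
by exists (complex.Re c), (complex.Im c), (complex.Re c).
Qed.

(* The sides of [[-3, 3] x [0, 2]]. *)
Definition bounded_on_sides f (bottom rest : R) :=
  [/\ forall x, -3 <= x <= 3 -> norm1 (f (x +i* 0)) <= bottom,
      forall x, -3 <= x <= 3 -> norm1 (f (x +i* 2)) <= rest,
      forall y, 0 <= y <= 2 -> norm1 (f (3 +i* y)) <= rest &
      forall y, 0 <= y <= 2 -> norm1 (f (-3 +i* y)) <= rest].

Lemma invcE (a b : R) :
  (a +i* b)^-1 = (a / (a ^+ 2 + b ^+ 2)) +i* (- b / (a ^+ 2 + b ^+ 2)).
Proof. by rewrite mulNr. Qed.

Lemma subciE (a b : R) : (a +i* b) - 'i%C = a +i* (b - 1).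
Proof. by apply/eqP; rewrite eq_complex/= subr0 !eqxx. Qed.

(** The difference quotient of [F] at [i]; the removable singularity is to be filled with the
    derivative [c]. *)
Let slope F c := fun z => if z == 'i%C then c else (F z - F 'i%C) / (z - 'i%C).

Let slope_diff F c z : entire F -> z != 'i%C -> exists c', cdiff (slope F c) z c'.
Proof.
move=> /(_ z)[a dF] zi.
have z0 : z - 'i%C != 0 by rewrite subr_eq0.
have d1 : cdiff (fun w => w - 'i%C) z 1.
  by have := cdiffB (cdiff_id z) (cdiff_cst 'i%C z); rewrite subr0.
have d2 : cdiff (fun w => (w - 'i%C)^-1) z _ := cdiff_comp d1 (cdiffV z0).
eexists; apply: cdiff_near (cdiffM (cdiffB dF (cdiff_cst (F 'i%C) z)) d2).
  exact: (norm1_gt0 z0).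
move=> z' Hz'; rewrite /slope ifF//; apply/negbTE; apply: contraTneq Hz' => ->.
by rewrite norm1_distC ltxx.
Qed.

Let slope_continuous F c z : entire F -> cdiff F 'i%C c -> ccontinuous_at (slope F c) z.
Proof.
move=> eF dc; have [->|zi] := eqVneq z 'i%C; last first.
  by have [c' /cdiff_continuous] := slope_diff c eF zi.
move=> e e0; pose e' := e / 4.
have [|d d0 H] := dc e'; first by rewrite divr_gt0.
exists d => // z' Hz'; rewrite {2}/slope eqxx /slope; case: eqVneq => [_|z'i].
  by rewrite subrr norm1_0.
have z0 : z' - 'i%C != 0 by rewrite subr_eq0.
have -> : (F z' - F 'i%C) / (z' - 'i%C) - c =
   (F z' - F 'i%C - c * (z' - 'i%C)) * (z' - 'i%C)^-1 by field.
apply: le_lt_trans (norm1M _ _) _.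
(* The moduli multiply to [1]; the constant comes from [(|a| + |b|)^2 <= 2 (a^2 + b^2)]. *)
have nV : norm1 (z' - 'i%C) * norm1 (z' - 'i%C)^-1 <= 2.
  case: (z' - 'i%C) z0 => a b ab0; rewrite /norm1/=.
  have s0 : 0 < a ^+ 2 + b ^+ 2.
    rewrite lt_neqAle addr_ge0 ?sqr_ge0// andbT eq_sym paddr_eq0 ?sqr_ge0//.
    by move: ab0; rewrite eq_complex/= !sqrf_eq0.
  rewrite normrN !normrM normfV [`|_ + _|]gtr0_norm//.
  rewrite -mulrDl mulrA ler_pdivrMr// -(real_normK (num_real a)) -(real_normK (num_real b)).
  by have := sqr_ge0 (`|a| - `|b|); nra.
apply: le_lt_trans (_ : e' * 2 < _); last by rewrite /e'; lra.
apply: le_trans (ler_wpM2r (norm1_ge0 _) (H _ Hz')) _.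
by rewrite -mulrA ler_wpM2l// divr_ge0// ltW.
Qed.

(** The circulation of the slope vanishes. As the integral of [dz / (z - i)] is [2 pi i], the term
    [F(i) / (z - i)] has circulation [- 2 pi Im F(i)]; it must match the circulation of
    [F z / (z - i)], which [M] bounds. *)
Let cauchy_Im F (M : R) : 0 <= M -> entire F -> bounded_on_sides F M M ->
  `|complex.Im (F 'i%C)| <= 27 * M.
Proof.
move=> M0 eF [Hb Ht Hr Hl]; have [c dc] := eF 'i%C.
have cS z := slope_continuous z eF dc.
have [cP cQ] := ccontinuous_at_continuous2 cS.
have := @circulation_holomorphic (slope F c) 'i%C (-3) 0 6 2 cS
  (fun z => @slope_diff F c z eF) ltac:(by rewrite /=; lra) ltac:(by rewrite /=; lra).
rewrite /circulation add0r (_ : -3 + 6 = 3); last by lra.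
set q := complex.Im (F 'i%C); set p := complex.Re (F 'i%C).
have FiE : F 'i%C = p +i* q by rewrite /p /q; case: (F _).
(* Up to sign, the contributions of [F(i) / (z - i)] to the horizontal and to the vertical sides,
   per unit of [q]. Opposite sides are symmetric about [i], so [p] cancels. *)
pose k1 (t : R) := 2 / (t ^+ 2 + 1); pose k2 (t : R) := 6 / (9 + (t - 1) ^+ 2).
have D1 (t : R) : 0 < t ^+ 2 + 1 by rewrite ltr_wpDl ?sqr_ge0.
have D2 (t : R) : 0 < 9 + (t - 1) ^+ 2 by rewrite ltr_pwDl ?sqr_ge0.
have ck1 : continuous k1.
  move=> t; apply: cvgM; first exact: cvg_cst.
  apply: cvgV; first by rewrite gt_eqF.
  by apply: cvgD; [exact: exprn_continuous|exact: cvg_cst].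
have ck2 : continuous k2.
  move=> t; apply: cvgM; first exact: cvg_cst.
  apply: cvgV; first by rewrite gt_eqF.
  apply: cvgD; first exact: cvg_cst.
  by apply: (@cvg_comp _ _ _ (fun t => t - 1) (fun t => t ^+ 2)); [apply: cvgB; [exact: cvg_id|exact: cvg_cst]|exact: exprn_continuous].
have cqk (k : R -> R) : continuous k -> continuous (fun t => q * k t).
  by move=> ck t; apply: cvgM; [exact: cvg_cst|exact: ck].
have cNqk2 : continuous (fun t => - (q * k2 t)).
  by move=> t; exact: (cvgN (cqk _ ck2 t)).
pose u t := repart (slope F c) t 0 - repart (slope F c) t 2.
pose v t := impart (slope F c) 3 t - impart (slope F c) (-3) t.
have cu : continuous u by exact: (continuous_sub2 (@continuous2_1 _ _ 0 cP) (@continuous2_1 _ _ 2 cP)).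
have cv : continuous v by exact: (continuous_sub2 (@continuous2_2 _ _ 3 cQ) (@continuous2_2 _ _ (-3) cQ)).
rewrite -/u -/v => /eqP.
have -> : segint u (-3) 3 = segint (fun t => u t - q * k1 t) (-3) 3 + segint (fun t => q * k1 t) (-3) 3.
  by rewrite segintB//; [rewrite subrK|exact: cqk].
have -> : segint v 0 2 = segint (fun t => v t - - (q * k2 t)) 0 2 - segint (fun t => q * k2 t) 0 2.
  rewrite -[RHS]segintB//; [|by exact: continuous_sub2|exact: cqk].
  by apply: eq_segint => t _; rewrite opprK addrK.
have segZ (k : R -> R) a b : continuous k -> segint (fun t => q * k t) a b = q * segint k a b.
  by move=> ck; rewrite /segint RintegralZl//; exact: segint_integrable.
rewrite !segZ// => /eqP E.
(* A crude lower bound takes the place of the exact total [2 pi]. The part with [F] is at most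
   [4 M * 6 + 4 M * 2 = 32 M], and [32 / 1.2 < 27]. *)
have kk1 : 12/10 <= segint k1 (-3) 3.
  rewrite (_ : 12/10 = segint (fun=> 2/10) (-3) 3 :> R); last first.
    by rewrite segint_cst; lra.
  apply: le_segint => // [|t Htt]; first exact: cst_continuous.
  rewrite /k1 ler_pdivlMr//; nra.
have kk2 : 0 <= segint k2 0 2.
  by apply: Rintegral_ge0 => t _; rewrite divr_ge0// ltW.
have mulbound z k : norm1 z <= M -> norm1 k <= 2 ->
    `|complex.Re (z * k)| <= 2 * M /\ `|complex.Im (z * k)| <= 2 * M.
  move=> zM k2M; have zk : norm1 (z * k) <= 2 * M.
    by apply: le_trans (norm1M _ _) _; rewrite mulrC; apply: ler_pM; rewrite ?norm1_ge0.
  by split; apply: le_trans zk; [exact: Re_le_norm1|exact: Im_le_norm1].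
have b1 : `|segint (fun t => u t - q * k1 t) (-3) 3| <= 4 * M * (3 - - 3).
  apply: norm_segint_le => //; [by apply: continuous_sub2 => //; exact: cqk|lra|move=> t Htt].
  have Dt := D1 t.
  have E0 : slope F c (t +i* 0) = F (t +i* 0) * ((t / (t ^+ 2 + 1)) +i* (t ^+ 2 + 1)^-1)
      - (p +i* q) * ((t / (t ^+ 2 + 1)) +i* (t ^+ 2 + 1)^-1).
    rewrite /slope ifF; last by apply/negbTE/eqP => -[_ /eqP]; rewrite lt_eqF.
    rewrite FiE mulrBl; suff -> : (t +i* 0 - 'i%C)^-1 = (t / (t ^+ 2 + 1)) +i* (t ^+ 2 + 1)^-1 by [].
    rewrite subciE invcE; congr (_ +i* _); field; lra.
  have E2 : slope F c (t +i* 2) = F (t +i* 2) * ((t / (t ^+ 2 + 1)) +i* - (t ^+ 2 + 1)^-1)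
      - (p +i* q) * ((t / (t ^+ 2 + 1)) +i* - (t ^+ 2 + 1)^-1).
    rewrite /slope ifF; last by apply/negbTE/eqP => -[_ /eqP]; rewrite gt_eqF// ltr1n.
    rewrite FiE mulrBl; suff -> : (t +i* 2 - 'i%C)^-1 = (t / (t ^+ 2 + 1)) +i* - (t ^+ 2 + 1)^-1 by [].
    rewrite subciE invcE; congr (_ +i* _); field; lra.
  have K b : `|b| <= 1 -> norm1 ((t / (t ^+ 2 + 1)) +i* (b * (t ^+ 2 + 1)^-1)) <= 2.
    move=> b1; rewrite /norm1/= !normrM normfV (gtr0_norm Dt) -mulrDl ler_pdivrMr//.
    by rewrite -(real_normK (num_real t)); have := sqr_ge0 (`|t| - 1); nra.
  have := mulbound _ _ (Hb t Htt) (K 1 ltac:(by rewrite normr1)).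
  have := mulbound _ _ (Ht t Htt) (K (-1) ltac:(by rewrite normrN normr1)).
  rewrite mul1r mulN1r /u /repart E0 E2 => -[+ _] [+ _].
  move: (F (t +i* 0) * _) (F (t +i* 2) * _) => [a b] [a' b'] /= A B.
  rewrite (_ : _ - q * _ = a - a'); last by rewrite /k1; field; lra.
  by apply: le_trans (ler_normB _ _) _; lra.
have b2 : `|segint (fun t => v t - - (q * k2 t)) 0 2| <= 4 * M * (2 - 0).
  apply: norm_segint_le => //; [|move=> t Htt].
    by exact: continuous_sub2.
  have Dt := D2 t.
  have E0 a : `|a| = 3 -> slope F c (a +i* t) = F (a +i* t) * ((a / (9 + (t - 1) ^+ 2)) +i* - ((t - 1) / (9 + (t - 1) ^+ 2)))
      - (p +i* q) * ((a / (9 + (t - 1) ^+ 2)) +i* - ((t - 1) / (9 + (t - 1) ^+ 2))).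
    move=> a3; have a9 : a ^+ 2 = 9 by rewrite -(real_normK (num_real a)) a3; ring.
    rewrite /slope ifF; last by apply/negbTE/eqP => -[a0]; move: a3; rewrite a0 normr0; lra.
    rewrite FiE mulrBl; suff -> : (a +i* t - 'i%C)^-1 = (a / (9 + (t - 1) ^+ 2)) +i* - ((t - 1) / (9 + (t - 1) ^+ 2)) by [].
    by rewrite subciE invcE a9 mulNr.
  have K a : `|a| = 3 -> norm1 ((a / (9 + (t - 1) ^+ 2)) +i* - ((t - 1) / (9 + (t - 1) ^+ 2))) <= 2.
    move=> a3; rewrite /norm1/= normrN !normrM normfV (gtr0_norm Dt) -mulrDl ler_pdivrMr// a3.
    have : `|t - 1| <= 1 by rewrite ler_norml; lra.
    by have := sqr_ge0 (t - 1); lra.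
  have n3 : `|-3 : R| = 3 by rewrite normrN ger0_norm.
  have p3 : `|3 : R| = 3 by rewrite ger0_norm.
  have := mulbound _ _ (Hr t Htt) (K _ p3).
  have := mulbound _ _ (Hl t Htt) (K _ n3).
  rewrite /v /impart (E0 _ p3) (E0 _ n3) => -[_ +] [_ +].
  move: (F (3 +i* t) * _) (F (-3 +i* t) * _) => [a b] [a' b'] /= A B.
  rewrite (_ : _ - - _ = b - b'); last by rewrite /k2; field; lra.
  by apply: le_trans (ler_normB _ _) _; lra.
move: b1 b2 E; set U := segint _ _ _; set V := segint _ _ _.
set S1 := segint _ _ _ in kk1 *; set S2 := segint _ _ _ in kk2 *.
rewrite !ler_norml => b1 b2 E.
have E' : q * (S1 + S2) = V - U by rewrite mulrDr; lra.
have [q0|q0] := leP 0 q.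
  have : q * (12/10) <= q * (S1 + S2) by rewrite ler_wpM2l//; lra.
  by lra.
have : - q * (12/10) <= - q * (S1 + S2) by rewrite ler_wpM2l ?oppr_ge0 ?(ltW q0)//; lra.
by lra.
Qed.

(** The real part of [F(i)] is the imaginary part of [i F(i)]. *)
Lemma cauchy_estimate F (M : R) : 0 <= M -> entire F -> bounded_on_sides F M M ->
  norm1 (F 'i%C) <= 54 * M.
Proof.
move=> M0 eF bF; have A := cauchy_Im M0 eF bF.
have eiF : entire (fun z => 'i%C * F z).
  by move=> z; have [c dc] := eF z; exists ('i%C * c); exact: cdiffZ.
have biF : bounded_on_sides (fun z => 'i%C * F z) M M.
  by case: bF => *; split=> *; rewrite norm1_iM; auto.
have := cauchy_Im M0 eiF biF.
rewrite /norm1; case: (F _) A => a b /=; rewrite mul0r mul1r add0r => A B.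
lra.
Qed.

(* Apply the Cauchy estimate to [f] times [exp (- N * (z - 3 i)^2)], whose
   modulus is largest on the bottom side but larger at [i] than on the three
   other ones. *)
Theorem two_constants (A t : R) : 0 <= A -> 0 < t -> exists2 e : R, 0 < e &
  forall f, entire f -> bounded_on_sides f e A -> norm1 (f 'i%C) <= t.
Proof.
move=> A0 t0.
(* The exponent of the factor has real part at most [9 N] on the bottom, at most [N] on the other
   sides and equal to [4 N] at [i]. A bottom bound [exp (- 8 N)] thus brings all sides down to
   [exp N], and the quotient [exp (- 3 N)] is what is gained. The constant is [108 = 54 * 2], from
   [cauchy_estimate] and [norm1_cexp]. *)
have [N HN] : exists N : nat, 108 * (A + 1) * expR (- (3 * N%:R)) <= t.
  exists (Num.truncn (108 * (A + 1) / t)).+1.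
  rewrite expRN ler_pdivrMr ?expR_gt0// -ler_pdivrMl// mulrC; set x := _ / t.
  have : x < (Num.truncn x).+1%:R by exact: truncnS_gt.
  set n := (Num.truncn x).+1%:R => xn.
  have n0 : 0 <= n by rewrite ler0n.
  by have := expR_ge1Dx (3 * n); lra.
exists (expR (- (8 * N%:R))); first exact: expR_gt0.
move=> f ef [Hb Ht Hr Hl].
pose k : C := (N%:R : R)%:C.
pose psi z := - k * ((z - 3 * 'i%C) * (z - 3 * 'i%C)).
have epsi : forall z, exists c, cdiff psi z c.
  move=> z; have d1 := cdiffB (cdiff_id z) (cdiff_cst (3 * 'i%C) z).
  by eexists; exact: cdiffZ (cdiffM d1 d1).
have eF : entire (fun z => f z * cexp (psi z)).
  move=> z; have [a da] := ef z; have [b db] := epsi z.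
  by eexists; apply: cdiffM da (cdiff_comp db (cdiff_cexp _)).
have Repsi x y : complex.Re (psi (x +i* y)) = - N%:R * (x ^+ 2 - (y - 3) ^+ 2).
  rewrite /psi /k (_ : 3 = (3 : R)%:C); last by rewrite rmorph_nat.
  by rewrite /=; ring.
have NN : 0 <= N%:R :> R := ler0n _ _.
have bound z B r : norm1 (f z) <= B -> complex.Re (psi z) <= r ->
    norm1 (f z * cexp (psi z)) <= B * (2 * expR r).
  move=> fB pr; apply: le_trans (norm1M _ _) _; apply: ler_pM; rewrite ?norm1_ge0//.
  by apply: le_trans (norm1_cexp _) _; rewrite ler_wpM2l// ler_expR.
have M0 : 0 <= (A + 1) * (2 * expR N%:R) by rewrite !mulr_ge0 ?expR_ge0//; lra.
have := cauchy_estimate M0 eF.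
have -> : f 'i%C * cexp (psi 'i%C) = (expR (4 * N%:R))%:C * f 'i%C.
  rewrite mulrC; congr (_ * _); rewrite -cexp_real; congr cexp.
  rewrite /psi /k (_ : 3 = (3 : R)%:C); last by rewrite rmorph_nat.
  by apply/eqP; rewrite eq_complex/=; apply/andP; split; apply/eqP; ring.
rewrite norm1_realM ger0_norm ?expR_ge0// => H.
have {}H : expR (4 * N%:R) * norm1 (f 'i%C) <= 54 * ((A + 1) * (2 * expR N%:R)).
  apply: H; split=> x Hx.
  - apply: le_trans (bound _ _ (9 * N%:R) (Hb x Hx) _) _.
      by rewrite Repsi; have := mulr_ge0 NN (sqr_ge0 x); lra.
    rewrite mulrCA -expRD (_ : _ + _ = N%:R); last by ring.
    rewrite ler_peMl// ?mulr_ge0 ?expR_ge0//; lra.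
  - apply: le_trans (bound _ _ N%:R (Ht x Hx) _) _.
      by rewrite Repsi; have := mulr_ge0 NN (sqr_ge0 x); lra.
    by rewrite ler_wpM2r ?mulr_ge0 ?expR_ge0//; lra.
  - apply: le_trans (bound _ _ N%:R (Hr x Hx) _) _.
      rewrite Repsi; have h9 : 0 <= 9 - (x - 3) ^+ 2 by nra.
      by have := mulr_ge0 NN h9; lra.
    by rewrite ler_wpM2r ?mulr_ge0 ?expR_ge0//; lra.
  - apply: le_trans (bound _ _ N%:R (Hl x Hx) _) _.
      rewrite Repsi; have h9 : 0 <= 9 - (x - 3) ^+ 2 by nra.
      by have := mulr_ge0 NN h9; lra.
    by rewrite ler_wpM2r ?mulr_ge0 ?expR_ge0//; lra.
apply: le_trans HN; rewrite -(ler_pM2l (expR_gt0 (4 * N%:R))); apply: le_trans H _.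
rewrite [leRHS](_ : _ = 108 * (A + 1) * (expR (4 * N%:R) * expR (- (3 * N%:R)))); last by ring.
rewrite -expRD (_ : 4 * N%:R + _ = N%:R); last by ring.
by rewrite le_eqVlt; apply/orP; left; apply/eqP; ring.
Qed.

End CauchyEstimate.

(** * Lattice sums and residue classes *)

Section LatticeSums.

Fixpoint zrange (N : nat) : seq int :=
  if N is N'.+1 then [:: N%:Z, - N%:Z & zrange N'] else [:: 0].

Lemma mem_zrange N (k : int) : (k \in zrange N) = (`|k| <= N%:Z).
Proof.
elim: N => [|N IH] /=; first by rewrite inE; lia.
by rewrite !inE IH; lia.
Qed.

Lemma zrange_uniq N : uniq (zrange N).
Proof.
elim: N => [//|N IH] /=; rewrite IH inE !mem_zrange negb_or andbT.
by apply/and3P; split; lia.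
Qed.

Definition box N : seq (int * int) := [seq (i, j) | i <- zrange N, j <- zrange N].

Lemma mem_box N (i : int * int) :
  (i \in box N) = (`|i.1| <= N%:Z) && (`|i.2| <= N%:Z).
Proof.
case: i => i j; apply/allpairsP/andP => [[[a b]] /= [Ha Hb [-> ->]]|[Hi Hj]].
  by rewrite !mem_zrange in Ha Hb.
by exists (i, j); rewrite !mem_zrange.
Qed.

Lemma box_uniq N : uniq (box N).
Proof. by apply: allpairs_uniq; [exact: zrange_uniq..|move=> [? ?] [? ?] _ _ [-> ->]]. Qed.

Lemma eq_big_support (V : nmodType) (I : choiceType) (s t : seq I) (G : I -> V) :
  uniq s -> uniq t -> (forall x, G x != 0 -> (x \in s) = (x \in t)) ->
  \sum_(x <- s) G x = \sum_(x <- t) G x.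
Proof.
move=> us ut H.
have E r : \sum_(x <- r) G x = \sum_(x <- [seq x <- r | G x != 0]) G x.
  rewrite big_filter [RHS]big_mkcond; apply: eq_bigr => x _.
  by case: eqVneq.
rewrite E [RHS]E; apply: perm_big; apply: uniq_perm; [exact: filter_uniq..|].
by move=> x; rewrite !mem_filter; case: (boolP (G x != 0)) => // /H ->.
Qed.

(** Given [u q + v M = 1], the representative [w] is the residue of [x u]. *)
Lemma residue_decomposition (M q : nat) (x : int) : coprime q M -> (0 < M)%N ->
  exists (i : int) (w : nat), (w < M)%N /\ x = M%:Z * i + q%:Z * w%:Z.
Proof.
move=> cqM M0; have /coprimezP[[u v] /= uv] : coprimez q%:Z M%:Z by [].
have M0' : M%:Z != 0 by rewrite eqz_nat -lt0n.
have E := divz_eq (x * u) M%:Z.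
have := modz_ge0 (x * u) M0'; have := ltz_pmod (x * u) (_ : 0 < M%:Z).
move=> /(_ ltac:(by [])); case: (_ %% _)%Z E => // w E wM _.
exists (q%:Z * ((x * u) %/ M%:Z)%Z + x * v), w; split; first by [].
move: E; move: (_ %/ _)%Z => k E.
transitivity (x * u * q%:Z + x * v * M%:Z); first by rewrite -!mulrA -mulrDr uv mulr1.
by rewrite E; ring.
Qed.

Lemma residue_unique (M q : nat) (i i' : int) (w w' : nat) : coprime q M ->
  (w < M)%N -> (w' < M)%N ->
  M%:Z * i + q%:Z * w%:Z = M%:Z * i' + q%:Z * w'%:Z -> i = i' /\ w = w'.
Proof.
move=> cqM wM w'M E.
have D : (M%:Z %| q%:Z * (w%:Z - w'%:Z))%Z.
  by apply/dvdzP; exists (i' - i); move: E; lia.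
have {}D : (M%:Z %| w%:Z - w'%:Z)%Z.
  by rewrite -(@Gauss_dvdzr _ q%:Z) // coprimez_sym.
have ww : w = w'.
  case/dvdzP: D => k Hk; have K : k = 0 \/ k <= -1 \/ 1 <= k by lia.
  by case: K => [?|[?|?]]; nia.
split => //; move: E; rewrite ww => /addIr /mulfI; apply.
by rewrite eqz_nat -lt0n; apply: leq_ltn_trans wM.
Qed.

Definition offsets (M : nat) : seq (nat * nat) := [seq (a, b) | a <- iota 0 M, b <- iota 0 M].

(** As [q] varies this runs through an arithmetic progression that starts at [M i] and has step [w];
    along it the finite differences are taken. At [q = 0] the offset disappears and only multiples
    of [M] remain. *)
Definition dilate (M q : nat) (i : int * int) (w : nat * nat) : int * int :=
  (M%:Z * i.1 + q%:Z * w.1%:Z, M%:Z * i.2 + q%:Z * w.2%:Z).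

Lemma mem_offsets M w : (w \in offsets M) = (w.1 < M)%N && (w.2 < M)%N.
Proof.
case: w => a b; apply/allpairsP/andP => [[[a' b']] /= [Ha Hb [-> ->]]|[Ha Hb]].
  by move: Ha Hb; rewrite !mem_iota.
by exists (a, b); rewrite !mem_iota.
Qed.

Lemma offsets_uniq M : uniq (offsets M).
Proof. by apply: allpairs_uniq; [exact: iota_uniq..|move=> [? ?] [? ?] _ _ [-> ->]]. Qed.

Lemma size_offsets M : size (offsets M) = (M * M)%N.
Proof. by rewrite size_allpairs !size_iota. Qed.

Definition supported (V : nmodType) N (G : int * int -> V) :=
  forall x, G x != 0 -> x \in box N.

(** The margin [q * M] is for the quotients: a point [M i + q w] of [box N] has
    [|i| <= N + q * M]. *)
Lemma sum_dilate (V : nmodType) M q N N' (G : int * int -> V) :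
  coprime q M -> (0 < M)%N -> supported N G -> (N + q * M <= N')%N ->
  \sum_(i <- box N') \sum_(w <- offsets M) G (dilate M q i w) = \sum_(j <- box N) G j.
Proof.
move=> cqM M0 sG NN'.
have bound (i y : int) (w : nat) : y = M%:Z * i + q%:Z * w%:Z -> `|y| <= N%:Z ->
    (w < M)%N -> `|i| <= N'%:Z.
  move=> -> yN wM; have qw : (q * w <= q * M)%N by rewrite leq_mul2l ltnW ?orbT.
  have iM : `|i| <= M%:Z * `|i| by rewrite ler_peMl//; lia.
  by move: iM; rewrite -[M%:Z]ger0_norm// -normrM; lia.
rewrite -(big_allpairs_dep (h := dilate M q) (r2 := fun=> offsets M)).
apply: eq_big_support; last 2 first.
- exact: box_uniq.
- move=> x Gx; rewrite (sG x Gx); apply/allpairsPdep.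
  have := sG x Gx; rewrite mem_box => /andP[x1 x2].
  have [i1 [w1 [w1M E1]]] := residue_decomposition x.1 cqM M0.
  have [i2 [w2 [w2M E2]]] := residue_decomposition x.2 cqM M0.
  exists (i1, i2), (w1, w2); split; last by rewrite [x]surjective_pairing E1 E2.
  + by rewrite mem_box /=; apply/andP; split; [exact: (bound _ _ _ E1)|exact: (bound _ _ _ E2)].
  + by rewrite mem_offsets w1M.
- apply: allpairs_uniq; [exact: box_uniq|exact: offsets_uniq|].
  move=> [[i1 i2] [w1 w2]] [[j1 j2] [v1 v2]] /allpairsP[[i w] /= [_ Hw [? ?]]].
  move=> /allpairsP[[j v] /= [_ Hv [? ?]]] [E1 E2]; subst.
  move: Hw Hv; rewrite !mem_offsets => /andP[Hw1 Hw2] /andP[Hv1 Hv2].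
  move: (residue_unique cqM Hw1 Hv1 E1) (residue_unique cqM Hw2 Hv2 E2) => /=.
  by move=> [-> ->] [-> ->].
Qed.

(** * Summable bounds and finite differences *)

Section RealSums.
Context {R : realType}.

(** The correction [- 2 / (N + 1)] lets the induction close: two new terms [(1 + x)^-2] are at most
    [2 / x - 2 / (1 + x)]. *)
Lemma sum_inv_sq_zrange N :
  \sum_(k <- zrange N) ((1 + `|k|%N%:R) ^- 2 : R) <= 4 - 2 / N.+1%:R.
Proof.
elim: N => [|N IH]; first by rewrite big_seq1 absz0 addr0 expr1n invr1 ?mulr1; lra.
rewrite /= !big_cons abszN absz_nat addrA.
set x : R := N.+1%:R; have x0 : 0 < x by rewrite ltr0n.
have -> : N.+2%:R = 1 + x :> R by rewrite -natr1 addrC.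
apply: le_trans (lerD (lexx _) IH) _.
rewrite -subr_ge0 (_ : _ - _ = 2 / (x * (1 + x) ^+ 2)); last first.
  by rewrite /x; field; rewrite -/x; lra.
by rewrite divr_ge0// mulr_ge0 ?sqr_ge0// ltW.
Qed.

(** A product of functions of one coordinate, so that its sum over a box factors. *)
Definition decay (i : int * int) : R :=
  ((1 + `|i.1|%N%:R) * (1 + `|i.2|%N%:R)) ^- 2.

Lemma decay_gt0 i : 0 < decay i.
Proof. by rewrite invr_gt0 exprn_gt0// mulr_gt0// ltr_wpDr. Qed.

Lemma sum_decay_le N : \sum_(i <- box N) decay i <= 16.
Proof.
rewrite big_allpairs_dep (eq_bigr (fun i : int => (1 + `|i|%N%:R) ^- 2 *
    \sum_(k <- zrange N) (1 + `|k|%N%:R) ^- 2)); last first.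
  move=> i _; rewrite big_distrr; apply: eq_bigr => j _.
  by rewrite /decay/= exprMn invfM.
rewrite -big_distrl/=; set S := \sum_(_ <- _) _.
have S0 : 0 <= S by apply: sumr_ge0 => k _; rewrite invr_ge0 exprn_ge0// addr_ge0.
have S4 : S <= 4.
  by apply: le_trans (sum_inv_sq_zrange N) _; rewrite lerBlDr lerDl divr_ge0.
by rewrite (_ : 16 = 4 * 4); [exact: ler_pM|ring].
Qed.

Lemma norm_sum_decay_le N (t : int * int -> R) C : 0 <= C ->
  (forall i, i \in box N -> `|t i| <= C * decay i) ->
  `|\sum_(i <- box N) t i| <= 16 * C.
Proof.
move=> C0 H; apply: le_trans (ler_norm_sum _ _ _) _.
apply: (@le_trans _ _ (\sum_(i <- box N) C * decay i)).
  by rewrite big_seq [leRHS]big_seq; apply: ler_sum.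
by rewrite -big_distrr/= mulrC ler_wpM2r// sum_decay_le.
Qed.

Fixpoint fdiff n (phi : R -> R) (t : R) : R :=
  if n is n'.+1 then fdiff n' phi (t + 1) - fdiff n' phi t else phi t.

(** These are the signed binomial coefficients. In [lattice_defectE] the term [q = 0] gives the sum
    over multiples of [M] and every other term the whole sum, so only the first coefficient and the
    vanishing total matter. *)
Lemma fdiff_coef n : exists a : nat -> R, [/\ a 0%N = (-1) ^+ n,
   (0 < n)%N -> \sum_(q < n.+1) a q = 0 &
   forall phi t, fdiff n phi t = \sum_(q < n.+1) a q * phi (t + q%:R)].
Proof.
suff [a [a0 an an1]] : exists a : nat -> R, [/\ a 0%N = (-1) ^+ n,
   (forall q, (n < q)%N -> a q = 0) &
   forall phi t, fdiff n phi t = \sum_(q < n.+1) a q * phi (t + q%:R)].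
  exists a; split=> // n0; have := an1 (fun=> 1) 0.
  under [in RHS]eq_bigr do rewrite mulr1.
  move=> <-; suff : forall t, fdiff n (fun=> 1) t = 0 by apply.
  elim: n n0 {a a0 an an1} => // -[|n] IH _ t; first by rewrite /= subrr.
  change (fdiff n.+1 (fun=> 1) (t + 1) - fdiff n.+1 (fun=> 1) t = 0).
  by rewrite !IH ?subrr.
elim: n => [|n [a [a0 an IH]]].
  exists (fun q => (q == 0%N)%:R); split; [by []|by case|move=> phi t].
  by rewrite big_ord1 /= mul1r addr0.
exists (fun q => (if q is q'.+1 then a q' else 0) - a q); split.
- by rewrite a0 sub0r exprS mulN1r.
- by case=> // q nq; rewrite !an ?subrr//; exact: ltnW.
- move=> phi t /=; rewrite !IH.
  under [in RHS]eq_bigr do rewrite mulrBl.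
  rewrite sumrB [in X in _ = X - _]big_ord_recl/= mul0r add0r [in X in _ = _ - X]big_ord_recr/=.
  rewrite [a n.+1]an// mul0r addr0; congr (_ - _); apply: eq_bigr => i _.
  by rewrite /bump/= add1n -addrA [1 + _]addrC natr1.
Qed.

Definition lattice_defect (M N : nat) (G : int * int -> R) : R :=
  \sum_(j <- box N) G j - M%:R ^+ 2 * \sum_(i <- box N) G (dilate M 0 i (0%N, 0%N)).

(* Each residue class is reached once by [M i + q w] when [q] is prime to [M],
   so that the [q]-th terms of the differences add up to the whole sum. *)
Lemma lattice_defectE M N N' n (G : int * int -> R) (a : nat -> R) :
  (0 < n)%N -> (0 < M)%N -> (forall q, (0 < q <= n)%N -> coprime q M) ->
  supported N G -> (N + n * M <= N')%N ->
  a 0%N = (-1) ^+ n -> \sum_(q < n.+1) a q = 0 ->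
  lattice_defect M N G = - (-1) ^+ n * \sum_(i <- box N') \sum_(w <- offsets M)
      \sum_(q < n.+1) a q * G (dilate M q i w).
Proof.
move=> n0 M0 cop sG NN' a0 aS.
have E q : \sum_(i <- box N') \sum_(w <- offsets M) a q * G (dilate M q i w) =
    a q * \sum_(i <- box N') \sum_(w <- offsets M) G (dilate M q i w).
  by rewrite big_distrr; apply: eq_bigr => i _; rewrite big_distrr.
have -> : \sum_(i <- box N') \sum_(w <- offsets M) \sum_(q < n.+1) a q * G (dilate M q i w)
   = \sum_(q < n.+1) \sum_(i <- box N') \sum_(w <- offsets M) a q * G (dilate M q i w).
  rewrite [RHS]exchange_big; apply: eq_bigr => i _.
  by rewrite exchange_big.
rewrite big_ord_recl E.
have -> : \sum_(i <- box N') \sum_(w <- offsets M) G (dilate M 0 i w) =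
   M%:R ^+ 2 * \sum_(i <- box N) G (dilate M 0 i (0%N, 0%N)).
  rewrite (eq_bigr (fun i => M%:R ^+ 2 * G (dilate M 0 i (0%N, 0%N)))); last first.
    move=> i _; rewrite (eq_bigr (fun=> G (dilate M 0 i (0%N, 0%N)))).
      by rewrite big_const_seq count_predT size_offsets iter_addr_0 -natrX mulr_natl mulnn.
    by move=> w _; rewrite /dilate !mul0r.
  rewrite -big_distrr/=; congr (_ * _); apply: eq_big_support; rewrite ?box_uniq//.
  move=> x /sG; rewrite !mem_box /dilate/= => /andP[A B].
  have shrink (i : int) : `|M%:Z * i + 0%:Z * 0%:Z| <= N%:Z -> `|i| <= N%:Z.
    rewrite mul0r addr0 normrM; apply: le_trans; rewrite ler_peMl//; lia.
  apply/idP/idP => _; apply/andP; split; try exact: shrink.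
  - by have := shrink _ A; lia.
  - by have := shrink _ B; lia.
rewrite (eq_bigr (fun i : 'I_n => a (lift ord0 i) * \sum_(j <- box N) G j)); last first.
  move=> q _; rewrite E (sum_dilate _ _ sG)//.
  - by apply: cop; exact: ltn_ord.
  - by apply: leq_trans NN'; rewrite leq_add2l leq_mul2r lift0 ltn_ord orbT.
rewrite -big_distrl/=.
have -> : \sum_(i < n) a (bump 0 i) = - (-1) ^+ n.
  by apply/eqP; rewrite -subr_eq0 opprK -a0 addrC; move: aS; rewrite big_ord_recl => ->.
have s2 : (-1) ^+ n * (-1) ^+ n = 1 :> R by rewrite -expr2 sqrr_sign.
rewrite a0 /lattice_defect; move: (\sum_(j <- _) G j) (M%:R ^+ 2 * _) => A B.
by rewrite [RHS](_ : _ = (-1) ^+ n * (-1) ^+ n * (A - B)); [rewrite s2 mul1r|ring].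
Qed.

End RealSums.
End LatticeSums.

(** * Symbol estimates *)

Section SymbolClass.
Context {R : realType}.
Variables (L : Type) (r : L -> R) (T : R).
Hypothesis r1 : forall l, 1 <= r l.
Implicit Types (f g : L -> R -> R) (k : int) (n : nat) (t : R).

Lemma is_derive_mul (f g : R -> R) (t a b : R) : is_derive t 1 f a ->
  is_derive t 1 g b -> is_derive t 1 (fun s => f s * g s) (a * g t + f t * b).
Proof.
move=> fa gb; have := is_deriveM fa gb.
by rewrite /GRing.scale/= addrC [g t * a]mulrC.
Qed.

Lemma is_derive_inv (f : R -> R) (t a : R) : f t != 0 -> is_derive t 1 f a ->
  is_derive t 1 (fun s => (f s)^-1) (- (a * ((f t)^-1 * (f t)^-1))).
Proof.
move=> f0 fa; apply: is_derive_eq (is_deriveV f0 fa) _.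
rewrite [LHS](_ : _ = - (f t) ^- 2 * a)//; by field.
Qed.

(* [f] is of order [k] with respect to the weight [r], uniformly in the
   parameter: its [j]-th derivative on [[0, T]] is [O(r ^ (k - j))] for
   [j <= n]. *)
Fixpoint symbol n k f : Prop :=
  (exists C : R, forall l t, 0 <= t <= T -> `|f l t| <= C * r l ^ k) /\
  (if n is n'.+1 then exists2 f' : L -> R -> R, (forall l t, 0 <= t <= T -> is_derive t 1 (f l) (f' l t))
     & symbol n' (k - 1) f' else True).

Let r0 l : 0 < r l. Proof. exact: lt_le_trans (r1 l). Qed.

Let rk0 l k : 0 < r l ^ k. Proof. exact: exprz_gt0. Qed.

Lemma symbol_bound n k f : symbol n k f ->
  exists2 C : R, 0 < C & forall l t, 0 <= t <= T -> `|f l t| <= C * r l ^ k.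
Proof.
move=> fn; have [C H] : exists C : R, forall l t, 0 <= t <= T -> `|f l t| <= C * r l ^ k.
  by case: n fn => [|n] [].
exists (`|C| + 1); first by rewrite ltr_wpDl.
move=> l t /H/le_trans; apply; rewrite ler_pM2r//.
by apply: le_trans (ler_norm _) _; rewrite lerDl.
Qed.

Lemma symbolS n k f : symbol n.+1 k f -> symbol n k f.
Proof.
elim: n k f => [|n IH] k f; first by case.
by case=> bf [f' df /IH sf']; split=> //; exists f'.
Qed.

Lemma symbolD n k f g : symbol n k f -> symbol n k g ->
  symbol n k (fun l t => f l t + g l t).
Proof.
elim: n k f g => [|n IH] k f g sf sg;
  have [C C0 H] := symbol_bound sf; have [D D0 H'] := symbol_bound sg.
all: have B : exists C : R, forall l t, 0 <= t <= T -> `|f l t + g l t| <= C * r l ^ k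
  by exists (C + D) => l t tT; apply: le_trans (ler_normD _ _) _;
     rewrite mulrDl lerD ?H ?H'.
  by split.
case: sf => _ [f' df sf']; case: sg => _ [g' dg sg']; split=> //.
exists (fun l t => f' l t + g' l t); last exact: IH.
by move=> l t tT; exact: (is_deriveD (df l t tT) (dg l t tT)).
Qed.

Lemma symbolM n k k' f g : symbol n k f -> symbol n k' g ->
  symbol n (k + k') (fun l t => f l t * g l t).
Proof.
elim: n k k' f g => [|n IH] k k' f g sf sg;
  have [C C0 H] := symbol_bound sf; have [D D0 H'] := symbol_bound sg.
all: have B : exists C : R, forall l t, 0 <= t <= T -> `|f l t * g l t| <= C * r l ^ (k + k')
  by exists (C * D) => l t tT; rewrite normrM expfzDr ?gt_eqF// mulrACA;
     apply: ler_pM => //; [exact: H|exact: H'].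
  by split.
have sf0 := symbolS sf; have sg0 := symbolS sg.
case: sf => _ [f' df sf']; case: sg => _ [g' dg sg']; split=> //.
exists (fun l t => f' l t * g l t + f l t * g' l t).
  by move=> l t tT; exact: (is_derive_mul (df l t tT) (dg l t tT)).
apply: symbolD.
- by rewrite (_ : k + k' - 1 = (k - 1) + k'); [exact: IH|lia].
- by rewrite (_ : k + k' - 1 = k + (k' - 1)); [exact: IH|lia].
Qed.

Lemma symbol0 n k : symbol n k (fun _ _ => 0).
Proof.
elim: n k => [|n IH] k.
all: have B : exists C : R, forall l t, 0 <= t <= T -> `|0 : R| <= C * r l ^ k
  by exists 0 => l t _; rewrite normr0 mul0r.
  by split.
by split=> //; exists (fun _ _ => 0) => // l t _; exact: is_derive_cst.
Qed.

Lemma symbol_cst n (c : L -> R) (C : R) : (forall l, `|c l| <= C) ->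
  symbol n 0 (fun l _ => c l).
Proof.
move=> H; have B : exists C : R, forall l t, 0 <= t <= T -> `|c l| <= C * r l ^ (0 : int).
  by exists C => l t _; rewrite expr0z mulr1.
case: n => [|n]; split=> //; exists (fun _ _ => 0); last exact: symbol0.
by move=> l t _; exact: is_derive_cst.
Qed.

Lemma symbolZ n k (c : L -> R) (C : R) f : (forall l, `|c l| <= C) -> symbol n k f ->
  symbol n k (fun l t => c l * f l t).
Proof. by move=> /(symbol_cst n) sc sf; have := symbolM sc sf; rewrite add0r. Qed.

Lemma symbolX n k f j : symbol n k f -> symbol n (k * j%:Z) (fun l t => f l t ^+ j).
Proof.
move=> sf; elim: j => [|j IH].
  by rewrite mulr0; apply: (@symbol_cst _ _ 1) => l; rewrite normr1.
rewrite (_ : k * j.+1%:Z = k + k * j%:Z); last by lia.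
under eq_fun do under eq_fun do rewrite exprS.
exact: symbolM.
Qed.

Lemma symbol_affine n (x y : L -> R) (C D : R) :
  (forall l t, 0 <= t <= T -> `|x l + t * y l| <= C * r l) ->
  (forall l, `|y l| <= D) -> symbol n 1 (fun l t => x l + t * y l).
Proof.
move=> Hx Hy.
have B : exists C : R, forall l t, 0 <= t <= T -> `|x l + t * y l| <= C * r l ^ (1 : int).
  by exists C => l t /Hx; rewrite expr1z.
case: n => [|n]; split=> //; exists (fun l _ => y l); last first.
  by rewrite subrr; exact: symbol_cst Hy.
move=> l t _.
have := is_deriveD (is_derive_cst (x l) t 1) (is_derive_mul (is_derive_id t 1) (is_derive_cst (y l) t 1)).
by rewrite add0r mulr0 addr0 mul1r.
Qed.

Lemma symbolV n k f (c : R) : 0 < c -> (forall l t, 0 <= t <= T -> c * r l ^ k <= f l t) ->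
  symbol n k f -> symbol n (- k) (fun l t => (f l t)^-1).
Proof.
move=> c0 fc.
have f0 l t : 0 <= t <= T -> 0 < f l t.
  by move=> tT; apply: lt_le_trans (fc _ _ tT); rewrite mulr_gt0.
have B : exists C : R, forall l t, 0 <= t <= T -> `|(f l t)^-1| <= C * r l ^ (- k).
  exists c^-1 => l t tT; rewrite normfV gtr0_norm ?f0// -invr_expz -invfM.
  by rewrite lef_pV2 ?fc// posrE ?f0// mulr_gt0.
elim: n => [|n IH]; first by split.
move=> sf; have sV := IH (symbolS sf); case: sf => _ [f' df sf']; split=> //.
exists (fun l t => -1 * (f' l t * ((f l t)^-1 * (f l t)^-1))).
  move=> l t tT; rewrite mulN1r.
  exact: is_derive_inv (lt0r_neq0 (f0 l t tT)) (df l t tT).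
apply: (@symbolZ _ _ _ 1); first by move=> l; rewrite normrN normr1.
rewrite (_ : - k - 1 = (k - 1) + (- k + - k)); last by lia.
by apply: symbolM => //; exact: symbolM.
Qed.

(* Real and imaginary parts of [q ^ (a + i b)]. *)
Lemma symbol_power n q (a b : L -> R) (A c : R) (K : int) : 0 < c ->
  (forall l t, 0 <= t <= T -> c * r l ^+ 2 <= q l t) -> symbol n 2 q ->
  (forall l, `|a l| <= A) -> (forall l, `|b l| <= A) ->
  (forall l, 2 * a l <= K%:~R) ->
  symbol n K (fun l t => expR (a l * ln (q l t)) * cos (b l * ln (q l t))) /\
  symbol n K (fun l t => expR (a l * ln (q l t)) * sin (b l * ln (q l t))).
Proof.
move=> c0 qc sq aA bA aK.
have q0 l t : 0 <= t <= T -> 0 < q l t.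
  by move=> tT; apply: lt_le_trans (qc _ _ tT); rewrite mulr_gt0// exprn_gt0.
have [D D0 qD] := symbol_bound sq.
(* As [q] lies between two multiples of [r ^ 2], the power [q ^ a] is at most a multiple of
   [r ^ (2 a)], and [r >= 1] allows the integer exponent [K]. *)
have [M MH] : exists M, forall l t, 0 <= t <= T -> expR (a l * ln (q l t)) <= M * r l ^ K.
  exists (expR (A * (`|ln c| + `|ln D|))) => l t tT.
  have rln : 0 <= ln (r l) by rewrite ln_ge0.
  have r2 : 0 < r l ^+ 2 by rewrite exprn_gt0.
  have q1 : ln c + 2 * ln (r l) <= ln (q l t).
    rewrite mulr_natl -lnXn// -lnM ?posrE// ler_ln ?posrE ?mulr_gt0 ?q0//; exact: qc.
  have q2 : ln (q l t) <= ln D + 2 * ln (r l).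
    rewrite mulr_natl -lnXn// -lnM ?posrE// ler_ln ?posrE ?mulr_gt0 ?q0//.
    by apply: le_trans (qD l t tT); rewrite ler_norm.
  have -> : r l ^ K = expR (K%:~R * ln (r l)).
    have rE : r l = expR (ln (r l)) by rewrite lnK ?posrE.
    case: K {aK} => j; first by rewrite [_%:~R]/(j%:R) expRM_natl -rE.
    by rewrite NegzE mulrNz mulNr expRN -[_%:~R]/(j.+1%:R) expRM_natl -rE -exprnN.
  rewrite -expRD ler_expR.
  rewrite -[ln (q l t)](subrK (2 * ln (r l))) mulrDr; apply: lerD; last first.
    by rewrite mulrA [a l * 2]mulrC ler_wpM2r.
  apply: le_trans (ler_norm _) _; rewrite normrM; apply: ler_pM => //.
  have := ler_norm (ln D); have := ler_norm (- ln c); rewrite normrN => ? ?.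
  have := normr_ge0 (ln D); have := normr_ge0 (ln c).
  by move=> *; rewrite ler_norml; apply/andP; split; lra.
have B (v : R -> R) : (forall x, `|v x| <= 1) -> exists C : R, forall l t, 0 <= t <= T ->
   `|expR (a l * ln (q l t)) * v (b l * ln (q l t))| <= C * r l ^ K.
  move=> v1; exists M => l t tT; rewrite normrM -[leRHS]mulr1; apply: ler_pM => //.
  by rewrite ger0_norm ?expR_ge0// MH.
have Bc := B cos (fun x => ltac:(by rewrite ler_norml cos_geN1 cos_le1)).
have Bs := B sin (fun x => ltac:(by rewrite ler_norml sin_geN1 sin_le1)).
elim: n sq => [|n IH] sq; first by split; split.
have [sc ss] := IH (symbolS sq).
have sV := @symbolV n 2 q c c0 qc (symbolS sq).
case: sq => _ [q' dq sq'].
have dlnq l t : 0 <= t <= T -> is_derive t 1 (fun s => ln (q l s)) (q' l t * (q l t)^-1).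
  move=> tT; have := is_derive1_comp (is_derive1_ln (q0 l t tT)) (dq l t tT).
  by rewrite mulrC.
have dZ l t (e : L -> R) : 0 <= t <= T ->
    is_derive t 1 (fun s => e l * ln (q l s)) (e l * (q' l t * (q l t)^-1)).
  move=> tT; have := is_derive_mul (is_derive_cst (e l) t 1) (dlnq l t tT).
  by rewrite mul0r add0r.
(* The logarithmic derivative [q' / q] has order [1 - 2 = - 1]. It multiplies combinations of both
   functions, which is why the two are treated together. *)
have sE (e1 e2 : L -> R) (u v : L -> R -> R) : (forall l, `|e1 l| <= A) -> (forall l, `|e2 l| <= A) ->
   symbol n K u -> symbol n K v ->
   symbol n (K - 1) (fun l t => q' l t * (q l t)^-1 * (e1 l * u l t + e2 l * v l t)).
  move=> He1 He2 su sv.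
  rewrite (_ : K - 1 = (2 - 1) + (- 2) + K); last by lia.
  apply: symbolM; first exact: symbolM.
  by apply: symbolD; [exact: symbolZ He1 su|exact: symbolZ He2 sv].
split; split=> //.
- exists (fun l t => q' l t * (q l t)^-1 *
     (a l * (expR (a l * ln (q l t)) * cos (b l * ln (q l t))) +
      - b l * (expR (a l * ln (q l t)) * sin (b l * ln (q l t))))); last first.
    by apply: sE => // l; rewrite normrN.
  move=> l t tT.
  apply: is_derive_eq (is_derive_mul (is_derive1_comp (is_derive_expR _) (dZ l t a tT))
    (is_derive1_comp (is_derive_cos _) (dZ l t b tT))) _.
  by rewrite /=; ring.
- exists (fun l t => q' l t * (q l t)^-1 *
     (a l * (expR (a l * ln (q l t)) * sin (b l * ln (q l t))) +
      b l * (expR (a l * ln (q l t)) * cos (b l * ln (q l t))))); last first.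
    exact: sE.
  move=> l t tT.
  apply: is_derive_eq (is_derive_mul (is_derive1_comp (is_derive_expR _) (dZ l t a tT))
    (is_derive1_comp (is_derive_sin _) (dZ l t b tT))) _.
  by rewrite /=; ring.
Qed.

(* By the mean value theorem an [n]-th difference is an [n]-th derivative. *)
Lemma symbol_fdiff n k f : n%:R <= T -> symbol n k f ->
  exists2 C : R, 0 < C & forall l, `|fdiff n (f l) 0| <= C * r l ^ (k - n%:Z).
Proof.
move=> nT sf.
suff [C C0 H] : exists2 C : R, 0 < C &
    forall l t, 0 <= t <= T - n%:R -> `|fdiff n (f l) t| <= C * r l ^ (k - n%:Z).
  by exists C => // l; apply: H; rewrite lexx subr_ge0.
elim: n k f nT sf => [|n IH] k f nT sf.
  by have [C C0 H] := symbol_bound sf; exists C => // l t; rewrite subr0 (_ : k - 0%:Z = k); [exact: H|lia].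
case: sf => _ [f' df sf'].
have nT' : n%:R <= T by apply: le_trans nT; rewrite ler_nat.
have [C C0 H] := IH _ _ nT' sf'; exists C => // l t; rewrite -natr1 => tT.
have dF (s : R) : 0 <= s <= T - n%:R -> is_derive s 1 (fdiff n (f l)) (fdiff n (f' l) s).
  elim: n {IH nT nT' sf' H tT} s (f l) (f' l) (df l) => [|n IH] s g g' dg sT.
    by apply: dg; rewrite subr0 in sT.
  have nn : n.+1%:R = n%:R + 1 :> R by rewrite -natr1.
  have d1 : is_derive s 1 (fdiff n g) (fdiff n g' s) by apply: IH => //; lra.
  have d2 : is_derive (s + 1) 1 (fdiff n g) (fdiff n g' (s + 1)) by apply: IH => //; lra.
  have d3 : is_derive s 1 (fun x => x + 1) (1 : R).
    by have := is_deriveD (is_derive_id s 1) (is_derive_cst (1 : R) s 1); rewrite addr0.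
  have := is_deriveB (@is_derive1_comp _ (fdiff n g) (fun x => x + 1) s _ _ d2 d3) d1.
  by rewrite mulr1.
have t1 : t <= t + 1 by rewrite lerDl.
have dx x : x \in `]t, t + 1[ -> is_derive x 1 (fdiff n (f l)) (fdiff n (f' l) x).
  by rewrite in_itv/= => xt; apply: dF; lra.
have cx : {within `[t, t + 1], continuous (fdiff n (f l))}.
  apply: derivable_within_continuous => x; rewrite in_itv/= => xt.
  by apply: ex_derive; apply: dF; lra.
have [x] := MVT_segment t1 dx cx.
rewrite in_itv/= => xt /= ->.
rewrite addrAC subrr add0r mulr1 (_ : k - n.+1%:Z = k - 1 - n%:Z); last by lia.
by apply: H; lra.
Qed.

End SymbolClass.

(** * The cutoff function along lines *)

Section CutoffLines.
Context {R : realType}.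
Variables (eta : R * R -> R) (a : R).
Hypothesis eta_smooth : smooth eta.
Hypothesis eta_supp : closure [set u | eta u != 0] `<=` [set u | `|u| <= a].
Implicit Types (u v w : R * R) (j n : nat).

Definition iter_derive v j : R * R -> R := foldr (fun v g => 'D_v g) eta (nseq j v).

Lemma differentiable_iter_derive v j u : differentiable (iter_derive v j) u.
Proof. exact: eta_smooth. Qed.

Lemma iter_derive_out v j u : a < `|u| -> iter_derive v j u = 0.
Proof.
elim: j u => [|j IH] u au.
  rewrite /iter_derive/=; apply/eqP; apply: contraTT au => e0; rewrite -leNgt; apply: eta_supp.
  exact: subset_closure.
change ('D_v (iter_derive v j) u = 0).
have [->|v0] := eqVneq v 0.
  by rewrite derive0.
rewrite (@near_eq_derive _ _ _ _ (cst 0)) ?derive_cst//.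
have : \forall u' \near u, a < `|u'|.
  exact: (cvgr_gt _ (@norm_continuous _ _ u) _ au).
by apply: filterS => u' /IH.
Qed.

Lemma iter_derive_bounded v j : exists2 C : R, 0 < C & forall u, `|iter_derive v j u| <= C.
Proof.
have cK : compact ([set` `[-a, a]%R] `*` [set` `[-a, a]%R] : set (R * R)).
  by apply: compact_setX; exact: segment_compact.
have : compact (iter_derive v j @` ([set` `[-a, a]%R] `*` [set` `[-a, a]%R])).
  apply: continuous_compact cK; apply: continuous_subspaceT => u.
  exact/differentiable_continuous/differentiable_iter_derive.
move=> /compact_bounded[M [_ HM]].
exists (`|M| + 1); first by rewrite ltr_wpDl.
move=> u; have [au|ua] := ltP a `|u|.
  by rewrite iter_derive_out// normr0 addr_ge0.
apply: (HM (`|M| + 1)); first by rewrite (le_lt_trans (ler_norm _))// ltrDl.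
exists u => //; move: ua; rewrite prod_normE ge_max => /andP[/= u1 u2].
by split; rewrite /= in_itv/= -ler_norml.
Qed.

Lemma is_derive_line (g : R * R -> R) u v t : differentiable g (u + t *: v) ->
  is_derive t 1 (fun s => g (u + s *: v)) ('D_v g (u + t *: v)).
Proof.
move=> dg.
have E : (fun h : R => h^-1 *: ((fun s => g (u + s *: v)) (h *: 1 + t) - g (u + t *: v))) =
   (fun h : R => h^-1 *: ((g \o shift (u + t *: v)) (h *: v) - g (u + t *: v))).
  apply/funext => h /=; congr (_ *: (g _ - _)).
  by rewrite [h *: 1]mulr1 scalerDl addrCA.
by split; rewrite /derivable /derive/= E//; exact: diff_derivable.
Qed.

Section Family.
Variables (L : Type) (r : L -> R) (T c : R) (h : L -> R) (x : L -> R * R) (w : R * R).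
Hypotheses (r1 : forall l, 1 <= r l) (c0 : 0 < c) (h0 : forall l, 0 < h l).
Hypothesis xr : forall l t, 0 <= t <= T -> c * r l <= `|x l + t *: w|.

(** This makes the estimates uniform in [h]: differentiating [eta (h u)] along a line brings out a
    factor [h], and on the support [h * r] is bounded, so each such factor is worth [r^-1]. *)
Lemma symbol_cutoff n j : symbol r T n (- j%:Z)
  (fun l t => h l ^+ j * iter_derive w j (h l *: (x l + t *: w))).
Proof.
have B m : exists C : R, forall l t, 0 <= t <= T ->
    `|h l ^+ m * iter_derive w m (h l *: (x l + t *: w))| <= C * r l ^ (- m%:Z).
  have [C C0 HC] := iter_derive_bounded w m.
  exists ((`|a| / c) ^+ m * C) => l t tT.
  have rl0 : 0 < r l by exact: lt_le_trans (r1 l).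
  have [au|ua] := ltP a `|h l *: (x l + t *: w)|.
    rewrite iter_derive_out// mulr0 normr0 !mulr_ge0 ?exprn_ge0 ?divr_ge0// ?ltW//.
    exact: exprz_gt0.
  rewrite normrM mulrAC; apply: ler_pM => //.
  have hr : h l <= `|a| / c * (r l)^-1.
    rewrite ler_pdivlMr// ler_pdivlMr// -mulrA [r l * c]mulrC.
    apply: le_trans (ler_norm a); apply: le_trans ua.
    by rewrite normrZ gtr0_norm// ler_pM2l// xr.
  rewrite -invr_expz -exprnP -exprVn -exprMn ger0_norm ?exprn_ge0 ?(ltW (h0 l))//.
  by apply: lerXn2r => //; rewrite nnegrE ?(ltW (h0 l))// (le_trans (ltW (h0 l)) hr).
elim: n j => [|n IH] j; first by split.
split=> //; exists (fun l t => h l ^+ j.+1 * iter_derive w j.+1 (h l *: (x l + t *: w))); last first.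
  by rewrite (_ : - j%:Z - 1 = - j.+1%:Z); [exact: IH|lia].
move=> l t tT.
have dg := @is_derive_line (iter_derive w j) (h l *: x l) (h l *: w) t (differentiable_iter_derive _ _ _).
have E s : h l *: (x l + s *: w) = h l *: x l + s *: (h l *: w).
  by rewrite scalerDr !scalerA [s * _]mulrC.
under eq_fun do rewrite E.
rewrite E; apply: is_derive_eq (is_derive_mul (is_derive_cst (h l ^+ j) t 1) dg) _.
rewrite mul0r add0r [RHS](_ : _ = h l ^+ j.+1 * 'D_w (iter_derive w j) (h l *: x l + t *: (h l *: w)))//.
rewrite !deriveE; [|exact: differentiable_iter_derive..].
by rewrite linearZ/= exprSr mulrA.
Qed.

End Family.
End CutoffLines.

(** * A bound for the defect, uniform in the scale, the form and the exponent *)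

Section DefectBound.
Context {R : realType}.
Variables (eta : R * R -> R) (a : R).
Hypothesis eta_smooth : smooth eta.
Hypothesis eta_supp : closure [set u | eta u != 0] `<=` [set u | `|u| <= a].

(* With [v] equal to [cos] or [sin], the real or imaginary part of the term with
   the complex power [Q ^ (al + i be)]. *)
Definition summand (p q : nat) (E F G al be : R) (v : R -> R) (h : R) (u : R * R) : R :=
  u.1 ^+ p * u.2 ^+ q *
  (expR (al * ln (qform E F G u)) * v (be * ln (qform E F G u))) * eta (h *: u).

(** The origin is excluded because there [summand] depends on the convention for [ln 0]. *)
Definition at_lattice (f : R * R -> R) (i : int * int) : R :=
  if i == (0, 0) then 0 else f (lattice_pt i).

Definition weight (i : int * int) : nat := maxn `|i.1|%N `|i.2|%N.

Lemma norm_lattice_pt i : `|lattice_pt i : R * R| = (weight i)%:R.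
Proof.
rewrite prod_normE /lattice_pt/= /weight -!intr_norm -!natr_absz.
case: (leqP `|i.1|%N `|i.2|%N) => H.
  by apply/max_idPr; rewrite ler_nat.
by apply/max_idPl; rewrite ler_nat ltnW.
Qed.

Lemma weight_gt0 i : i != (0, 0) -> (0 < weight i)%N.
Proof. by case: i => i j; rewrite /weight xpair_eqE/=; lia. Qed.

Lemma decay_ge (W : nat) i : (weight i <= W)%N -> (1 + W%:R) ^- 4 <= decay i :> R.
Proof.
rewrite /weight geq_max => /andP[i1 i2]; rewrite /decay lef_pV2 ?posrE ?exprn_gt0 ?mulr_gt0 ?ltr_wpDr//.
rewrite (_ : _ ^+ 4 = ((1 + W%:R) * (1 + W%:R)) ^+ 2); last by ring.
apply: lerXn2r; rewrite ?nnegrE ?mulr_ge0 ?addr_ge0//.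
by apply: ler_pM; rewrite ?addr_ge0// lerD2l ler_nat.
Qed.

Section Family.
Variables (L : Type) (E F G al be h : L -> R) (c B A : R) (K : int) (p q : nat) (v : R -> R).
Hypotheses (c0 : 0 < c) (Hq : forall l u, c * `|u| ^+ 2 <= qform (E l) (F l) (G l) u).
Hypotheses (EB : forall l, `|E l| <= B) (FB : forall l, `|F l| <= B) (GB : forall l, `|G l| <= B).
Hypotheses (alA : forall l, `|al l| <= A) (beA : forall l, `|be l| <= A).
Hypothesis alK : forall l, 2 * al l <= K%:~R.
Hypothesis h0 : forall l, 0 < h l.
Hypothesis vcs : v = cos \/ v = sin.

Let f l := summand p q (E l) (F l) (G l) (al l) (be l) v (h l).

Section Far.
Variables (M n : nat) (w : nat * nat).
Hypotheses (n0 : (0 < n)%N) (M0 : (0 < M)%N) (wM : (w.1 < M)%N && (w.2 < M)%N).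

Let w' : R * R := (w.1%:R, w.2%:R).
(** The lattice point joins the parameter of the family, so that symbol bounds become uniform in it.
    From weight [2 n] on, the displacement [t w], at most [n M], is at most half of [M |i|], and the
    segment keeps a distance from the origin comparable to [|i|]. *)
Let far := {li : L * (int * int) | (2 * n <= weight li.2)%N}.
Let r (l : far) : R := (weight (sval l).2)%:R.
Let x (l : far) : R * R := M%:R *: lattice_pt (sval l).2.

Let r1 l : 1 <= r l.
Proof. by rewrite ler1n; apply: leq_trans (svalP l); rewrite muln_gt0. Qed.

Let rn l : 2 * n%:R <= r l.
Proof. by rewrite -natrM ler_nat (svalP l). Qed.

Let norm_w : `|w'| <= M%:R.
Proof.
case/andP: wM => w1 w2; rewrite prod_normE/= ge_max !ger0_norm// !ler_nat.
by rewrite (ltnW w1) (ltnW w2).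
Qed.

Let norm_x l : `|x l| = M%:R * r l.
Proof. by rewrite normrZ normr_nat norm_lattice_pt. Qed.

Let norm_tw t : 0 <= t <= n%:R -> `|t *: w'| <= n%:R * M%:R.
Proof.
move=> /andP[t0 tn]; rewrite normrZ ger0_norm//.
by apply: ler_pM.
Qed.

Let lower l t : 0 <= t <= n%:R -> 2^-1 * r l <= `|x l + t *: w'|.
Proof.
move=> tn; have := norm_tw tn; have := rn l; have := r1 l.
have := lerB_normD (x l) (t *: w'); rewrite norm_x.
have : 1 <= M%:R :> R by rewrite ler1n.
by move: `|_ + _| `|_ *: _| (r l) (M%:R) (n%:R) => N1 N2 rr m nn; nra.
Qed.

Let upper l t : 0 <= t <= n%:R -> `|x l + t *: w'| <= 2 * M%:R * r l.
Proof.
move=> tn; have := norm_tw tn; have := rn l; have := r1 l.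
have := ler_normD (x l) (t *: w'); rewrite norm_x.
have : 1 <= M%:R :> R by rewrite ler1n.
by move: `|_ + _| `|_ *: _| (r l) (M%:R) (n%:R) => N1 N2 rr m nn; nra.
Qed.

Let fst_le (u : R * R) : `|u.1| <= `|u|. Proof. by rewrite prod_normE le_max lexx. Qed.
Let snd_le (u : R * R) : `|u.2| <= `|u|. Proof. by rewrite prod_normE le_max lexx orbT. Qed.

Let symbol_summand m : symbol r n%:R m (p%:Z + q%:Z + K)
  (fun l t => f (sval l).1 (x l + t *: w')).
Proof.
have sx : symbol r n%:R m 1 (fun l t => (x l).1 + t * w'.1).
  apply: (@symbol_affine _ _ r _ m (fun l => (x l).1) (fun=> w'.1) (2 * M%:R) M%:R) => [l t /(upper l)|l].
    by apply: le_trans; exact: (fst_le (x l + t *: w')).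
  exact: le_trans norm_w.
have sy : symbol r n%:R m 1 (fun l t => (x l).2 + t * w'.2).
  apply: (@symbol_affine _ _ r _ m (fun l => (x l).2) (fun=> w'.2) (2 * M%:R) M%:R) => [l t /(upper l)|l].
    by apply: le_trans; exact: (snd_le (x l + t *: w')).
  exact: le_trans norm_w.
have sQ : symbol r n%:R m 2 (fun l t => qform (E (sval l).1) (F (sval l).1) (G (sval l).1) (x l + t *: w')).
  rewrite /qform; apply: symbolD => //; first apply: symbolD => //.
  - apply: (symbolZ r1 (C := B)) => [l|]; first exact: EB.
    exact: (symbolX r1 2 sx).
  - under eq_fun do under eq_fun do rewrite -!mulrA.
    apply: (symbolZ r1 (C := 2)) => [l|]; first by rewrite ger0_norm.
    apply: (symbolZ r1 (C := B)) => [l|]; first exact: FB.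
    exact: (symbolM r1 sx sy).
  - apply: (symbolZ r1 (C := B)) => [l|]; first exact: GB.
    exact: (symbolX r1 2 sy).
have Qlow (l : far) t : 0 <= t <= n%:R ->
    c / 4 * r l ^+ 2 <= qform (E (sval l).1) (F (sval l).1) (G (sval l).1) (x l + t *: w').
  move=> tn; apply: le_trans (Hq _ _); rewrite -mulrA ler_pM2l//.
  have := lower l tn; have := r1 l; move: `|_ + _| (r l) => N rr; nra.
have c4 : 0 < c / 4 by rewrite divr_gt0.
have [sc ss] := @symbol_power R far r n%:R r1 m _ (fun l => al (sval l).1) (fun l => be (sval l).1)
  A (c / 4) K c4 Qlow sQ (fun l => alA _) (fun l => beA _) (fun l => alK _).
have se := @symbol_cutoff R eta a eta_smooth eta_supp far r n%:R 2^-1 (fun l => h (sval l).1) x w'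
  r1 ltac:(by []) (fun l => h0 _) lower m 0.
have sv : symbol r n%:R m K (fun l t =>
   expR (al (sval l).1 * ln (qform (E (sval l).1) (F (sval l).1) (G (sval l).1) (x l + t *: w'))) *
   v (be (sval l).1 * ln (qform (E (sval l).1) (F (sval l).1) (G (sval l).1) (x l + t *: w')))).
  by case: vcs => ->.
have := symbolM r1 (symbolM r1 (symbolM r1 (symbolX r1 p sx) (symbolX r1 q sy)) sv) se.
rewrite oppr0 addr0 !mul1r.
by under eq_fun do under eq_fun do rewrite expr0 mul1r.
Qed.

(** An [n]-th difference of a symbol of order [p + q + K] has order at most [- 4], and [|i|^-4] is
    summable over the plane lattice. *)
Let far_bound (coef : nat -> R) :
  (forall phi t, fdiff n phi t = \sum_(j < n.+1) coef j * phi (t + j%:R)) ->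
  p%:Z + q%:Z + K + 4 <= n%:Z ->
  exists2 C : R, 0 < C & forall l i, (2 * n <= weight i)%N ->
    `|\sum_(j < n.+1) coef j * at_lattice (f l) (dilate M j i w)| <= C * decay i.
Proof.
move=> Hc kn; have [C C0 HC] := symbol_fdiff r1 (lexx _) (symbol_summand n).
exists (C * 16); first by rewrite mulr_gt0.
move=> l i iW; pose li : far := exist _ (l, i) iW.
have := HC li; rewrite Hc /r/= => H.
rewrite (eq_bigr (fun j : 'I_n.+1 => coef j * f l (M%:R *: lattice_pt i + (0 + j%:R) *: w'))); last first.
  move=> j _; congr (_ * _); rewrite add0r.
  have E1 : lattice_pt (dilate M j i w) = M%:R *: lattice_pt i + j%:R *: w' :> R * R.
    rewrite /lattice_pt /dilate/= !rmorphD/= !rmorphM/=.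
    by congr (_, _).
  rewrite /at_lattice -E1 ifF//; apply/negbTE/eqP => D0.
  (* The progression avoids the origin, so the exceptional value of [at_lattice] never occurs. *)
  have jn : 0 <= (j%:R : R) <= n%:R by rewrite ler0n ler_nat -ltnS ltn_ord.
  have := lower li jn; rewrite /x/= -E1 D0 /r/=.
  have := r1 li; rewrite /r/=.
  have -> : `|lattice_pt (0, 0) : R * R| = 0.
    by rewrite norm_lattice_pt /weight/= maxnn.
  by lra.
apply: le_trans H _; rewrite -mulrA ler_pM2l//.
have W1 : 1 <= (weight i)%:R :> R by have := r1 li.
apply: le_trans (_ : (weight i)%:R ^ (- 4 : int) <= _); first by rewrite ler_weXz2l//; lia.
have D : 16 * (1 + (weight i)%:R) ^- 4 <= 16 * decay i :> R by rewrite ler_pM2l// decay_ge.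
apply: le_trans D.
have W0 : 0 < (weight i)%:R :> R by lra.
have W0' : 0 < 1 + (weight i)%:R :> R by lra.
rewrite -invr_expz -exprnP ler_pdivlMr ?exprn_gt0// mulrC ler_pdivrMr ?exprn_gt0//.
have -> : 16 * (weight i)%:R ^+ 4 = (2 * (weight i)%:R) ^+ 4 :> R by ring.
by apply: lerXn2r; rewrite ?nnegrE ?addr_ge0 ?mulr_ge0//; lra.
Qed.

(** Finitely many points need no cancellation, only uniformity in the parameter. All arguments
    satisfy [1 <= |u| <= 3 n M], where [Q] lies between positive constants. *)
Let near_bound (coef : nat -> R) : exists2 C : R, 0 < C & forall l i, (weight i < 2 * n)%N ->
    `|\sum_(j < n.+1) coef j * at_lattice (f l) (dilate M j i w)| <= C * decay i.
Proof.
have [D D0 HD] := iter_derive_bounded eta_smooth eta_supp 0 0.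
pose W : nat := (3 * n * M)%N.
pose Y := expR (A * (`|ln c| + `|ln (4 * (B + 1) * W%:R ^+ 2)|)).
pose X := W%:R ^+ p * W%:R ^+ q * Y * D.
have X0 : 0 <= X by rewrite mulr_ge0 ?(ltW D0)// mulr_ge0 ?expR_ge0// mulr_ge0 ?exprn_ge0.
pose S := \sum_(j < n.+1) `|coef j|.
have S0 : 0 <= S by apply: sumr_ge0.
have n20 : 0 < (1 + (2 * n)%:R) ^+ 4 :> R by rewrite exprn_gt0// ltr_wpDr.
exists ((S * X + 1) * (1 + (2 * n)%:R) ^+ 4).
  by rewrite mulr_gt0// ltr_wpDl// mulr_ge0.
move=> l i iW; apply: (@le_trans _ _ (S * X)); last first.
  rewrite -mulrA; apply: (@le_trans _ _ ((S * X + 1) * 1)); first by lra.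
  rewrite ler_wpM2l//; first by rewrite addr_ge0// mulr_ge0.
  by rewrite -ler_pdivrMl// mulr1; apply: decay_ge; exact: ltnW.
apply: le_trans (ler_norm_sum _ _ _) _; rewrite /S big_distrl/=; apply: ler_sum => j _.
rewrite normrM ler_wpM2l// /at_lattice; case: eqVneq => [_|nz]; first by rewrite normr0.
set u := lattice_pt _.
have u1 : 1 <= `|u| by rewrite norm_lattice_pt ler1n weight_gt0.
have uW : `|u| <= W%:R.
  rewrite norm_lattice_pt ler_nat /weight /dilate/= /W.
  have jn : (j <= n)%N by rewrite -ltnS.
  move: iW wM; rewrite /weight; move: (nat_of_ord j) jn => j' jn.
  case: (i) (w) => [i1 i2] [w1 w2] /= iW /andP[w1M w2M].
  have T (i' : int) (k : nat) : (`|i'| < 2 * n)%N -> (k < M)%N ->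
     (`|(M%:Z * i' + j'%:Z * k%:Z)%R| <= 3 * n * M)%N.
    move=> H1 H2; have H3 : (j' * k <= n * M)%N by rewrite leq_mul// ltnW.
    have H4 : (M * `|i'| <= M * (2 * n))%N by rewrite leq_mul2l ltnW ?orbT.
    by have := leqD_dist (M%:Z * i' + j'%:Z * k%:Z) (M%:Z * i') 0; rewrite !subr0 addrAC subrr add0r !abszM; lia.
  by rewrite geq_max !T//; lia.
have Q1 : c <= qform (E l) (F l) (G l) u.
  by apply: le_trans (Hq l u); rewrite ler_peMr ?(ltW c0)// expr_ge1.
have Q2 : qform (E l) (F l) (G l) u <= 4 * (B + 1) * W%:R ^+ 2.
  have T e s t : `|e| <= B -> `|s| <= `|u| -> `|t| <= `|u| -> e * (s * t) <= (B + 1) * W%:R ^+ 2.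
    move=> eB su tu; apply: le_trans (ler_norm _) _; rewrite !normrM expr2.
    apply: ler_pM => //; first by rewrite (le_trans eB)// lerDl.
    by apply: ler_pM => //; apply: le_trans uW.
  have := T _ _ _ (EB l) (fst_le u) (fst_le u); have := T _ _ _ (FB l) (fst_le u) (snd_le u).
  have := T _ _ _ (GB l) (snd_le u) (snd_le u).
  rewrite /qform !expr2 -!mulrA; move: ((B + 1) * _) => z.
  by move: (E l * _) (F l * _) (G l * _) => e f' g; lra.
rewrite /f /summand normrM; apply: ler_pM; rewrite ?HD//.
rewrite normrM; apply: ler_pM => //.
  rewrite normrM !normrX; apply: ler_pM; rewrite ?exprn_ge0//;
    apply: lerXn2r; rewrite ?nnegrE//; apply: le_trans uW; [exact: fst_le|exact: snd_le].
rewrite normrM -[Y]mulr1; apply: ler_pM => //; last first.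
  by case: vcs => ->; rewrite ler_norml ?cos_geN1 ?cos_le1 ?sin_geN1 ?sin_le1.
have Q0 := lt_le_trans c0 Q1.
rewrite ger0_norm ?expR_ge0// ler_expR; apply: le_trans (ler_norm _) _; rewrite normrM.
apply: ler_pM => //.
have L1 : ln c <= ln (qform (E l) (F l) (G l) u) by rewrite ler_ln.
have L2 : ln (qform (E l) (F l) (G l) u) <= ln (4 * (B + 1) * W%:R ^+ 2).
  by rewrite ler_ln ?posrE// (lt_le_trans Q0).
have := ler_norm (ln (4 * (B + 1) * W%:R ^+ 2)); have := ler_norm (- ln c); rewrite normrN => ? ?.
have := normr_ge0 (ln (4 * (B + 1) * W%:R ^+ 2)); have := normr_ge0 (ln c).
by move=> *; rewrite ler_norml; apply/andP; split; lra.
Qed.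

Lemma block_bound (coef : nat -> R) :
  (forall phi t, fdiff n phi t = \sum_(j < n.+1) coef j * phi (t + j%:R)) ->
  p%:Z + q%:Z + K + 4 <= n%:Z ->
  exists2 C : R, 0 < C & forall l i,
    `|\sum_(j < n.+1) coef j * at_lattice (f l) (dilate M j i w)| <= C * decay i.
Proof.
move=> Hc kn; have [C C0 HC] := far_bound Hc kn; have [D D0 HD] := near_bound coef.
exists (C + D); first exact: addr_gt0.
move=> l i; rewrite mulrDl; have d0 : 0 < decay i :> R := decay_gt0 i.
case: (leqP (2 * n) (weight i)) => [/HC|/HD] /(_ l)/le_trans; apply.
  by rewrite lerDl mulr_ge0// ltW.
by rewrite lerDr mulr_ge0// ltW.
Qed.

End Far.

Lemma supported_at_lattice l N : a <= N%:R * h l -> supported N (at_lattice (f l)).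
Proof.
move=> aN i; rewrite /at_lattice; case: (eqVneq i (0, 0)) => [_|_]; first by rewrite eqxx.
have [au|ua] := ltP a `|h l *: (lattice_pt i : R * R)|.
  rewrite /f /summand -[eta _]/(iter_derive eta 0 0 _).
  by rewrite (iter_derive_out eta_supp)// mulr0 eqxx.
move=> _; have : (weight i)%:R <= N%:R :> R.
  rewrite -(ler_pM2r (h0 l)); apply: le_trans aN; apply: le_trans ua.
  by rewrite normrZ gtr0_norm// norm_lattice_pt mulrC.
by rewrite ler_nat /weight geq_max mem_box; lia.
Qed.

Theorem lattice_defect_bound (M n : nat) : (0 < n)%N -> (0 < M)%N ->
  (forall j, (0 < j <= n)%N -> coprime j M) -> p%:Z + q%:Z + K + 4 <= n%:Z ->
  exists2 C : R, 0 < C & forall l N, a <= N%:R * h l ->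
    `|lattice_defect M N (at_lattice (f l))| <= C.
Proof.
move=> n0 M0 cop kn; have [coef [c1 /(_ n0) c2 c3]] := @fdiff_coef R n.
have [C C0 HC] : exists2 C : R, 0 < C & forall l i, `|\sum_(w <- offsets M)
    \sum_(j < n.+1) coef j * at_lattice (f l) (dilate M j i w)| <= C * decay i.
  have : forall w, w \in offsets M -> (w.1 < M)%N && (w.2 < M)%N.
    by move=> w; rewrite mem_offsets.
  elim: (offsets M) => [|w s IH] sM.
    by exists 1 => // l i; rewrite big_nil normr0 mul1r ltW// decay_gt0.
  have [|C C0 HC] := IH; first by move=> w' w's; apply: sM; rewrite inE w's orbT.
  have [D D0 HD] := block_bound n0 M0 (sM w (mem_head _ _)) c3 kn.
  exists (D + C); first exact: addr_gt0.
  move=> l i; rewrite big_cons mulrDl; apply: le_trans (ler_normD _ _) _.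
  by apply: lerD.
exists (16 * C); first by rewrite mulr_gt0.
move=> l N aN.
rewrite (lattice_defectE n0 M0 cop (supported_at_lattice aN) (leqnn _) c1 c2).
rewrite normrM normrN normrX normrN1 expr1n mul1r.
by apply: norm_sum_decay_le => [|i _]; [exact: ltW|exact: HC].
Qed.

End Family.
End DefectBound.

(** * Positive definite forms *)

Section PosdefForms.
Context {R : realType}.
Implicit Types (E F G : R) (u : R * R).

Lemma fst_le_norm u : `|u.1| <= `|u|. Proof. by rewrite prod_normE le_max lexx. Qed.
Lemma snd_le_norm u : `|u.2| <= `|u|. Proof. by rewrite prod_normE le_max lexx orbT. Qed.

(** Completing the square, [G * Q = (E G - F^2) x^2 + (F x + G y)^2], and likewise with the roles of
    [x] and [y] exchanged. *)
Lemma posdef_lower E F G : posdef E F G ->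
  exists2 c : R, 0 < c & forall u, c * `|u| ^+ 2 <= qform E F G u.
Proof.
move=> [E0 G0 D0]; set D := E * G - F ^+ 2 in D0.
exists (Num.min (D / E) (D / G)); first by rewrite lt_min !divr_gt0.
move=> [x y]; rewrite /qform/= prod_normE/=.
have Hx : D / G * `|x| ^+ 2 <= E * x ^+ 2 + 2 * F * x * y + G * y ^+ 2.
  rewrite real_normK ?num_real// mulrAC ler_pdivrMr// /D.
  have := sqr_ge0 (F * x + G * y); nra.
have Hy : D / E * `|y| ^+ 2 <= E * x ^+ 2 + 2 * F * x * y + G * y ^+ 2.
  rewrite real_normK ?num_real// mulrAC ler_pdivrMr// /D.
  have := sqr_ge0 (E * x + F * y); nra.
case: (leP `|x| `|y|) => _.
  by apply: le_trans Hy; rewrite ler_wpM2r ?sqr_ge0// ge_min lexx.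
by apply: le_trans Hx; rewrite ler_wpM2r ?sqr_ge0// ge_min lexx orbT.
Qed.

(** Test vectors: the two unit vectors, and [(- F, E)], where the form equals
    [E * (E * G - F ^ 2)]. *)
Lemma lower_posdef E F G (c : R) : 0 < c ->
  (forall u, c * `|u| ^+ 2 <= qform E F G u) -> posdef E F G.
Proof.
move=> c0 H.
have E0 : 0 < E.
  have := H (1, 0); rewrite /qform prod_normE/= normr1 normr0 max_l// => A.
  by apply: lt_le_trans c0 _; lra.
have G0 : 0 < G.
  have := H (0, 1); rewrite /qform prod_normE/= normr1 normr0 max_r// => A.
  by apply: lt_le_trans c0 _; lra.
split=> //; rewrite -(pmulr_rgt0 _ E0).
have := H (- F, E); rewrite /qform prod_normE/= => A.
have -> : E * (E * G - F ^+ 2) = E * (- F) ^+ 2 + 2 * F * - F * E + G * E ^+ 2 by ring.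
apply: lt_le_trans A; rewrite mulr_gt0// exprn_gt0// lt_max orbC normr_gt0.
by rewrite gt_eqF.
Qed.

Lemma qform_le E F G (B : R) u : `|E| <= B -> `|F| <= B -> `|G| <= B ->
  `|qform E F G u| <= 4 * B * `|u| ^+ 2.
Proof.
move=> EB FB GB; have u1 := fst_le_norm u; have u2 := snd_le_norm u.
have T e s t : `|e| <= B -> `|s| <= `|u| -> `|t| <= `|u| -> `|e * (s * t)| <= B * `|u| ^+ 2.
  move=> eB su tu; rewrite !normrM expr2; apply: ler_pM => //.
  exact: ler_pM.
have := T _ _ _ EB u1 u1; have := T _ _ _ FB u1 u2; have := T _ _ _ GB u2 u2.
rewrite /qform (_ : E * _ + _ + _ =
  E * (u.1 * u.1) + F * (u.1 * u.2) + F * (u.1 * u.2) + G * (u.2 * u.2)); last by ring.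
rewrite -mulrA; move: (B * _) (E * _) (F * _) (G * _) => z e f g; rewrite !ler_norml => ? ? ?.
by lra.
Qed.

Lemma posdef_nbhs E F G : posdef E F G -> exists d c : R, [/\ 0 < d, 0 < c &
  forall E' F' G', `|E' - E| < d -> `|F' - F| < d -> `|G' - G| < d ->
    posdef E' F' G' /\ forall u, c * `|u| ^+ 2 <= qform E' F' G' u].
Proof.
(* Changing the coefficients by at most [c / 8] changes the form by at most [4 * (c / 8) * |u|^2],
   half of the lower bound. *)
move=> /posdef_lower[c c0 Hc]; exists (c / 8), (c / 2).
have h c' : 0 < c' -> 0 < c / c' by move=> ?; rewrite divr_gt0.
split; [exact: h|exact: h|move=> E' F' G' dE dF dG].
suff H u : c / 2 * `|u| ^+ 2 <= qform E' F' G' u.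
  by split => //; apply: lower_posdef H; exact: h.
have := qform_le u (ltW dE) (ltW dF) (ltW dG); have := Hc u.
rewrite (_ : qform (E' - E) (F' - F) (G' - G) u = qform E' F' G' u - qform E F G u); last first.
  by rewrite /qform; ring.
by rewrite ler_norml; move: (`|u| ^+ 2) => z; lra.
Qed.

End PosdefForms.

(** * Bounds for the region of absolute convergence *)

Section WeightedSums.
Context {R : realType}.

Lemma weight_decay i : i != (0, 0) -> (weight i)%:R ^- 4 <= 16 * decay i :> R.
Proof.
move=> /weight_gt0 W.
have W1 : 1 <= (weight i)%:R :> R by rewrite ler1n.
have W0 : 0 < (weight i)%:R :> R by lra.
have W0' : 0 < 1 + (weight i)%:R :> R by lra.
have D : 16 * (1 + (weight i)%:R) ^- 4 <= 16 * decay i :> R by rewrite ler_pM2l// decay_ge.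
apply: le_trans D.
rewrite ler_pdivlMr ?exprn_gt0// mulrC ler_pdivrMr ?exprn_gt0//.
have -> : 16 * (weight i)%:R ^+ 4 = (2 * (weight i)%:R) ^+ 4 :> R by ring.
by apply: lerXn2r; rewrite ?nnegrE ?addr_ge0 ?mulr_ge0//; lra.
Qed.

Lemma expR_ln_le (x q c s : R) : 0 < c -> 1 <= x -> c * x ^+ 2 <= q -> 0 <= s ->
  expR (- s * ln q) <= expR (s * `|ln c|) * expR (- (2 * s) * ln x).
Proof.
move=> c0 x1 cq s0; rewrite -expRD ler_expR.
have x0 : 0 < x by lra.
have q0 : 0 < q by apply: lt_le_trans cq; rewrite mulr_gt0// exprn_gt0.
have q1 : ln c + 2 * ln x <= ln q.
  by rewrite mulr_natl -lnXn// -lnM ?posrE ?exprn_gt0// ler_ln ?posrE ?mulr_gt0 ?exprn_gt0.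
have := ler_norm (- ln c); rewrite normrN => ?.
have : s * (- `|ln c| + 2 * ln x) <= s * ln q by rewrite ler_wpM2l//; lra.
by lra.
Qed.

Variables (eta : R * R -> R) (a : R).
Hypothesis eta_smooth : smooth eta.
Hypothesis eta_supp : closure [set u | eta u != 0] `<=` [set u | `|u| <= a].

Lemma cutoff_lipschitz : exists2 C : R, 0 < C &
  forall u, `|eta u - eta (0, 0)| <= C * `|u|.
Proof.
have de u : differentiable eta u by exact: (eta_smooth [::]).
have [C C0 HC] := iter_derive_bounded eta_smooth eta_supp (1, 0) 1.
have [D D0 HD] := iter_derive_bounded eta_smooth eta_supp (0, 1) 1.
exists (C + D); first exact: addr_gt0.
move=> u.
have dl (t : R) : is_derive t 1 (fun s => eta (0 + s *: u)) ('D_u eta (0 + t *: u)).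
  by apply: is_derive_line; exact: de.
have cl : {within `[0, 1], continuous (fun s : R => eta (0 + s *: u))}.
  by apply: derivable_within_continuous => t _; exact: ex_derive.
have [t _] := MVT_segment ler01 (fun t _ => dl t) cl.
rewrite subr0 mulr1 !add0r scale1r scale0r => ->.
have -> : 'D_u eta (t *: u) = u.1 * 'D_(1, 0) eta (t *: u) + u.2 * 'D_(0, 1) eta (t *: u).
  rewrite !deriveE//; move: ('d eta (t *: u)) => dd.
  have {1}-> : u = u.1 *: (1, 0) + u.2 *: (0, 1) :> R * R.
    case: u {dl cl dd} => x y; transitivity ((x * 1 + y * 0 : R), (x * 0 + y * 1 : R)) => //.
    by rewrite !mulr1 !mulr0 addr0 add0r.
  by rewrite linearD !linearZ.
apply: le_trans (ler_normD _ _) _; rewrite mulrDl !normrM mulrC [`|u.2| * _]mulrC.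
apply: lerD; apply: ler_pM => //; rewrite ?fst_le_norm ?snd_le_norm//.
- exact: HC.
- exact: HD.
Qed.

End WeightedSums.

(** * Continuation of the zeta function *)

Section ZetaContinuation.
Context {R : realType}.
Local Notation C := R[i].
Variables (eta : R * R -> R) (a : R).
Hypothesis eta_smooth : smooth eta.
Hypothesis eta_supp : closure [set u | eta u != 0] `<=` [set u | `|u| <= a].
Hypothesis eta0 : eta (0, 0) = 1.

Lemma punctured_square_sum (V : nmodType) N (f : int * int -> V) :
  \sum_(i \in punctured_square N.+1) f i = \sum_(i <- box N | i != (0, 0)) f i.
Proof.
have -> : punctured_square N.+1 = [set` [seq i <- box N | i != (0, 0)]].
  apply/seteqP; split=> i; rewrite /punctured_square/= mem_filter mem_box.
    by move=> [i1 [i2 ->]]; apply/andP; split; lia.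
  by move=> /andP[-> /andP[i1 i2]]; split; [lia|split=> //; lia].
by rewrite -fsbig_seq ?filter_uniq ?box_uniq// big_filter.
Qed.

Lemma norm1_le_normc (w : C) (e : R) : `|w| <= e%:C -> norm1 w <= 2 * e.
Proof.
rewrite normc_def lecR => we.
have A : `|complex.Re w| <= e.
  by apply: le_trans we; rewrite -sqrtr_sqr ler_sqrt ?addr_ge0 ?sqr_ge0// lerDl sqr_ge0.
have B : `|complex.Im w| <= e.
  by apply: le_trans we; rewrite -[leLHS]sqrtr_sqr ler_sqrt ?addr_ge0 ?sqr_ge0// lerDr sqr_ge0.
by rewrite /norm1; lra.
Qed.

Lemma cpowE (x : R) (s : C) : 0 < x -> cpow x s = cexp (s * (ln x)%:C).
Proof.
move=> x0; rewrite /cpow /powR gt_eqF//; case: s => p q.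
by rewrite /cexp/= !mulr0 subr0 add0r; apply/eqP; rewrite eq_complex/= !mul0r subr0 addr0 !eqxx.
Qed.

Lemma entire_bounded (f : C -> C) : entire f -> exists2 A : R, 0 < A &
  forall x y : R, -3 <= x <= 3 -> 0 <= y <= 2 -> norm1 (f (x +i* y)) <= A.
Proof.
move=> ef.
have cf z : ccontinuous_at f z by have [c] := ef z; exact: cdiff_continuous.
have [cR cI] := ccontinuous_at_continuous2 cf.
have bd (P : R -> R -> R) : continuous2 P -> exists2 A : R, 0 < A &
    forall x y : R, -3 <= x <= 3 -> 0 <= y <= 2 -> `|P x y| <= A.
  move=> cP.
  have cK : compact ([set` `[-3, 3]%R] `*` [set` `[0, 2]%R] : set (R * R)).
    by apply: compact_setX; exact: segment_compact.
  have : compact ((fun u : R * R => P u.1 u.2) @` ([set` `[-3, 3]%R] `*` [set` `[0, 2]%R])).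
    apply: continuous_compact cK; apply: continuous_subspaceT => -[x y].
    apply/cvgrPdist_lt => e e0; have [d d0 H] := cP x y e e0.
    apply/(@nbhs_normP _ (R * R)%type); exists d => // -[x' y'] /=.
    rewrite prod_normE/= gt_max => /andP[H1 H2].
    by rewrite distrC; apply: H; rewrite distrC.
  move=> /compact_bounded[M [_ HM]].
  exists (`|M| + 1); first by rewrite ltr_wpDl.
  move=> x y Hx Hy; apply: (HM (`|M| + 1)); first by rewrite (le_lt_trans (ler_norm _))// ltrDl.
  by exists (x, y) => //; split; rewrite /= in_itv.
have [A A0 HA] := bd _ cR; have [B B0 HB] := bd _ cI.
exists (A + B); first exact: addr_gt0.
by move=> x y Hx Hy; apply: lerD; [exact: HA|exact: HB].
Qed.

Section FixedForm.
Variables (E F G : R) (Z : C -> C).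
Hypothesis hQ : posdef E F G.
Hypothesis Zhol : forall s : C, s != 2 -> derivable (Z : C^o -> C^o) s 1.
Hypothesis Zser : forall s : C, 2 < complex.Re s ->
  (\sum_(i \in punctured_square N)
     cpow (qform E F G (lattice_pt i)) (- s / 2) : C^o) @[N --> \oo] --> (Z s : C^o).
Variables (M : nat).
Hypothesis M0 : (1 < M)%N.

Let Q (i : int * int) : R := qform E F G (lattice_pt i).

Let Q_gt0 i : i != (0, 0) -> 0 < Q i.
Proof.
move=> i0; have [c c0 H] := posdef_lower hQ.
apply: lt_le_trans (H _); rewrite mulr_gt0// exprn_gt0//.
by rewrite norm_lattice_pt ltr0n weight_gt0.
Qed.

Definition zterm (h : R) (s : C) (i : int * int) : C :=
  if i == (0, 0) then 0
  else cexp (- s / 2 * (ln (qform E F G (lattice_pt i)))%:C) * (eta (h *: lattice_pt i))%:C.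

Definition zeta_defect N (h : R) (s : C) : C :=
  \sum_(j <- box N) zterm h s j -
  (M%:R ^+ 2)%:C * \sum_(i <- box N) zterm h s (dilate M 0 i (0%N, 0%N)).

Lemma zeta_defectE N h s : zeta_defect N h s =
  lattice_defect M N (at_lattice (summand eta 0 0 E F G
     (complex.Re (- s / 2)) (complex.Im (- s / 2)) cos h)) +i*
  lattice_defect M N (at_lattice (summand eta 0 0 E F G
     (complex.Re (- s / 2)) (complex.Im (- s / 2)) sin h)).
Proof.
have T i : zterm h s i =
  at_lattice (summand eta 0 0 E F G (complex.Re (- s / 2)) (complex.Im (- s / 2)) cos h) i +i*
  at_lattice (summand eta 0 0 E F G (complex.Re (- s / 2)) (complex.Im (- s / 2)) sin h) i.
  rewrite /zterm /at_lattice; case: eqVneq => // _.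
  rewrite /summand /cexp; case: (- s / 2) => x y.
  by apply/eqP; rewrite eq_complex/= !expr0 !mul1r !mulr0 !subr0 !add0r !eqxx.
have S (r : seq (int * int)) (t : int * int -> int * int) : \sum_(i <- r) zterm h s (t i) =
   (\sum_(i <- r) at_lattice (summand eta 0 0 E F G (complex.Re (- s / 2)) (complex.Im (- s / 2)) cos h) (t i)) +i*
   (\sum_(i <- r) at_lattice (summand eta 0 0 E F G (complex.Re (- s / 2)) (complex.Im (- s / 2)) sin h) (t i)).
  elim: r => [|i r IH]; first by rewrite !big_nil.
  by rewrite !big_cons IH T.
rewrite /zeta_defect (S _ id) (S _ (fun i => dilate M 0 i (0%N, 0%N))) /lattice_defect.
by apply/eqP; rewrite eq_complex/= !mul0r subr0 addr0 !eqxx.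
Qed.

Lemma cdiff_zeta_defect N h s : exists c, cdiff (zeta_defect N h) s c.
Proof.
have dT i : exists c, cdiff (fun s => zterm h s i) s c.
  rewrite /zterm; case: eqVneq => _; first by exists 0; exact: cdiff_cst.
  have d1 := cdiffM (cdiffM (cdiffN (cdiff_id s)) (cdiff_cst (2^-1) s))
    (cdiff_cst ((ln (qform E F G (lattice_pt i)))%:C) s).
  have d2 := cdiffM (cdiff_comp d1 (cdiff_cexp _)) (cdiff_cst ((eta (h *: lattice_pt i))%:C) s).
  by eexists; exact: d2.
have /choice[T' dT'] := dT.
eexists; apply: cdiffB; first exact: cdiff_sum.
apply: cdiffZ; apply: (cdiff_sum _ (F' := fun i => T' (dilate M 0 i (0%N, 0%N)))) => i.
exact: dT'.
Qed.

Section RealArgument.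
Variable sm : R.

Let g (s : R) (i : int * int) : R := if i == (0, 0) then 0 else expR (- (s / 2) * ln (Q i)).

Let realterm s h i : zterm h s%:C i = (g s i * eta (h *: lattice_pt i))%:C.
Proof.
rewrite /zterm /g; case: eqVneq => _; first by rewrite mul0r.
rewrite rmorphM/= -cexp_real; congr (cexp _ * _).
rewrite !rmorphM/= rmorphN/= rmorphM/= fmorphV rmorph_nat; ring.
Qed.

(** The cutoff differs from [1] by [O(h |i|)], and [Q ^ (- s / 2)] is [O(|i|^-5)] for these [s], so
    the error is [O(h |i|^-4)] termwise. The bound [18] is the least value guaranteed for
    [zeta_path] on the real axis; the upper bound [sm] keeps the constants uniform in [s]. *)
Let smoothing_error : exists2 D : R, 0 < D & forall s h N, 18 <= s <= sm -> 0 < h ->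
  `|\sum_(i <- box N) g s i * eta (h *: lattice_pt i) - \sum_(i <- box N) g s i| <= D * h.
Proof.
have [c c0 Hc] := posdef_lower hQ.
have [Le Le0 HL] := cutoff_lipschitz eta_smooth eta_supp.
pose Y := expR (`|sm| * `|ln c|).
have Y0 : 0 < Y := expR_gt0 _.
exists (16 * (Y * Le * 16)); first by rewrite !mulr_gt0.
move=> s h N sm18 h0; rewrite -sumrB -mulrA; apply: norm_sum_decay_le.
  by rewrite !mulr_ge0// ltW.
move=> i _; rewrite /g; case: (eqVneq i (0, 0)) => [_|i0].
  by rewrite mul0r subrr normr0 !mulr_ge0 ?ltW// decay_gt0.
rewrite -{2}[expR _]mulr1 -mulrBr normrM ger0_norm ?expR_ge0//.
have W1 : 1 <= (weight i)%:R :> R by rewrite ler1n weight_gt0.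
have W0 : 0 < (weight i)%:R :> R by lra.
have H1 : `|eta (h *: lattice_pt i) - 1| <= Le * h * (weight i)%:R.
  have := HL (h *: lattice_pt i); rewrite eta0 => /le_trans; apply.
  by rewrite normrZ gtr0_norm// norm_lattice_pt mulrA.
have s2 : 0 <= s / 2 by lra.
have H2 : expR (- (s / 2) * ln (Q i)) <= Y * (weight i)%:R ^- 5.
  have Hi : c * (weight i)%:R ^+ 2 <= Q i by rewrite -norm_lattice_pt; exact: Hc.
  apply: le_trans (expR_ln_le c0 W1 Hi s2) _; apply: ler_pM; rewrite ?expR_ge0//.
    by rewrite ler_expR ler_wpM2r//; apply: le_trans (ler_norm sm); lra.
  rewrite -[X in _ <= X^-1]lnK ?posrE ?exprn_gt0// lnXn// -expRN ler_expR -mulr_natl.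
  have lw : 0 <= ln (weight i)%:R :> R by rewrite ln_ge0.
  have : 0 <= (s - 5) * ln (weight i)%:R by apply: mulr_ge0 => //; lra.
  lra.
apply: (@le_trans _ _ (Y * (weight i)%:R ^- 5 * (Le * h * (weight i)%:R))).
  by apply: ler_pM; rewrite ?expR_ge0.
rewrite (_ : Y * _ * _ = Y * Le * h * (weight i)%:R ^- 4); last first.
  by field; rewrite gt_eqF.
rewrite (_ : Y * Le * 16 * h * decay i = Y * Le * h * (16 * decay i)); last by ring.
by rewrite ler_pM2l ?mulr_gt0// weight_decay.
Qed.

Let series_cvg s : 2 < s -> forall e, 0 < e -> exists N0, forall N, (N0 <= N)%N ->
  norm1 (Z s%:C - (\sum_(i <- box N) g s i)%:C) <= e.
Proof.
move=> s2 e e0; have := Zser (s := s%:C) s2.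
have e2 : 0 < (e / 2)%:C :> C by rewrite ltcR divr_gt0.
move=> /cvgrPdist_le/(_ _ e2)[N0 _ H]; exists N0 => N N0N.
have := H N.+1 (leqW N0N); rewrite /= punctured_square_sum => /norm1_le_normc.
have -> : 2 * (e / 2) = e by field.
congr (is_true (norm1 (_ - _) <= _)).
rewrite rmorph_sum/= big_mkcond; apply: eq_bigr => i _; rewrite /g.
case: eqVneq => //= i0; rewrite cpowE ?Q_gt0// -cexp_real; congr cexp.
rewrite !rmorphM/= rmorphN/= rmorphM/= fmorphV rmorph_nat; ring.
Qed.

(** By homogeneity the sum over multiples of [M] is [M ^ (- s)] times the full sum with cutoff scale
    [h * M]. Both full sums are close to [Z s], which leaves the factor [1 - M ^ (2 - s)] and the
    errors [D * h] and [D * M * h]. *)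
Lemma zeta_defect_real : exists2 D : R, 0 < D & forall s h N, 18 <= s <= sm -> 0 < h ->
  a <= N%:R * h ->
  norm1 ((1 - cexp ((2 - s%:C) * (ln M%:R)%:C)) * Z s%:C - zeta_defect N h s%:C) <= D * h.
Proof.
have [D D0 HD] := smoothing_error.
exists (D + D * M%:R); first by rewrite addr_gt0// mulr_gt0// ltr0n ltnW.
move=> s h N Hs h0 aN.
have M1 : 1 < M%:R :> R by rewrite ltr1n.
have Mp : 0 < M%:R :> R by lra.
pose S h' N' := \sum_(i <- box N') g s i * eta (h' *: lattice_pt i).
have near h' : 0 < h' -> a <= N%:R * h' -> norm1 (Z s%:C - (S h' N)%:C) <= D * h'.
  move=> h'0 aN'; apply/ler_addgt0Pr => e e0.
  have s2 : 2 < s by lra.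
  have [N0 HN0] := series_cvg s2 e0.
  have := HN0 (maxn N0 N) (leq_maxl _ _).
  have -> : S h' N = S h' (maxn N0 N).
    apply: eq_big_support; rewrite ?box_uniq// => i.
    have [au|ua] := ltP a `|h' *: (lattice_pt i : R * R)|.
      by rewrite -[eta _]/(iter_derive eta 0 0 _) (iter_derive_out eta_supp)// mulr0 eqxx.
    move=> _; have : (weight i)%:R <= N%:R :> R.
      rewrite -(ler_pM2r h'0); apply: le_trans aN'; apply: le_trans ua.
      by rewrite normrZ gtr0_norm// norm_lattice_pt mulrC.
    by rewrite ler_nat /weight geq_max !mem_box; lia.
  set N' := maxn _ _; set T := \sum_(i <- box N') g s i => H1.
  rewrite (_ : Z s%:C - _ = (Z s%:C - T%:C) + (T - S h' N')%:C); last by rewrite rmorphB/=; ring.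
  apply: le_trans (norm1D _ _) _; rewrite addrC norm1_real distrC.
  by apply: lerD => //; exact: HD.
pose mu := expR ((2 - s) * ln M%:R).
have lnMp : 0 < ln M%:R :> R by rewrite ln_gt0.
have mu1 : mu <= 1 by rewrite -expR0 ler_expR; nra.
have E1 : cexp ((2 - s%:C) * (ln M%:R)%:C) = mu%:C.
  by rewrite -cexp_real; congr cexp; rewrite rmorphM rmorphB/= rmorph_nat.
have E2 : zeta_defect N h s%:C = (S h N - mu * S (h * M%:R) N)%:C.
  rewrite /zeta_defect rmorphB/=; congr (_ - _).
    by rewrite rmorph_sum/=; apply: eq_bigr => i _; exact: realterm.
  rewrite [RHS](_ : _ = (M%:R ^+ 2)%:C * ((expR (- s * ln M%:R)) * S (h * M%:R) N)%:C); last first.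
    rewrite -rmorphM/= mulrA; congr ((_ * _)%:C).
    by rewrite /mu mulrBl expRB expRM_natl lnK ?posrE// mulNr expRN.
  congr (_ * _); rewrite /S big_distrr/= rmorph_sum/=; apply: eq_bigr => i _.
  rewrite realterm; congr (_%:C).
  have E0 : lattice_pt (dilate M 0 i (0%N, 0%N)) = M%:R *: lattice_pt i :> R * R.
    rewrite /lattice_pt /dilate/= !mul0r !addr0 !rmorphM/=.
    by congr (_, _).
  rewrite E0 scalerA mulrA; congr (_ * _); rewrite /g.
  have M00 : (M%:Z == 0) = false by rewrite eqz_nat gtn_eqF// ltnW.
  have -> : (dilate M 0 i (0%N, 0%N) == (0, 0)) = (i == (0, 0)).
    by case: (i) => i1 i2; rewrite /dilate !xpair_eqE/= !mul0r !addr0 !mulf_eq0 M00.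
  case: (eqVneq i (0, 0)) => [_|i0]; first by rewrite mulr0.
  have -> : Q (dilate M 0 i (0%N, 0%N)) = M%:R ^+ 2 * Q i.
    by rewrite /Q E0 /qform/=; rewrite /GRing.scale/=; ring.
  rewrite lnM ?posrE ?exprn_gt0 ?Q_gt0// lnXn// -expRD; congr expR.
  by rewrite -mulr_natl; field.
rewrite E1 E2.
rewrite (_ : _ - _ = (Z s%:C - (S h N)%:C) - mu%:C * (Z s%:C - (S (h * M%:R) N)%:C)); last first.
  by rewrite rmorphB rmorphM/=; ring.
apply: le_trans (norm1B _ _) _; rewrite mulrDl; apply: lerD; first exact: near.
rewrite norm1_realM ger0_norm ?expR_ge0//.
apply: (@le_trans _ _ (1 * (D * (h * M%:R)))); last by rewrite mul1r; lra.
apply: ler_pM; rewrite ?expR_ge0 ?norm1_ge0//; apply: near; first by rewrite mulr_gt0.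
apply: le_trans aN _; rewrite mulrA ler_peMr//; last lra.
by rewrite mulr_ge0// ltW.
Qed.

End RealArgument.
End FixedForm.
End ZetaContinuation.

(** * Carrying the limit of the defect past the pole *)

Section ZetaLimit.
Context {R : realType}.
Local Notation C := R[i].

Lemma coprime_fact_succ j n : (0 < j <= n)%N -> coprime j (n`!).+1.
Proof.
move=> /dvdn_fact/dvdnP[q ->].
by rewrite -addn1 /coprime gcdnMDl gcdn1.
Qed.

(* Parametrizes [C \ {2}]: on the real axis it takes real values at least
   [18], and it sends [i] to [2 - k]. *)
Definition zeta_path (k : nat) (z : C) : C :=
  2 + (k%:R : R)%:C * cexp ((16 : R)%:C + (pi : R)%:C * z + (16 : R)%:C * (z * z)).

Lemma zeta_path_neq2 k z : (0 < k)%N -> zeta_path k z != 2.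
Proof.
move=> k0; rewrite /zeta_path -subr_eq0 addrAC subrr add0r mulf_neq0 ?cexp_neq0//.
by rewrite eq_complex/= eqxx andbT pnatr_eq0 -lt0n.
Qed.

Lemma cdiff_zeta_path k z : exists c, cdiff (zeta_path k) z c.
Proof.
have d1 := cdiffD (cdiffD (cdiff_cst ((16 : R)%:C) z) (cdiffZ ((pi : R)%:C) (cdiff_id z)))
  (cdiffZ ((16 : R)%:C) (cdiffM (cdiff_id z) (cdiff_id z))).
have d2 := cdiffD (cdiff_cst 2 z) (cdiffZ ((k%:R : R)%:C) (cdiff_comp d1 (cdiff_cexp _))).
by eexists; exact: d2.
Qed.

Lemma zeta_path_real k (x : R) :
  zeta_path k (x +i* 0) = (2 + k%:R * expR (16 + pi * x + 16 * x ^+ 2))%:C.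
Proof.
rewrite /zeta_path (_ : (16 : R)%:C + _ + _ = (16 + pi * x + 16 * x ^+ 2)%:C).
  by rewrite cexp_real -rmorphM/= rmorphD rmorph_nat.
rewrite -[x +i* 0]/(x%:C) -!rmorphM -!rmorphD/=.
by rewrite expr2.
Qed.

Lemma zeta_path_i k : zeta_path k 'i%C = ((2 - k%:R : R)%:C).
Proof.
rewrite /zeta_path (_ : _ + _ * ('i%C * 'i%C) = 0 +i* pi); last first.
  by apply/eqP; rewrite eq_complex/=; apply/andP; split; apply/eqP; ring.
rewrite /cexp/= expR0 cospi sinpi !mul1r.
by apply/eqP; rewrite eq_complex/=; apply/andP; split; apply/eqP; ring.
Qed.

Variables (eta : R * R -> R) (a : R).
Hypothesis eta_smooth : smooth eta.
Hypothesis eta_supp : closure [set u | eta u != 0] `<=` [set u | `|u| <= a].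
Hypothesis eta0 : eta (0, 0) = 1.

(** [M] and [n] come before the form: they depend only on the path, so that one defect serves all
    forms and can be differentiated in them. The clause [k + 2 <= n] is what the later derivations
    require. *)
Theorem zeta_defect_cvg (k : nat) : (0 < k)%N -> exists M n : nat,
  [/\ (1 < M)%N, (0 < n)%N, (forall j, (0 < j <= n)%N -> coprime j M), (k + 2 <= n)%N &
  forall (E F G : R) (Z : C -> C), posdef E F G ->
  (forall s : C, s != 2 -> derivable (Z : C^o -> C^o) s 1) ->
  (forall s : C, 2 < complex.Re s ->
  (\sum_(i \in punctured_square N)
     cpow (qform E F G (lattice_pt i)) (- s / 2) : C^o) @[N --> \oo] --> (Z s : C^o)) ->
  forall t : R, 0 < t -> exists2 h0 : R, 0 < h0 & forall h N, 0 < h -> h < h0 ->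
    a <= N%:R * h ->
    norm1 ((1 - (M%:R ^+ k)%:C) * Z (2 - k%:R : R)%:C -
      zeta_defect eta E F G M N h (2 - k%:R : R)%:C) <= t].
Proof.
move=> k0.
have [A A0 HA] := entire_bounded (cdiff_zeta_path k).
(* Along the path the exponents [- s / 2] have order at most [truncn A + 1]; four more differences
   make the bound summable, and [k + 2] is for the derivations. The successor of [n!] is prime to
   [1, ..., n]. *)
pose n := ((Num.truncn A).+1 + 4 + k + 2)%N; exists (n`!).+1, n.
have M0 : (1 < (n`!).+1)%N by rewrite ltnS fact_gt0.
have cop j : (0 < j <= n)%N -> coprime j (n`!).+1 by exact: coprime_fact_succ.
split=> //; first by rewrite /n; lia.
move=> E F G Z hQ Zhol Zser t t0; set M := (n`!).+1 in M0 cop *.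
have [c c0 Hc] := posdef_lower hQ.
(* The index of the family: a scale [h] with a point of the rectangle. The bounds are thus uniform
   in both. *)
pose rect := {hz : R * (R * R) | [/\ 0 < hz.1, -3 <= hz.2.1 <= 3 & 0 <= hz.2.2 <= 2]}.
pose s (l : rect) := - zeta_path k ((sval l).2.1 +i* (sval l).2.2) / 2.
have halfNE (w : C) : - w / 2 = (- 2^-1 : R)%:C * w.
  by rewrite rmorphN/= fmorphV rmorph_nat; ring.
have sA l : norm1 (s l) <= A.
  have [_ Hx Hy] := svalP l; have := HA _ _ Hx Hy.
  by apply: le_trans; rewrite /s halfNE norm1_realM normrN ger0_norm//;
     have := norm1_ge0 (zeta_path k ((sval l).2.1 +i* (sval l).2.2)); lra.
have sK l : 2 * complex.Re (s l) <= ((Num.truncn A).+1 : int)%:~R.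
  have [_ Hx Hy] := svalP l; have := HA _ _ Hx Hy; rewrite /s.
  case: (zeta_path k _) => p q.
  have -> : 2 * complex.Re (- (p +i* q) / 2) = - p.
    by rewrite halfNE /= mul0r subr0; field.
  rewrite /norm1/= => pqA; apply: le_trans (ltW (truncnS_gt A)).
  by have := ler_norm (- p); rewrite normrN; have := normr_ge0 q; lra.
have B v : v = cos \/ v = sin -> exists2 D : R, 0 < D & forall l N,
    a <= N%:R * (sval l).1 -> `|lattice_defect M N (at_lattice (summand eta 0 0 E F G
       (complex.Re (s l)) (complex.Im (s l)) v (sval l).1))| <= D.
  move=> vcs; apply: (lattice_defect_bound eta_smooth eta_supp (E := fun=> E) (F := fun=> F)
    (G := fun=> G) (al := fun l => complex.Re (s l)) (be := fun l => complex.Im (s l))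
    (c := c) (B := `|E| + `|F| + `|G|) (A := A) (K := (Num.truncn A).+1) _ _ _ _ _ _ _ _ _ _ (_ : (0 < n)%N) _ cop) => //.
  - by move=> _; rewrite -addrA lerDl addr_ge0.
  - by move=> _; rewrite addrAC lerDr addr_ge0.
  - by move=> _; rewrite lerDr addr_ge0.
  - by move=> l; apply: le_trans (Re_le_norm1 _) (sA l).
  - by move=> l; apply: le_trans (Im_le_norm1 _) (sA l).
  - by move=> l; have [] := svalP l.
  - by rewrite /n; lia.
have [D1 D10 HD1] := B cos (or_introl erefl); have [D2 D20 HD2] := B sin (or_intror erefl).
pose V z := (1 - cexp ((2 - zeta_path k z) * (ln M%:R)%:C)) * Z (zeta_path k z).
have eV : entire V.
  move=> z; have [p dp] := cdiff_zeta_path k z.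
  have [z' dz] := derivable_cdiff (Zhol _ (zeta_path_neq2 z k0)).
  have d1 := cdiffM (cdiffB (cdiff_cst 2 z) dp) (cdiff_cst ((ln M%:R)%:C) z).
  have d2 := cdiffM (cdiffB (cdiff_cst 1 z) (cdiff_comp d1 (cdiff_cexp _))) (cdiff_comp dp dz).
  by eexists; exact: d2.
have [A1 A10 HA1] := entire_bounded eV.
have [e e0 He] := two_constants (ltW (addr_gt0 A10 (addr_gt0 D10 D20))) t0.
have [D D0 HD] := zeta_defect_real eta_smooth eta_supp eta0 hQ Zser M0 A.
exists (e / D); first by rewrite divr_gt0.
move=> h N h0 hD aN.
(* The function for the two-constants theorem: on all sides it is bounded independently of [h], and
   on the bottom, where the series converges, it is at most [D * h <= e]. *)
have eW : entire (fun z => V z - zeta_defect eta E F G M N h (zeta_path k z)).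
  move=> z; have [v dv] := eV z; have [p dp] := cdiff_zeta_path k z.
  have [q dq] := cdiff_zeta_defect eta E F G M N h (zeta_path k z).
  by eexists; exact: cdiffB dv (cdiff_comp dp dq).
have W3 x y : -3 <= x <= 3 -> 0 <= y <= 2 ->
    norm1 (V (x +i* y) - zeta_defect eta E F G M N h (zeta_path k (x +i* y))) <= A1 + (D1 + D2).
  move=> Hx Hy; apply: le_trans (norm1B _ _) _; apply: lerD; first exact: HA1.
  pose l : rect := exist _ (h, (x, y)) (And3 h0 Hx Hy).
  by rewrite zeta_defectE; apply: lerD; [exact: (HD1 l)|exact: (HD2 l)].
have := He _ eW; rewrite /V zeta_path_i.
have -> : cexp ((2 - (2 - k%:R : R)%:C) * (ln M%:R)%:C) = (M%:R ^+ k)%:C.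
  rewrite -[M%:R ^+ k]lnK ?posrE ?exprn_gt0// -cexp_real lnXn//; congr cexp.
  rewrite -[ln M%:R *+ k]mulr_natl rmorphM; congr (_ * _).
  by rewrite rmorphB/= !rmorph_nat; ring.
apply; split=> x Hx.
- rewrite zeta_path_real; apply: le_trans (HD _ _ _ _ h0 aN) _; last first.
    by rewrite mulrC -ler_pdivlMr// ltW.
  have /= := HA x 0 Hx ltac:(by rewrite lexx ler0n); rewrite zeta_path_real norm1_real => HAx.
  apply/andP; split; last exact: le_trans (ler_norm _) HAx.
  have k1 : 1 <= k%:R :> R by rewrite ler1n.
  have pi4 : pi <= 4 :> R by by have := @pihalf_lt2 R; lra.
  have pi0 : 0 <= pi :> R by exact: pi_ge0.
  (* The quadratic term absorbs [pi * x]: completing the square leaves at least [16 - pi^2 / 64],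
     and [exp y >= 1 + y] makes up for the loss. *)
  have e16 : 16 <= expR (16 + pi * x + 16 * x ^+ 2).
    apply: le_trans (expR_ge1Dx _); have := sqr_ge0 (x + pi / 32); nra.
  nra.
- by apply: W3 => //; lra.
- by apply: W3 => //; lra.
- by apply: W3 => //; lra.
Qed.

End ZetaLimit.

(** * Derivatives in the parameters *)

Section LimitDerivative.
Context {R : realType}.

Definition tends0 (D : R -> R) (v : R) := forall t, 0 < t ->
  exists2 h0 : R, 0 < h0 & forall h, 0 < h -> h < h0 -> `|D h - v| <= t.

Lemma tends0_cvg D v : tends0 D v -> D h @[h --> 0^'+] --> v.
Proof.
move=> H; apply/cvgrPdist_le => t t0; have [h0 h00 {}H] := H t t0.
near=> h; rewrite distrC; apply: H; first by near: h; exact: nbhs_right_gt.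
by near: h; exact: nbhs_right_lt.
Unshelve. all: by end_near. Qed.

Lemma tends0Z D v c : tends0 D v -> tends0 (fun h => c * D h) (c * v).
Proof.
move=> H t t0; have c1 : 0 < `|c| + 1 by rewrite ltr_wpDl.
have [|h0 h00 {}H] := H (t / (`|c| + 1)); first by rewrite divr_gt0.
exists h0 => // h hp hh; rewrite -mulrBr normrM.
have := H h hp hh; rewrite ler_pdivlMr// => /(le_trans _); apply.
by rewrite mulrC ler_wpM2l// lerDl.
Qed.

Lemma mean_value_le (g g' : R -> R) (t B : R) :
  (forall x : R, `|x| <= `|t| -> is_derive x 1 g (g' x)) ->
  (forall x : R, `|x| <= `|t| -> `|g' x| <= B) -> `|g t - g 0| <= B * `|t|.
Proof.
move=> dg gB.
have key (a b : R) : a <= b -> (forall x : R, a <= x <= b -> `|x| <= `|t|) ->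
    `|g b - g a| <= B * (b - a).
  move=> ab H.
  have dx (x : R) : x \in `]a, b[ -> is_derive x 1 g (g' x).
    by rewrite in_itv/= => /andP[ax xb]; apply/dg/H; rewrite !ltW.
  have cg : {within `[a, b], continuous g}.
    by apply: derivable_within_continuous => x; rewrite in_itv/= => /H/dg ?; exact: ex_derive.
  have [x] := MVT_segment ab dx cg; rewrite in_itv/= => /H/gB gx ->.
  by rewrite normrM [`|b - a|]ger0_norm ?subr_ge0// ler_wpM2r// subr_ge0.
have [t0|t0] := leP 0 t.
  have := key 0 t t0; rewrite subr0 ger0_norm//; apply => x /andP[x0 xt].
  by rewrite !ger0_norm.
have := key t 0 (ltW t0); rewrite sub0r distrC ltr0_norm//; apply => x /andP[tx x0].
by rewrite ler0_norm// lerN2.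
Qed.

(* Landau: the second derivatives being bounded, the first ones converge. *)
Lemma limit_derivative (f0 f1 f2 : R -> R -> R) (f : R -> R) (d C : R) : 0 < d ->
  (forall h x : R, 0 < h -> `|x| < d -> is_derive x 1 (f0 h) (f1 h x)) ->
  (forall h x : R, 0 < h -> `|x| < d -> is_derive x 1 (f1 h) (f2 h x)) ->
  (forall h x : R, 0 < h -> `|x| < d -> `|f2 h x| <= C) ->
  (forall x : R, `|x| < d -> tends0 (f0 ^~ x) (f x)) ->
  exists2 v : R, is_derive (0 : R) 1 f v & tends0 (f1 ^~ 0) v.
Proof.
move=> d0 df0 df1 f2C f0f.
have C0 : 0 <= C by apply: le_trans (f2C 1 0 ltr01 _); rewrite ?normr0.
have taylor h t : 0 < h -> `|t| < d -> `|f0 h t - f0 h 0 - t * f1 h 0| <= C * `|t| * `|t|.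
  move=> h0 td.
  have lip x : `|x| <= `|t| -> `|f1 h x - f1 h 0| <= C * `|t|.
    move=> xt; have xd := le_lt_trans xt td.
    apply: le_trans (_ : C * `|x| <= _); last by rewrite ler_wpM2l.
    apply: (mean_value_le (g' := f2 h)) => y yx; have yd := le_lt_trans yx xd.
      exact: df1.
    exact: f2C.
  have := @mean_value_le (fun x => f0 h x - x * f1 h 0) (fun x => f1 h x - f1 h 0) t _ _ lip.
  rewrite mul0r subr0 addrAC; apply => x xt.
  have dl := is_derive_mul (is_derive_id x (1 : R)) (is_derive_cst (f1 h 0) x (1 : R)).
  have := is_deriveB (df0 h x h0 (le_lt_trans xt td)) dl.
  by rewrite mulr0 addr0 mul1r.
have lim_taylor t e : `|t| < d -> 0 < e -> exists2 h0 : R, 0 < h0 &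
    forall h, 0 < h -> h < h0 -> `|f t - f 0 - t * f1 h 0| <= C * `|t| * `|t| + e.
  move=> td e0; have e2 : 0 < e / 2 by rewrite divr_gt0.
  have [h1 h10 H1] := f0f t td _ e2.
  have [|h2 h20 H2] := f0f 0 _ _ e2; first by rewrite normr0.
  exists (Num.min h1 h2); first by rewrite lt_min h10.
  move=> h hp; rewrite lt_min => /andP[/(H1 h hp) A /(H2 h hp) B].
  have := taylor h t hp td; move: A B; rewrite !ler_norml; lra.
(* A difference quotient with step [t] misses [f1 h 0] by at most [C * t] plus the convergence error
   divided by [t]. This step makes the first part at most [e / 4]; the other [e / 4] is left to the
   second. *)
pose tt (e : R) := Num.min (d / 2) (e / (4 * (C + 1))).
have tt0 e : 0 < e -> 0 < tt e by move=> e0; rewrite lt_min !divr_gt0// mulr_gt0//; lra.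
have ttd e : tt e < d by rewrite gt_min; apply/orP; left; lra.
have ttC e : 0 < e -> C * tt e <= e / 4.
  move=> e0; have : tt e <= e / (4 * (C + 1)) by rewrite ge_min lexx orbT.
  have C1 : 0 < C + 1 by lra.
  rewrite ler_pdivlMr ?mulr_gt0// => H; have := tt0 e e0; nra.
have est e : 0 < e -> exists y, exists2 h0 : R, 0 < h0 & forall h, 0 < h -> h < h0 ->
    `|y - f1 h 0| <= e / 2.
  move=> e0; have t0 := tt0 e e0; exists ((f (tt e) - f 0) / tt e).
  have [||h0 h00 H] := lim_taylor (tt e) (e / 4 * tt e).
  - by rewrite gtr0_norm.
  - by rewrite mulr_gt0// divr_gt0.
  exists h0 => // h hp hh; rewrite -(ler_pM2r t0) -[X in _ * X <= _](gtr0_norm t0) -normrM.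
  move: {H}(H h hp hh); rewrite (gtr0_norm t0) => H.
  have E1 : ((f (tt e) - f 0) / tt e - f1 h 0) * tt e = f (tt e) - f 0 - tt e * f1 h 0.
    by field; rewrite gt_eqF.
  rewrite E1.
  apply: le_trans H _; have := ttC e e0; nra.
have [v fv] : exists v : R, f1 h 0 @[h --> 0^'+] --> v.
  apply/cvg_ex; apply/cauchy_cvgP/cauchy_exP => e e0; have [y [h0 h00 H]] := est e e0.
  exists y.
  have : \forall h \near 0^'+, ball y e (f1 h 0).
    near=> h; rewrite -ball_normE; apply: (@le_lt_trans _ _ (e / 2)); last lra.
    apply: H; first by near: h; exact: nbhs_right_gt.
    by near: h; exact: nbhs_right_lt.
  by [].
have tv : tends0 (f1 ^~ 0) v.
  move=> e e0; have [y [h0 h00 H]] := est e e0; exists h0 => // h hp hh.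
  have : `|y - v| <= e / 2.
    apply/ler_addgt0Pr => e' e'0.
    move/cvgrPdist_le : fv => /(_ e' e'0) fv.
    have [h' [h'p h'h vh']] : exists h', [/\ 0 < h', h' < h0 & `|v - f1 h' 0| <= e'].
      near (0 : R)^'+ => h'; exists h'; split.
      - by near: h'; exact: nbhs_right_gt.
      - by near: h'; exact: nbhs_right_lt.
      - by near: h'.
    rewrite (_ : y - v = (y - f1 h' 0) - (v - f1 h' 0)); last by ring.
    by apply: le_trans (ler_normB _ _) _; apply: lerD => //; exact: H.
  have := H h hp hh; rewrite !ler_norml; lra.
exists v => //.
(* Letting [h] tend to [0] in the Taylor estimate, which transfers it to the limit function with
   slope [v]. *)
have ft t : `|t| < d -> `|f t - f 0 - t * v| <= C * `|t| * `|t|.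
  move=> td; apply/ler_addgt0Pr => e e0; have e2 : 0 < e / 2 by rewrite divr_gt0.
  have [h1 h10 H1] := lim_taylor t _ td e2.
  have e3 : 0 < e / 2 / (`|t| + 1) by rewrite divr_gt0// ltr_wpDl.
  have [h2 h20 H2] := tv _ e3.
  pose h := Num.min h1 h2 / 2; have hp : 0 < h by rewrite divr_gt0// lt_min h10.
  have hm : h < Num.min h1 h2 by rewrite /h; have : 0 < Num.min h1 h2; [rewrite lt_min h10|lra].
  move: hm; rewrite lt_min => /andP[/(H1 h hp) A /(H2 h hp) B].
  rewrite (_ : f t - f 0 - t * v = (f t - f 0 - t * f1 h 0) + t * (f1 h 0 - v)); last by ring.
  apply: le_trans (ler_normD _ _) _; rewrite normrM.
  have t1 : 0 < `|t| + 1 by rewrite ltr_wpDl.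
  move: B; rewrite ler_pdivlMr// => B.
  by have := normr_ge0 (f1 h 0 - v); have := normr_ge0 t; nra.
have fv0 : h^-1 *: (f (h *: 1 + 0) - f 0) @[h --> (0 : R)^'] --> v.
  apply/cvgrPdist_le => e e0; apply/nbhs_normP; exists (tt e); first exact: tt0.
  move=> t /=; rewrite sub0r normrN => te t0.
  have -> : t *: (1 : R) + 0 = t by rewrite addr0 [_ *: _]mulr1.
  rewrite [_ *: _]/(_ * _) distrC.
  have tp : 0 < `|t| by rewrite normr_gt0.
  rewrite -(ler_pM2r tp) -normrM.
  have -> : (t^-1 * (f t - f 0) - v) * t = f t - f 0 - t * v by field.
  apply: le_trans (ft t (lt_trans te (ttd e))) _.
  by rewrite ler_pM2r//; have := ttC e e0; nra.
split; first by apply/cvg_ex; exists v.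
exact: cvg_lim fv0.
Unshelve. all: by end_near. Qed.

End LimitDerivative.

(** * Defects as functions of the form *)

Section ParameterDerivatives.
Context {R : realType}.
Variables (eta : R * R -> R) (a : R).
Hypothesis eta_smooth : smooth eta.
Hypothesis eta_supp : closure [set u | eta u != 0] `<=` [set u | `|u| <= a].
Variables (M n : nat).
Hypotheses (n0 : (0 < n)%N) (M1 : (1 < M)%N).
Hypothesis cop : forall j, (0 < j <= n)%N -> coprime j M.

(** A box that covers the support of the cutoff at scale [h], so that the defect becomes a function
    of [h] alone. *)
Definition cutoff_size (h : R) : nat := (Num.truncn (a / h)).+1.

Lemma cutoff_sizeP h : 0 < h -> a <= (cutoff_size h)%:R * h.
Proof. by move=> h0; rewrite -ler_pdivrMr// ltW// truncnS_gt. Qed.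

Definition defect (p q : nat) (be E F G h : R) : R :=
  lattice_defect M (cutoff_size h) (at_lattice (summand eta p q E F G be 0 cos h)).

Lemma is_derive_sum_seq (I : Type) (s : seq I) (g : I -> R -> R) (g' : I -> R) (x : R) :
  (forall i, is_derive x 1 (g i) (g' i)) ->
  is_derive x 1 (fun y => \sum_(i <- s) g i y) (\sum_(i <- s) g' i).
Proof.
move=> dg; elim: s => [|i s IH].
  rewrite big_nil; under eq_fun do rewrite big_nil; exact: is_derive_cst.
rewrite big_cons; under eq_fun do rewrite big_cons.
exact: is_deriveD (dg i) IH.
Qed.

Lemma is_derive_lattice_defect N (g : R -> int * int -> R) (g' : int * int -> R) (x : R) :
  (forall i, is_derive x 1 (g^~ i) (g' i)) ->
  is_derive x 1 (fun y => lattice_defect M N (g y)) (lattice_defect M N g').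
Proof.
move=> dg; rewrite /lattice_defect.
have d1 := is_derive_sum_seq (box N) dg.
have d2 := is_derive_sum_seq (box N) (fun i => dg (dilate M 0 i (0%N, 0%N))).
have d3 := is_derive_mul (is_derive_cst (M%:R ^+ 2 : R) x (1 : R)) d2.
apply: is_derive_eq (is_deriveB d1 d3) _.
by rewrite mul0r add0r.
Qed.

Section Direction.
Variables (e f g : R) (r s : nat).
Hypothesis dirE : forall u : R * R, qform e f g u = u.1 ^+ r * u.2 ^+ s.
Hypothesis rs : (r + s = 2)%N.

Lemma qform_line E F G x (u : R * R) :
  qform (E + x * e) (F + x * f) (G + x * g) u = qform E F G u + x * (u.1 ^+ r * u.2 ^+ s).
Proof. by rewrite -dirE /qform; ring. Qed.

(** The directions are chosen so that their form is one monomial: [(1, 0, 0)] gives [u^2],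
    [(0, 1/2, 0)] gives [u v], whence the half in front of the derivative in [F], and [(0, 0, 1)]
    gives [v^2]. Differentiating [Q ^ be] then only changes the exponents and brings out [be]. *)
Lemma is_derive_defect p q be E F G h x :
  posdef (E + x * e) (F + x * f) (G + x * g) ->
  is_derive x 1 (fun y => defect p q be (E + y * e) (F + y * f) (G + y * g) h)
   (be * defect (p + r) (q + s) (be - 1) (E + x * e) (F + x * f) (G + x * g) h).
Proof.
move=> pd; rewrite /defect.
have -> : be * lattice_defect M (cutoff_size h) (at_lattice (summand eta (p + r) (q + s)
    (E + x * e) (F + x * f) (G + x * g) (be - 1) 0 cos h)) =
  lattice_defect M (cutoff_size h) (fun i => be * at_lattice (summand eta (p + r) (q + s)
    (E + x * e) (F + x * f) (G + x * g) (be - 1) 0 cos h) i).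
  by rewrite /lattice_defect -!big_distrr/=; ring.
apply: is_derive_lattice_defect => i; rewrite /at_lattice.
case: (eqVneq i (0, 0)) => i0; first by rewrite mulr0; exact: is_derive_cst.
set u := lattice_pt i.
have Qp : 0 < qform (E + x * e) (F + x * f) (G + x * g) u.
  have [c c0 Hc] := posdef_lower pd; apply: lt_le_trans (Hc u).
  by rewrite mulr_gt0// exprn_gt0// norm_lattice_pt ltr0n weight_gt0.
rewrite /summand; under eq_fun do rewrite mul0r cos0 mulr1 qform_line.
rewrite mul0r cos0 mulr1; rewrite qform_line in Qp *.
set Q0 := qform E F G u in Qp *; set k := u.1 ^+ r * u.2 ^+ s in Qp *.
have dQ : is_derive x 1 (fun y => Q0 + y * k) k.
  apply: is_derive_eq (is_deriveD (is_derive_cst Q0 x (1 : R))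
    (is_derive_mul (is_derive_id x (1 : R)) (is_derive_cst k x (1 : R)))) _.
  by rewrite mulr0 addr0 mul1r add0r.
have dl := @is_derive1_comp _ (@ln R) (fun y => Q0 + y * k) x _ _ (is_derive1_ln Qp) dQ.
have db := is_derive_mul (is_derive_cst be x (1 : R)) dl.
have de := @is_derive1_comp _ (@expR R) (fun y => be * ln (Q0 + y * k)) x _ _ (is_derive_expR _) db.
have dz := is_derive_mul (is_derive_mul (is_derive_cst (u.1 ^+ p * u.2 ^+ q : R) x (1 : R)) de)
  (is_derive_cst (eta (h *: u)) x (1 : R)).
apply: is_derive_eq dz _.
rewrite mulrBl mul1r expRB lnK ?posrE//= !exprD /k; field.
by rewrite gt_eqF// -/k.
Qed.

(** A derivation adds [2] to [p + q] and takes [2] from [2 * be], so the order is preserved and the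
    same [n] bounds the second derivatives, as [limit_derivative] requires. *)
Lemma defect_step p q be (K : int) (V : R -> R -> R -> R) :
  2 * be <= K%:~R -> p%:Z + q%:Z + K + 4 <= n%:Z ->
  (forall E F G, posdef E F G -> tends0 (defect p q be E F G) (V E F G)) ->
  forall E F G, posdef E F G ->
  exists2 v : R, is_derive (0 : R) 1 (fun x => V (E + x * e) (F + x * f) (G + x * g)) v &
    tends0 (fun h => be * defect (p + r) (q + s) (be - 1) E F G h) v.
Proof.
move=> beK pqK HV E F G pd.
have [d [c [d0 c0 Hd]]] := posdef_nbhs pd.
pose m := `|e| + `|f| + `|g| + 1.
have m0 : 0 < m by rewrite ltr_wpDl// !addr_ge0.
pose d' := d / m; have d'0 : 0 < d' by rewrite divr_gt0.
have near x : `|x| < d' -> posdef (E + x * e) (F + x * f) (G + x * g) /\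
   forall u, c * `|u| ^+ 2 <= qform (E + x * e) (F + x * f) (G + x * g) u.
  move=> xd; have xm (b : R) : `|b| <= m -> `|x * b| < d.
    move=> bm; rewrite normrM; move: xd; rewrite ltr_pdivlMr//; apply: le_lt_trans.
    by rewrite ler_wpM2l.
  have := normr_ge0 e; have := normr_ge0 f; have := normr_ge0 g => ? ? ?.
  by apply: Hd; rewrite addrAC subrr add0r; apply: xm; rewrite /m; lra.
pose L := {hx : R * R | 0 < hx.1 /\ `|hx.2| < d'}.
have [C C0 HC] : exists2 C : R, 0 < C & forall (l : L) N, a <= N%:R * (sval l).1 ->
   `|lattice_defect M N (at_lattice (summand eta (p + r + r) (q + s + s)
     (E + (sval l).2 * e) (F + (sval l).2 * f) (G + (sval l).2 * g) (be - 1 - 1) 0 cos (sval l).1))| <= C.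
  pose B := `|E| + `|F| + `|G| + d.
  have xB (l : L) (y b : R) : `|b| <= m -> `|y| <= B - d -> `|y + (sval l).2 * b| <= B.
    move=> bm yB; have [_ xd] := svalP l.
    apply: le_trans (ler_normD _ _) _; rewrite normrM.
    move: xd; rewrite ltr_pdivlMr// => /ltW xd.
    have : `|(sval l).2| * `|b| <= `|(sval l).2| * m by rewrite ler_wpM2l.
    by lra.
  have NE := normr_ge0 E; have NF := normr_ge0 F; have NG := normr_ge0 G.
  have Ne := normr_ge0 e; have Nf := normr_ge0 f; have Ng := normr_ge0 g.
  apply: (lattice_defect_bound eta_smooth eta_supp
    (E := fun l : L => E + (sval l).2 * e) (F := fun l : L => F + (sval l).2 * f)
    (G := fun l : L => G + (sval l).2 * g) (al := fun=> be - 1 - 1) (be := fun=> 0)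
    (c := c) (B := B) (A := `|be - 1 - 1|) (K := K - 4) (h := fun l : L => (sval l).1)
    _ _ _ _ _ _ _ _ _ _ n0 (ltnW M1) cop) => //.
  - by move=> l; have [_ /near[_]] := svalP l.
  - by move=> l; apply: xB; rewrite /m /B; lra.
  - by move=> l; apply: xB; rewrite /m /B; lra.
  - by move=> l; apply: xB; rewrite /m /B; lra.
  - by move=> _; rewrite normr0.
  - by move=> _; rewrite rmorphB/=; lra.
  - by move=> l; have [] := svalP l.
  - by left.
  - by move: pqK rs; lia.
have := @limit_derivative R
  (fun h x => defect p q be (E + x * e) (F + x * f) (G + x * g) h)
  (fun h x => be * defect (p + r) (q + s) (be - 1) (E + x * e) (F + x * f) (G + x * g) h)
  (fun h x => be * ((be - 1) * defect (p + r + r) (q + s + s) (be - 1 - 1)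
     (E + x * e) (F + x * f) (G + x * g) h))
  (fun x => V (E + x * e) (F + x * f) (G + x * g)) d' (`|be| * (`|be - 1| * C)) d'0.
rewrite !mul0r !addr0; apply.
- by move=> h x h0 /near[pdx _]; exact: is_derive_defect.
- move=> h x h0 /near[pdx _].
  have := is_derive_mul (is_derive_cst be x (1 : R))
    (is_derive_defect (p + r) (q + s) (be - 1) h pdx).
  by rewrite mul0r add0r.
- move=> h x h0 xd; rewrite !normrM ler_wpM2l// ler_wpM2l//.
  pose l : L := exist _ (h, x) (conj h0 xd).
  exact: (HC l _ (cutoff_sizeP h0)).
- by move=> x /near[pdx _]; exact: HV.
Qed.

End Direction.
End ParameterDerivatives.

(** * Riemann sums of singular functions *)

Section RiemannSums.
Context {R : realType}.
Local Notation mu := (@lebesgue_measure R).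
Local Notation leb2 := (mu \x mu)%E.
Variables (G : R * R -> R) (B C : R) (e : nat -> R) (n : nat -> nat) (N : nat).
Hypotheses (B0 : 0 < B) (C0 : 0 < C).
Hypothesis G0 : G (0, 0) = 0.
Hypothesis G_cont : forall u, u != (0, 0) -> {for u, continuous G}.
Hypothesis G_le : forall u, u != (0, 0) -> `|G u| <= C / `|u|.
Hypothesis G_out : forall u, B < `|u| -> G u = 0.
Hypotheses (e0 : forall j, 0 < e j) (e1 : forall j, e j < 1).
Hypothesis e_cvg : e @ \oo --> 0.
Hypothesis n_large : forall j, B <= (n j)%:R * e j.
Hypothesis N_large : B <= N%:R.

Let D : set (R * R) := [set u | `|u| < N%:R + 2^-1].

Let side (d : R) (i : int) : set R := [set` `[d * i%:~R - d / 2, d * i%:~R + d / 2[%R].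
Let cell (d : R) (i : int * int) : set (R * R) := side d i.1 `*` side d i.2.
(** Rounding half up agrees with cells that are closed on the left and open on the right, so that
    each point lies in exactly one. *)
Let round (d x : R) : int := Num.floor (x / d + 2^-1).
Let round2 (d : R) (u : R * R) : int * int := (round d u.1, round d u.2).

Let mem_side d i x : 0 < d -> side d i x <-> i = round d x.
Proof.
move=> d0; rewrite /side /round /= in_itv/=.
have xd : x = d * (x / d) by field; rewrite gt_eqF.
have E (k : int) : (k%:~R <= x / d + 2^-1 < (k + 1)%:~R) =
    (d * k%:~R - d / 2 <= x < d * k%:~R + d / 2).
  rewrite {3 4}xd rmorphD/=; move: (x / d) (k%:~R) => z k'.
  rewrite -(ler_pM2l d0) -(ltr_pM2l d0) !mulrDr mulr1.
  by apply/idP/idP => /andP[? ?]; apply/andP; split; lra.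
split=> [|->]; first by rewrite -E => /floor_def.
by rewrite -E; exact: real_floor_itv (num_real _).
Qed.

Let mem_cell d i u : 0 < d -> cell d i u <-> i = round2 d u.
Proof.
move=> d0; case: i => i1 i2; rewrite /cell/= /round2; split.
  by move=> [/mem_side -> // /mem_side -> //].
by move=> [-> ->]; split; exact/mem_side.
Qed.

Let cell_dist d i u : 0 < d -> cell d i u -> `|d *: (lattice_pt i : R * R) - u| <= d / 2.
Proof.
move=> d0 [/= + +]; rewrite /side/= !in_itv/= => H1 H2.
rewrite prod_normE ge_max /= /GRing.scale/= !ler_norml.
by apply/andP; split; lra.
Qed.

Let measurable_cell d i : measurable (cell d i).
Proof. by apply: measurableX; exact: measurable_itv. Qed.

Let leb2_cell d i : 0 < d -> leb2 (cell d i) = (d ^+ 2)%:E.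
Proof.
move=> d0.
have S k : mu (side d k) = d%:E.
  rewrite lebesgue_measure_itv/= lte_fin ifT; last by lra.
  by rewrite -EFinB; congr (_%:E); lra.
transitivity (mu (side d i.1) * mu (side d i.2))%E.
  by apply: product_measure1E; exact: measurable_itv.
by rewrite !S -EFinM expr2.
Qed.

Let step j (u : R * R) : R :=
  \sum_(i <- box (n j)) G (e j *: lattice_pt i) * \1_(cell (e j) i) u.

Let G_out_box j i : i \notin box (n j) -> G (e j *: lattice_pt i) = 0.
Proof.
rewrite mem_box => ib; apply: G_out; rewrite normrZ gtr0_norm// norm_lattice_pt.
apply: le_lt_trans (n_large j) _; rewrite mulrC ltr_pM2l// ltr_nat /weight.
by move: ib; rewrite negb_and; lia.
Qed.

Let stepE j u : step j u = G (e j *: lattice_pt (round2 (e j) u)).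
Proof.
have indE i : \1_(cell (e j) i) u = (i == round2 (e j) u)%:R :> R.
  rewrite indicE; congr (_%:R); congr nat_of_bool; apply/idP/eqP.
    by rewrite inE => /mem_cell; exact.
  by move=> ->; rewrite inE; apply/mem_cell.
rewrite /step; under eq_bigr do rewrite indE.
have [rb|rb] := boolP (round2 (e j) u \in box (n j)).
  rewrite (bigD1_seq _ rb) ?box_uniq//= eqxx mulr1 big1 ?addr0// => i /negPf ->.
  by rewrite mulr0.
rewrite G_out_box// big_seq big1// => i ib.
case: eqVneq => [E|_]; last by rewrite mulr0.
by move: rb; rewrite -E ib.
Qed.

Let round_dist j u : `|e j *: (lattice_pt (round2 (e j) u) : R * R) - u| <= e j / 2.
Proof. by apply: cell_dist => //; exact/mem_cell. Qed.

Let step_cvg u : step ^~ u @ \oo --> G u.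
Proof.
have [->|u0] := eqVneq u (0, 0).
  have z j : step j (0, 0) = 0.
    rewrite stepE; have -> : round2 (e j) (0, 0) = (0, 0).
      apply/esym/mem_cell => //; split; rewrite /side/= in_itv/= mulr0;
      by have := e0 j; lra.
    by rewrite (_ : e j *: _ = (0, 0)) ?G0//; congr pair; exact: mulr0.
  by rewrite G0; under eq_fun do rewrite z; exact: cvg_cst.
under eq_fun do rewrite stepE.
apply: (cvg_comp (fun j => e j *: (lattice_pt (round2 (e j) u) : R * R)) G _ (G_cont u0)).
apply/cvgrPdist_le => t t0.
move/cvgrPdist_le : e_cvg => /(_ t t0); apply: filterS => j.
rewrite sub0r normrN gtr0_norm// => ejt; rewrite distrC.
by apply: le_trans (round_dist j u) _; have := e0 j; lra.
Qed.

(** An integrable substitute for a multiple of [1 / |u|], built from indicators of squares with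
    sides halving each time: heights grow like [2^t] while areas decrease like [4^-t], so the
    integral is bounded by a geometric series. The constant [K] combines the factor [2] between the
    norms of a point and of its grid point with the factor [2] between consecutive squares. *)
Let S (t : nat) : set (R * R) :=
  [set` `[- ((B + 1) * 2^-1 ^+ t), (B + 1) * 2^-1 ^+ t]%R] `*`
  [set` `[- ((B + 1) * 2^-1 ^+ t), (B + 1) * 2^-1 ^+ t]%R].
Let K : R := 4 * C / (B + 1).
Let shell t (u : R * R) : \bar R := (K * 2 ^+ t * \1_(S t) u)%:E.
Let dom u : \bar R := (\sum_(t <oo) shell t u)%E.

Let K0 : 0 < K.
Proof. by rewrite divr_gt0 ?mulr_gt0// addr_gt0. Qed.

Let shell_ge0 t u : (0 <= shell t u)%E.
Proof. by rewrite lee_fin mulr_ge0// mulr_ge0 ?exprn_ge0// ltW. Qed.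

Let measurable_S t : measurable (S t).
Proof. by apply: measurableX; exact: measurable_itv. Qed.

Let measurable_D : measurable D.
Proof.
rewrite /D (_ : [set _ | _] = [set` `]- (N%:R + 2^-1), N%:R + 2^-1[%R] `*`
   [set` `]- (N%:R + 2^-1), N%:R + 2^-1[%R]); first by apply: measurableX; exact: measurable_itv.
apply/seteqP; split=> -[x y] /=; rewrite prod_normE/= gt_max !in_itv/= -!ltr_norml.
  by move=> /andP[].
by move=> [-> ->].
Qed.

Let leb2_S t : leb2 (S t) = ((2 * ((B + 1) * 2^-1 ^+ t)) ^+ 2)%:E.
Proof.
have : 0 < (B + 1) * 2^-1 ^+ t by rewrite mulr_gt0 ?exprn_gt0// addr_gt0.
rewrite /S; move: (_ * _) => b b0.
transitivity (mu [set` `[- b, b]%R] * mu [set` `[- b, b]%R])%E.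
  by apply: product_measure1E; exact: measurable_itv.
rewrite lebesgue_measure_itv/= lte_fin ifT; last by lra.
by rewrite -EFinB -EFinM; congr (_%:E); ring.
Qed.

Let measurable_shell t : measurable_fun D (shell t).
Proof.
apply/measurable_EFinP; apply: measurable_funM; first exact: measurable_cst.
exact: measurable_indic.
Qed.

Let dom_integrable : leb2.-integrable D dom.
Proof.
apply/integrableP; split.
  by apply: ge0_emeasurable_sum => [t u _ _|t _]; [exact: shell_ge0|exact: measurable_shell].
under eq_integral.
  move=> u _; rewrite gee0_abs; last by apply: nneseries_ge0 => t _ _; exact: shell_ge0.
  over.
rewrite integral_nneseries//.
(* The height [K 2^t] times the area [4 (B + 1)^2 4^-t], written as [r / 2^(t + 1)] to match the
   library's geometric series. *)
pose r := K * 8 * (B + 1) ^+ 2.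
apply: (@le_lt_trans _ _ (\sum_(t <oo) (r / (2 ^ (t + 1))%:R)%:E)%E).
  apply: lee_nneseries => [t *|t *].
    by apply: integral_ge0 => u _; exact: shell_ge0.
  rewrite /shell; under eq_integral do rewrite EFinM.
  have -> : (\int[leb2]_(u in D) ((K * 2 ^+ t)%:E * (\1_(S t) u)%:E) =
     (K * 2 ^+ t)%:E * \int[leb2]_(u in D) (\1_(S t) u)%:E)%E.
    apply: ge0_integralZl => //.
    - by apply/measurable_EFinP; apply: measurable_indic; exact: measurable_S.
    - by rewrite lee_fin mulr_ge0 ?exprn_ge0// ltW.
  rewrite integral_indic//; last exact: measurable_S.
  apply: (@le_trans _ _ ((K * 2 ^+ t)%:E * leb2 (S t))%E).
    apply: lee_wpmul2l; first by rewrite lee_fin mulr_ge0 ?exprn_ge0// ltW.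
    by apply: le_measure; rewrite ?inE; [apply: measurableI; [exact: measurable_S|exact: measurable_D]|exact: measurable_S|exact: subIsetl].
  rewrite leb2_S -EFinM lee_fin /r natrX addn1 [2 ^+ t.+1]exprS.
  rewrite le_eqVlt; apply/orP; left; apply/eqP.
  have p0 : 2 ^+ t != 0 :> R by rewrite expf_neq0.
  rewrite exprVn; move: p0; move: (2 ^+ t : R) (K) (B + 1) => x k b x0.
  by field.
have -> : (\sum_(t <oo) (r / (2 ^ (t + 1))%:R)%:E = (r / 2 ^+ 0)%:E)%E.
  by apply: cvg_lim => //; exact: cvg_geometric_eseries_half.
exact: ltry.
Qed.

Let dominated j u : (`|(step j u)%:E| <= dom u)%E.
Proof.
rewrite stepE; set v := e j *: _.
have [v0|v0] := eqVneq v (0, 0).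
  by rewrite v0 G0 abse0; apply: nneseries_ge0 => t _ _; exact: shell_ge0.
have [Bv|vB] := ltP B `|v|.
  by rewrite (G_out Bv) abse0; apply: nneseries_ge0 => t _ _; exact: shell_ge0.
have := round_dist j u; rewrite -/v => vu.
(* A grid point other than the origin has norm at least one mesh, whereas [u] is within half a mesh
   of it. So [|u|] and [|v|] are comparable even next to the singularity; the cell of the origin
   carries the value [0]. *)
have ev : e j <= `|v|.
  rewrite /v normrZ gtr0_norm// norm_lattice_pt ler_peMr//; first exact: ltW.
  rewrite ler1n weight_gt0//; apply: contra_neq v0 => r0.
  by rewrite /v r0; congr pair; exact: mulr0.
have uv := ler_distD 0 u v; have vp : 0 < `|v| by exact: lt_le_trans ev.
have u_le : `|u| <= 2 * `|v|.
  have := lerB_dist u v; rewrite distrC => ?; lra.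
have u_ge : `|v| / 2 <= `|u| by have := lerB_dist v u; lra.
have uB : `|u| <= B + 1 by have := lerB_dist u v; rewrite distrC; have := e1 j; lra.
have up : 0 < `|u| by lra.
have B1 : 0 < B + 1 by rewrite addr_gt0.
have [t t1 t2] : exists2 t : nat, (B + 1) * 2^-1 ^+ t.+1 < `|u| & `|u| <= (B + 1) * 2^-1 ^+ t.
  have ex : exists t : nat, (B + 1) * 2^-1 ^+ t.+1 < `|u|.
    have d0 : 0 < `|u| / (B + 1) by rewrite divr_gt0.
    have /cvgrPdist_lt/(_ _ d0)[k _ /(_ k.+1 (leqnSn k))] :=
      @cvg_expr R 2^-1 ltac:(by rewrite ger0_norm// invf_lt1// ltr1n).
    rewrite sub0r normrN ger0_norm ?exprn_ge0// => H; exists k.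
    by rewrite mulrC -ltr_pdivlMr.
  exists (ex_minn ex); first by case: ex_minnP.
  case: ex_minnP => -[|t] H min; first by rewrite expr0 mulr1.
  by rewrite leNgt; apply/negP => /min; rewrite ltnn.
have uS : u \in S t.
  move: t2; rewrite prod_normE ge_max inE /S /= !in_itv/= -!ler_norml => /andP[-> ->].
  by [].
apply: (@le_trans _ _ (shell t u)).
  rewrite /shell indicE uS mulr1 lee_fin; apply: le_trans (G_le v0) _.
  rewrite ler_pdivrMr// /K.
  have : `|u| <= 2 * `|v| by [].
  have p2 : 0 < 2 ^+ t :> R by rewrite exprn_gt0.
  have : (B + 1) < 2 ^+ t * (2 * `|u|).
    by move: t1; rewrite exprVn ltr_pdivrMr ?exprn_gt0// exprS; lra.
  move=> H1 H2; rewrite mulrAC -mulrA mulrAC ler_pdivlMr//.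
  have : 2 ^+ t * (2 * `|u|) <= 2 ^+ t * (2 * (2 * `|v|)) by rewrite ler_pM2l//; lra.
  move=> H3; have : C * (B + 1) <= C * (2 ^+ t * (2 * (2 * `|v|))) by rewrite ler_pM2l//; lra.
  lra.
apply: (@le_trans _ _ (\sum_(0 <= k < t.+1) shell k u)%E); last first.
  by apply: nneseries_lim_ge => k _ _; exact: shell_ge0.
rewrite big_mkord big_ord_recr/= leeDr//.
by apply: sume_ge0 => k _; exact: shell_ge0.
Qed.

Let indic_integrable j i : leb2.-integrable D (fun u => (\1_(cell (e j) i) u)%:E).
Proof.
apply/integrableP; split.
  by apply/measurable_EFinP; apply: measurable_indic; exact: measurable_cell.
under eq_integral do rewrite gee0_abs ?lee_fin//.
rewrite integral_indic//; last exact: measurable_cell.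
apply: (@le_lt_trans _ _ (leb2 (cell (e j) i))).
  by apply: le_measure; rewrite ?inE; [apply: measurableI; [exact: measurable_cell|exact: measurable_D]|exact: measurable_cell|exact: subIsetl].
by rewrite leb2_cell ?ltry.
Qed.

Let step_integrable j : leb2.-integrable D (EFin \o step j).
Proof.
rewrite /step (_ : EFin \o _ = fun u => (\sum_(i <- box (n j))
   (G (e j *: lattice_pt i))%:E * (\1_(cell (e j) i) u)%:E)%E); last first.
  by apply/funext => u /=; rewrite -sumEFin; apply: eq_bigr => i _; rewrite EFinM.
by apply: integrable_sum => // i _; apply: integrableZl => //; exact: indic_integrable.
Qed.

Let integral_step j : (\int[leb2]_(u in D) (step j u)%:E =
  (e j ^+ 2 * \sum_(i <- box (n j)) G (e j *: lattice_pt i))%:E)%E.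
Proof.
transitivity (\int[leb2]_(u in D) (\sum_(i <- box (n j))
   (G (e j *: lattice_pt i))%:E * (\1_(cell (e j) i) u)%:E))%E.
  apply: eq_integral => u _; rewrite /step -sumEFin.
  by apply: eq_bigr => i _; rewrite EFinM.
rewrite integral_sum//; last by move=> i; apply: integrableZl => //; exact: indic_integrable.
rewrite big_distrr/= -sumEFin; apply: eq_bigr => i _.
rewrite (integralZl _ (indic_integrable j i)); last exact: measurable_D.
rewrite integral_indic//; last exact: measurable_cell.
have [B'|B'] := ltP B `|e j *: (lattice_pt i : R * R)|.
  by rewrite (G_out B') mul0e mulr0.
(* The extra [1/2] in the radius of [D] is used here: a cell centred within [B <= N] extends by less
   than [1/2]. *)
rewrite (_ : cell (e j) i `&` D = cell (e j) i).
  by rewrite [X in (_ = X%:E)%E]mulrC EFinM; congr (_ * _)%E; exact: leb2_cell.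
apply/setIidPl => u /(cell_dist (e0 j)) H; rewrite /D/=.
have := lerB_dist u (e j *: (lattice_pt i : R * R)); rewrite distrC => ?.
by have := e1 j; have := e0 j; have := N_large; lra.
Qed.

Theorem riemann_sum_cvg :
  e j ^+ 2 * \sum_(i <- box (n j)) G (e j *: lattice_pt i) @[j --> \oo] -->
  \int[leb2]_(u in D) G u.
Proof.
have sc u : D u -> (fun j => (step j u)%:E) @ \oo --> (G u)%:E.
  by move=> _; apply: cvg_EFin; [exact: nearW|exact: step_cvg].
have mG : measurable_fun D (EFin \o G).
  apply: (emeasurable_fun_cvg (fun j u => (step j u)%:E)) => [j|u Du].
    by have /integrableP[] := step_integrable j.
  exact: sc.
have ms j : measurable_fun D (EFin \o step j) by exact: measurable_int (step_integrable j).
have [] := @dominated_convergence _ _ R leb2 D _ (fun j => EFin \o step j) (EFin \o G) dom ms mG.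
- exact: measurable_D.
- by apply: aeW => u; exact: sc.
- exact: dom_integrable.
- by apply: aeW => u j _; exact: dominated.
move=> iG _; rewrite /Rintegral; set I := (X in fine X).
have If : I \is a fin_num by exact: integrable_fin_num.
rewrite -[X in _ --> X -> _](fineK If) => /fine_cvg/=.
by under eq_fun do rewrite /= integral_step /=.
Qed.

End RiemannSums.

(** * Sums minus integrals *)

Section WignerLimit.
Context {R : realType}.
Variables (eta : R * R -> R) (a : R).
Hypothesis a0 : 0 < a.
Hypothesis eta_smooth : smooth eta.
Hypothesis eta_supp : closure [set u | eta u != 0] `<=` [set u | `|u| <= a].
Variables (E F G : R) (m d l : nat).
Hypothesis hQ : posdef E F G.
Hypotheses (md : (m <= d)%N) (hl : (l <= 2 * d)%N).

Let f (u : R * R) : R := u.1 ^+ (2 * d - l) * u.2 ^+ l.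
Let g (h : R) : R * R -> R := wigner_integrand E F G eta m h f.
Let al : R := m%:R + 2^-1.

Let al0 : 0 < al. Proof. by rewrite ltr_wpDl ?invr_gt0. Qed.

Let Q_gt0 u : u != (0, 0) -> 0 < qform E F G u.
Proof.
move=> u0; have [c c0 Hc] := posdef_lower hQ; apply: lt_le_trans (Hc u).
by rewrite mulr_gt0// exprn_gt0// normr_gt0.
Qed.

Let eta_out u : a < `|u| -> eta u = 0.
Proof. exact: (iter_derive_out eta_supp 0 0). Qed.

Let g0 h : g h (0, 0) = 0.
Proof.
rewrite /g /wigner_integrand (_ : qform _ _ _ _ = 0); last by rewrite /qform/= expr0n/= !mulr0 !addr0.
by rewrite powR0 ?gt_eqF// invr0 mulr0 mul0r.
Qed.

Let g_summand h u : u != (0, 0) -> g h u = summand eta (2 * d - l) l E F G (- al) 0 cos h u.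
Proof.
move=> u0; rewrite /g /wigner_integrand /summand mul0r cos0 mulr1 mulNr expRN.
by rewrite /powR gt_eqF ?Q_gt0.
Qed.

Let at_lattice_g h i : g h (lattice_pt i) =
  at_lattice (summand eta (2 * d - l) l E F G (- al) 0 cos h) i.
Proof.
rewrite /at_lattice; case: eqVneq => [->|i0]; first exact: g0.
apply: g_summand; apply: contra_neq i0 => /= [[/eqP + /eqP]].
by rewrite !intr_eq0; case: i => i j /= /eqP -> /eqP ->.
Qed.

Let g_continuous h u : u != (0, 0) -> {for u, continuous (g h)}.
Proof.
move=> u0; rewrite /prop_for /continuous_at.
have c1 : (x : R * R).1 @[x --> u] --> u.1 by exact: cvg_fst.
have c2 : (x : R * R).2 @[x --> u] --> u.2 by exact: cvg_snd.
have cX n (v : R * R -> R) : v x @[x --> u] --> v u -> v x ^+ n @[x --> u] --> v u ^+ n.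
  by move=> cv; apply: (cvg_comp v (fun y => y ^+ n) cv); exact: exprn_continuous.
have cQ : qform E F G x @[x --> u] --> qform E F G u.
  apply: cvgD; [apply: cvgD|].
  - by apply: cvgM; [exact: cvg_cst|exact: cX].
  - by apply: cvgM => //; apply: cvgM => //; exact: cvg_cst.
  - by apply: cvgM; [exact: cvg_cst|exact: cX].
have cP : qform E F G x `^ al @[x --> u] --> qform E F G u `^ al.
  have cp : {for qform E F G u, continuous (fun y : R => y `^ al)}.
    by apply/differentiable_continuous/derivable1_diffP; have [] := is_derive1_powR al (Q_gt0 u0).
  exact: (cvg_comp (qform E F G) _ cQ cp).
have cE : eta (h *: x) @[x --> u] --> eta (h *: u).
  have ch : h *: x @[x --> u] --> h *: u by apply: cvgZr; exact: cvg_id.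
  have ce : {for h *: u, continuous eta} by apply/differentiable_continuous; exact: (eta_smooth [::]).
  exact: (cvg_comp _ _ ch ce).
apply: cvgM => //; apply: cvgM; first by apply: cvgM; exact: cX.
by apply: cvgV => //; rewrite gt_eqF// powR_gt0// Q_gt0.
Qed.

Let g_out h u : 0 < h -> a / h < `|u| -> g h u = 0.
Proof.
move=> h0 hu; rewrite /g /wigner_integrand eta_out ?mulr0//.
by rewrite normrZ gtr0_norm// mulrC -ltr_pdivrMr.
Qed.

Let powR_al (x : R) : 0 <= x -> (x ^+ 2) `^ al = x ^+ (2 * m).+1.
Proof.
move=> x0; rewrite -!powR_mulrn// -powRrM; congr (_ `^ _).
by rewrite /al -[RHS]natr1 natrM; field.
Qed.

(** The quotient is homogeneous of degree [2 (d - m) - 1 >= - 1], and on the bounded support the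
    surplus power is bounded. *)
Let g_le h : 0 < h -> exists2 C : R, 0 < C & forall u, u != (0, 0) -> `|g h u| <= C / `|u|.
Proof.
move=> h0; have [c c0 Hc] := posdef_lower hQ.
have [D D0 HD] := iter_derive_bounded eta_smooth eta_supp 0 0.
have B0 : 0 < a / h by rewrite divr_gt0.
exists ((a / h) ^+ (2 * (d - m)) / c `^ al * D).
  by rewrite mulr_gt0// divr_gt0 ?exprn_gt0// powR_gt0.
move=> u u0; have up : 0 < `|u| by rewrite normr_gt0.
have [hu|uh] := ltP (a / h) `|u|.
  by rewrite g_out// normr0 divr_ge0// mulr_ge0 ?(ltW D0)// divr_ge0 ?powR_ge0// exprn_ge0// ltW.
rewrite /g /wigner_integrand normrM [leRHS]mulrAC; apply: ler_pM => //.
rewrite normf_div [`|_ `^ _|]ger0_norm ?powR_ge0//.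
apply: (@le_trans _ _ (`|u| ^+ (2 * d) / (c `^ al * `|u| ^+ (2 * m).+1))).
  apply: ler_pM => //; first by rewrite invr_ge0 powR_ge0.
    rewrite /f -(subnK hl) exprD normrM !normrX subnK//.
    by apply: ler_pM; rewrite ?exprn_ge0//; apply: lerXn2r; rewrite ?nnegrE//;
      [exact: fst_le_norm|exact: snd_le_norm].
  rewrite lef_pV2 ?posrE ?powR_gt0 ?Q_gt0//; last by rewrite mulr_gt0 ?powR_gt0 ?exprn_gt0.
  rewrite -powR_al// -powRM ?exprn_ge0 ?(ltW c0)//.
  by apply: ge0_ler_powR; rewrite ?nnegrE ?(ltW al0) ?(ltW (Q_gt0 u0))// mulr_ge0 ?exprn_ge0// ltW.
rewrite (_ : (2 * d)%N = (2 * (d - m) + 2 * m)%N); last by lia.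
have cp : 0 < c `^ al by rewrite powR_gt0.
rewrite (_ : _ / _ = `|u| ^+ (2 * (d - m)) / c `^ al / `|u|); last first.
  rewrite exprD [`|u| ^+ (2 * m).+1]exprS.
  have : `|u| ^+ (2 * m) != 0 by rewrite gt_eqF// exprn_gt0.
  move: (`|u| ^+ (2 * m)) (`|u| ^+ (2 * (d - m))) => x y x0; field.
  by rewrite x0 !gt_eqF.
rewrite ler_pM2r ?invr_gt0// ler_pM2r ?invr_gt0//.
by apply: lerXn2r; rewrite ?nnegrE// ltW.
Qed.

(** The factor [x ^ 2] is that of an area element, so the exponent on the right is
    [2 (d - m) - 1 + 2]. *)
Let g_scale h x u : 0 < x -> x ^+ 2 * g h (x *: u) = x ^+ (2 * (d - m)).+1 * g (h * x) u.
Proof.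
move=> x0; have [->|u0] := eqVneq u (0, 0).
  by rewrite (_ : x *: _ = (0, 0)) ?g0 ?mulr0//; congr pair; exact: mulr0.
rewrite /g /wigner_integrand scalerA.
have -> : qform E F G (x *: u) = x ^+ 2 * qform E F G u.
  by rewrite /qform /= /GRing.scale/=; ring.
have -> : f (x *: u) = x ^+ (2 * d) * f u.
  rewrite /f /= /GRing.scale/= !exprMn -{3}(subnK hl) exprD; ring.
rewrite powRM ?sqr_ge0 ?(ltW (Q_gt0 u0))// powR_al ?(ltW x0)//.
rewrite (_ : (2 * d)%N = (2 * (d - m) + 2 * m)%N); last by lia.
have : qform E F G u `^ al != 0 by rewrite gt_eqF// powR_gt0// Q_gt0.
rewrite -/al exprD [x ^+ (2 * m).+1]exprS [x ^+ (2 * (d - m)).+1]exprS.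
have : x ^+ (2 * m) != 0 by rewrite gt_eqF// exprn_gt0.
move: (x ^+ (2 * m)) (x ^+ (2 * (d - m))) (_ `^ _) (f u) (eta _) => y z w v t y0 w0; field.
by rewrite y0 w0 gt_eqF.
Qed.

Let S h N := \sum_(i <- box N) g h (lattice_pt i).

Let S_large h N N' : 0 < h -> a <= N%:R * h -> a <= N'%:R * h -> S h N = S h N'.
Proof.
move=> h0 aN aN'; have sp k : a <= k%:R * h -> supported k (fun i => g h (lattice_pt i)).
  move=> ak i; rewrite at_lattice_g.
  exact: (@supported_at_lattice _ _ _ eta_supp unit (fun=> E) (fun=> F) (fun=> G) (fun=> - al)
    (fun=> 0) (fun=> h) 1 _ _ _ ltr01 (fun=> h0) tt _ ak).
apply: eq_big_support; [exact: box_uniq..|move=> i gi].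
by rewrite (sp N)// (sp N').
Qed.

Let Sc h := S h (cutoff_size a h).

Variables (M : nat) (L : R).
Hypothesis M1 : (1 < M)%N.
Hypothesis defect_cvg : tends0 (defect eta a M (2 * d - l) l (- al) E F G) L.

Let k := (2 * (d - m)).+1.
Let lam : R := M%:R ^- k.
(** By homogeneity this is the Riemann sum of [g h] with mesh [M ^- j]. *)
Let T h j := lam ^+ j * Sc (h * M%:R ^- j).

Let Mp : 0 < M%:R :> R. Proof. by rewrite ltr0n ltnW. Qed.
Let lam0 : 0 < lam. Proof. by rewrite invr_gt0 exprn_gt0. Qed.

Let Mk : 2 <= M%:R ^+ k :> R.
Proof. by rewrite -natrX ler_nat (leq_trans M1)// -[X in (X <= _)%N]expn1 leq_pexp2l// ltnW. Qed.

(* [T h] telescopes from the lattice sum at scale [h] to the integral. *)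
Let T_step h j : 0 < h -> T h j.+1 - T h j =
  lam ^+ j.+1 * defect eta a M (2 * d - l) l (- al) E F G (h * M%:R ^- j.+1).
Proof.
move=> h0; set x := h * M%:R ^- j.+1.
have x0 : 0 < x by rewrite mulr_gt0// invr_gt0 exprn_gt0.
have xE : h * M%:R ^- j = x * M%:R.
  by rewrite /x exprS invfM; field; rewrite expf_neq0// gt_eqF.
have -> : defect eta a M (2 * d - l) l (- al) E F G x = Sc x - M%:R ^+ k * Sc (x * M%:R).
  rewrite /defect /lattice_defect /Sc /S; congr (_ - _).
    by apply: eq_bigr => i _; rewrite at_lattice_g.
  have -> : \sum_(i <- box (cutoff_size a (x * M%:R))) g (x * M%:R) (lattice_pt i) =
     \sum_(i <- box (cutoff_size a x)) g (x * M%:R) (lattice_pt i).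
    apply: S_large; [exact: mulr_gt0|exact: cutoff_sizeP (mulr_gt0 _ _)|].
    apply: le_trans (cutoff_sizeP a x0) _; rewrite ler_wpM2l// ler_peMr ?(ltW x0)//.
    by rewrite ler1n ltnW.
  rewrite !big_distrr/=; apply: eq_bigr => i _; rewrite -at_lattice_g -g_scale//.
  congr (_ * g _ _); rewrite /dilate /lattice_pt/= !mul0r !addr0 !intrM.
  by congr pair.
rewrite /T xE mulrBr; congr (_ - _); rewrite mulrA; congr (_ * _).
by rewrite exprS [lam * _]mulrC -mulrA mulVf ?mulr1// gt_eqF// exprn_gt0.
Qed.

Let T_cvg h N : 0 < h -> a <= N%:R * h ->
  T h j @[j --> \oo] --> \int[leb2]_(u in [set u | `|u| < N%:R + 2^-1]) g h u.
Proof.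
move=> h0 aN; pose e j : R := M%:R ^- j.+1.
have Mj j : 1 < M%:R ^+ j.+1 :> R by rewrite exprn_egt1// ltr1n.
have e0 j : 0 < e j by rewrite invr_gt0 (lt_trans ltr01).
have [C C0 HC] := g_le h0.
(* Dropping the first term makes every mesh smaller than [1], as [riemann_sum_cvg] asks. *)
rewrite -(cvg_shiftS (T h)).
have -> : (fun j => T h j.+1) = (fun j => e j ^+ 2 *
    \sum_(i <- box (cutoff_size a (h * e j))) g h (e j *: lattice_pt i)).
  apply/funext => j; rewrite /T /Sc /S !big_distrr/=; apply: eq_bigr => i _.
  rewrite g_scale// /lam -/(e j) -/k; congr (_ * _).
  by rewrite /e !exprVn -!exprM mulnC.
apply: (@riemann_sum_cvg _ (g h) (a / h) C) => //.
- by rewrite divr_gt0.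
- by move=> u u0; exact: g_continuous.
- by move=> u; exact: g_out.
- by move=> j; rewrite invf_lt1 ?(lt_trans ltr01).
- rewrite (_ : e = (fun j => M%:R^-1 ^+ j.+1)); last by apply/funext => j; rewrite /e exprVn.
  rewrite (cvg_shiftS (fun j => M%:R^-1 ^+ j : R)); apply: cvg_expr.
  by rewrite ger0_norm ?invr_ge0 ?(ltW Mp)// invf_lt1// ltr1n.
- move=> j; rewrite ler_pdivrMr// -mulrA [e j * h]mulrC; apply: cutoff_sizeP.
  exact: mulr_gt0.
- by rewrite ler_pdivrMr.
Qed.

(** Once the box covers the support, neither the sum nor the integral depends on [N]. The successor
    accounts for the strict inequality in [punctured_square]. *)
Let wigner_seq_eq h N : 0 < h -> a <= N%:R * h ->
  wigner_seq E F G eta m f h N.+1 =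
  Sc h - lim (T h j @[j --> \oo]).
Proof.
move=> h0 aN; have aN1 : a <= N.+1%:R * h.
  by apply: le_trans aN _; rewrite ler_pM2r// ler_nat.
rewrite (cvg_lim _ (T_cvg h0 aN1))//; congr (_ - _).
rewrite punctured_square_sum /Sc (S_large h0 (cutoff_sizeP a h0) aN).
rewrite /S big_mkcond; apply: eq_bigr => i _.
by case: eqVneq => [->|//]; rewrite g0.
Qed.

Let wigner_seq_cvg h : 0 < h ->
  wigner_seq E F G eta m f h N @[N --> \oo] --> Sc h - lim (T h j @[j --> \oo]).
Proof.
move=> h0; rewrite -(cvg_shiftS (wigner_seq E F G eta m f h)); apply: cvg_near_cst.
exists (cutoff_size a h) => // N /= hN; apply: wigner_seq_eq => //.
by apply: le_trans (cutoff_sizeP a h0) _; rewrite ler_pM2r// ler_nat.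
Qed.

(** Telescoping, sum minus integral is minus the series of the terms [lam ^ (j + 1)] times the
    defects at the scales [h / M ^ (j + 1)]. With every defect near [L] this is near
    [- L * lam / (1 - lam) = L / (1 - M ^ k)]. *)
Theorem wigner_limit :
  (forall h, 0 < h -> cvg (wigner_seq E F G eta m f h N @[N --> \oo])) /\
  tends0 (wigner_h E F G eta m f) (L / (1 - M%:R ^+ k)).
Proof.
split=> [h h0|t t0]; first by apply/cvg_ex; eexists; exact: wigner_seq_cvg.
have [h1 h10 H] := defect_cvg t0; exists h1 => // h h0 hh1.
rewrite /wigner_h (cvg_lim _ (wigner_seq_cvg h0))//.
have cT := T_cvg h0 (cutoff_sizeP a h0).
rewrite (cvg_lim _ cT)//; move: cT; move: (\int[_]_(_ in _) _) => I cT.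
set c := L / (1 - M%:R ^+ k).
have Mk1 : 1 - M%:R ^+ k != 0 :> R by rewrite lt_eqF// subr_lt0 (lt_le_trans _ Mk)// ltr1n.
have lamM : lam * M%:R ^+ k = 1 by rewrite mulVf// gt_eqF// exprn_gt0.
have lam2 : 2 * lam <= 1 by have : lam * 2 <= lam * M%:R ^+ k; [rewrite ler_pM2l|lra].
(* The partial sums with their error. Since [lam <= 1/2], each new error [t * lam ^ (j + 1)] is at
   most [t * (lam ^ j - lam ^ (j + 1))], so the total stays below [t]. *)
have est j : `|T h j - c * lam ^+ j - (Sc h - c)| <= t * (1 - lam ^+ j).
  elim: j => [|j IH].
    by rewrite /T !expr0 mul1r mulr1 invr1 mulr1 !subrr mulr0 normr0.
  set D := defect eta a M (2 * d - l) l (- al) E F G (h * M%:R ^- j.+1).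
  have hD : `|D - L| <= t.
    apply: H; first by rewrite mulr_gt0// invr_gt0 exprn_gt0.
    apply: le_lt_trans hh1; rewrite ler_piMr ?(ltW h0)// invf_le1 ?exprn_gt0//.
    by rewrite exprn_ege1// ler1n ltnW.
  have -> : T h j.+1 - c * lam ^+ j.+1 - (Sc h - c) =
      (T h j - c * lam ^+ j - (Sc h - c)) + lam ^+ j.+1 * (D - L).
    have -> : T h j.+1 = T h j + lam ^+ j.+1 * D by rewrite /D -T_step// addrC subrK.
    have -> : L = c * (1 - M%:R ^+ k) by rewrite /c divfK.
    have : lam ^+ j.+1 * (c * M%:R ^+ k) = c * lam ^+ j.
      by rewrite mulrCA exprSr -[lam ^+ j * lam * _]mulrA lamM mulr1.
    move=> E'; rewrite [c * (1 - _)]mulrBr mulr1 [lam ^+ j.+1 * (D - _)]mulrBr.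
    rewrite [lam ^+ j.+1 * (c - _)]mulrBr E'.
    by move: (Sc h) (T h j) (lam ^+ j) (lam ^+ j.+1 * D) (lam ^+ j.+1) => x y z w v; ring.
  apply: le_trans (ler_normD _ _) _.
  have lj : 0 < lam ^+ j.+1 by rewrite exprn_gt0.
  rewrite normrM (gtr0_norm lj).
  have : lam ^+ j.+1 * `|D - L| <= lam ^+ j.+1 * t by rewrite ler_pM2l.
  have : t * (2 * lam ^+ j.+1) <= t * lam ^+ j.
    by rewrite ler_pM2l// exprSr mulrCA -[leRHS]mulr1 ler_pM2l ?exprn_gt0.
  lra.
have clam : c * lam ^+ j @[j --> \oo] --> c * 0.
  apply: cvgM; first exact: cvg_cst.
  by apply: cvg_expr; rewrite gtr0_norm//; lra.
have c1 : `|T h j - c * lam ^+ j - (Sc h - c)| @[j --> \oo] --> `|I - c * 0 - (Sc h - c)|.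
  by apply: cvg_norm; apply: cvgB; [exact: cvgB|exact: cvg_cst].
have -> : Sc h - I - c = - (I - c * 0 - (Sc h - c)) by ring.
rewrite normrN -(cvg_lim _ c1)//; apply: limr_le; first by apply/cvg_ex; eexists; exact: c1.
apply: nearW => j; apply: le_trans (est j) _.
by rewrite ler_piMr ?(ltW t0)// lerBlDr lerDl exprn_ge0// ltW.
Qed.

End WignerLimit.

(** * Iterated derivatives of the zeta function as limits of defects *)

Section Tracking.
Context {R : realType}.
Local Notation C := R[i].
Variables (eta : R * R -> R) (a : R).
Hypothesis eta_smooth : smooth eta.
Hypothesis eta_supp : closure [set u | eta u != 0] `<=` [set u | `|u| <= a].
Variables (M n : nat).
Hypotheses (n0 : (0 < n)%N) (M1 : (1 < M)%N).
Hypothesis cop : forall j, (0 < j <= n)%N -> coprime j M.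
Variables (b ka : R) (K : int).
Hypotheses (b0 : forall i : nat, b - i%:R != 0) (ka0 : ka != 0).
Hypotheses (bK : 2 * b <= K%:~R) (Kn : K + 4 <= n%:Z).
Implicit Type W : R -> R -> R -> C.

(** After [i] derivations of [Q ^ b] the falling factorial [b (b - 1) ... (b - i + 1)] stands before
    the defect, hence the product in the denominator; [ka] will be [1 - M ^ k]. The claim covers all
    positive definite forms so that it can be differentiated again, and reality is included because
    [cderive1] acts on both parts. *)
Definition tracks W (p q i : nat) : Prop := forall E F G, posdef E F G ->
  complex.Im (W E F G) = 0 /\
  tends0 (defect eta a M p q (b - i%:R) E F G)
    (ka / (\prod_(t < i) (b - t%:R)) * complex.Re (W E F G)).

Lemma is_derive_affine (phi : R -> R) (x e v : R) : e != 0 ->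
  is_derive (0 : R) 1 (fun y : R => phi (x + y * e)) v -> is_derive x 1 phi (v / e).
Proof.
move=> e0 dphi.
have dg : is_derive x 1 (fun y => (y - x) * e^-1) e^-1.
  apply: is_derive_eq (is_derive_mul (is_deriveB (is_derive_id x (1 : R))
    (is_derive_cst x x (1 : R))) (is_derive_cst e^-1 x (1 : R))) _.
  by rewrite mulr0 addr0 subr0 mul1r.
have dphi' : is_derive ((x - x) * e^-1) 1 (fun y : R => phi (x + y * e)) v by rewrite subrr mul0r.
have := @is_derive1_comp _ _ (fun y => (y - x) * e^-1) x _ _ dphi' dg.
rewrite (_ : _ \o _ = phi)//; apply/funext => y /=.
by rewrite divfK// addrC subrK.
Qed.

Section Direction.
Variables (e f g : R) (r s : nat).
Hypothesis dirE : forall u : R * R, qform e f g u = u.1 ^+ r * u.2 ^+ s.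
Hypothesis rs : (r + s = 2)%N.

(** As [p + q = 2 i], the order [p + q + 2 (b - i)] is [2 b] at every stage, so the single condition
    [Kn] on [n] suffices for any number of derivations. *)
Lemma tracks_derive W p q i : (p + q = 2 * i)%N -> tracks W p q i ->
  forall E F G, posdef E F G -> exists2 v : R,
  is_derive (0 : R) 1 (fun x => complex.Re (W (E + x * e) (F + x * f) (G + x * g))) v &
  tends0 (defect eta a M (p + r) (q + s) (b - i.+1%:R) E F G)
    (ka / (\prod_(t < i.+1) (b - t%:R)) * v).
Proof.
move=> pq HW E F G pd; set w := ka / \prod_(t < i) (b - t%:R).
have P0 j : \prod_(t < j) (b - t%:R) != 0 by apply/prodf_neq0 => t _; exact: b0.
have w0 : w != 0 by rewrite mulf_neq0// invr_eq0.
have [||v dv tv] := defect_step eta_smooth eta_supp n0 M1 cop dirE rs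
  (p := p) (q := q) (be := b - i%:R) (K := K - 2 * i%:Z)
  (V := fun E F G => w * complex.Re (W E F G)) _ _ (fun E F G pd => proj2 (HW E F G pd)) pd.
- by rewrite rmorphB rmorphM/= mulrBr lerB// -pmulrn.
- by move: Kn; lia.
exists (w^-1 * v).
  have := is_derive_mul (is_derive_cst w^-1 (0 : R) (1 : R)) dv.
  rewrite mul0r add0r; congr (is_derive _ _ _ _).
  by apply/funext => x; rewrite mulKf.
have := tends0Z (b - i%:R)^-1 tv.
rewrite (_ : (fun h => _) = defect eta a M (p + r) (q + s) (b - i%:R - 1) E F G); last first.
  by apply/funext => h; rewrite mulKf.
rewrite -natr1 opprD addrA; congr (tends0 _ _).
rewrite big_ord_recr/= /w invfM -!mulrA; move: (P0 i) (b0 i).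
by move: (\prod_(t < i) _) (b - _) => x y x0 y0; field; rewrite x0 y0 ka0.
Qed.

Lemma posdef_line_near E F G : posdef E F G ->
  \forall x \near (0 : R), posdef (E + x * e) (F + x * f) (G + x * g).
Proof.
move=> /posdef_nbhs[d [c [d0 _ Hd]]].
have near (t : R) : \forall x \near (0 : R), `|x * t| < d.
  have c0 : `|x * t| @[x --> (0 : R)] --> `|0 * t|.
    by apply: cvg_norm; apply: cvgM; [exact: cvg_id|exact: cvg_cst].
  by apply: (cvgr_lt _ c0); rewrite mul0r normr0.
near=> x; apply: (proj1 (Hd _ _ _ _ _ _)); rewrite addrAC subrr add0r; near: x; exact: near.
Unshelve. all: by end_near. Qed.

End Direction.

Lemma cderive1_real (phi : R -> C) (x v : R) :
  is_derive x 1 (fun y => complex.Re (phi y)) v ->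
  (\forall y \near x, complex.Im (phi y) = 0) -> cderive1 phi x = v%:C.
Proof.
move=> dv Im0; rewrite /cderive1 !derive1E derive_val; congr (_ +i* _).
by rewrite (@near_eq_derive _ _ _ _ (cst 0)) ?derive_cst.
Qed.

Lemma near_affine (P : R -> Prop) (x e : R) : e != 0 ->
  (\forall y \near (0 : R), P (x + y * e)) -> \forall y \near x, P y.
Proof.
move=> e0 nP.
have c0 : (y - x) / e @[y --> x] --> (x - x) / e.
  by apply: cvgM; [apply: cvgB; [exact: cvg_id|exact: cvg_cst]|exact: cvg_cst].
rewrite subrr mul0r in c0; have : \forall y \near x, P (x + (y - x) / e * e) by exact: c0 nP.
apply: filterS => y.
by rewrite divfK// addrC subrK.
Qed.

Lemma tracks_dE W p q i : (p + q = 2 * i)%N -> tracks W p q i ->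
  tracks (dE W) (p + 2) q i.+1.
Proof.
move=> pq HW E F G pd.
have dirE (u : R * R) : qform 1 0 0 u = u.1 ^+ 2 * u.2 ^+ 0 by rewrite /qform; ring.
have [v dv] := tracks_derive dirE erefl pq HW pd; rewrite addn0 => tv.
suff -> : dE W E F G = v%:C by split.
apply: cderive1_real; last first.
  apply: (@near_affine _ E 1) => //.
  have := posdef_line_near 1 0 0 pd; apply: filterS => x; rewrite !mulr0 !addr0.
  by move=> /HW[].
rewrite -[v]divr1; apply: is_derive_affine => //.
move: dv; congr (is_derive _ _ _ _).
by apply/funext => x; rewrite !mulr0 !addr0.
Qed.

Lemma tracks_half_dF W p q i : (p + q = 2 * i)%N -> tracks W p q i ->
  tracks (half_dF W) (p + 1) (q + 1) i.+1.
Proof.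
move=> pq HW E F G pd.
have dirE (u : R * R) : qform 0 2^-1 0 u = u.1 ^+ 1 * u.2 ^+ 1 by rewrite /qform; field.
have [v dv tv] := tracks_derive dirE erefl pq HW pd.
have h0 : 2^-1 != 0 :> R by rewrite invr_eq0.
suff -> : half_dF W E F G = v%:C by split.
rewrite /half_dF (_ : cderive1 _ F = (v / 2^-1)%:C).
  by rewrite invrK mulrC rmorphM/= rmorph_nat mulfK.
apply: cderive1_real; last first.
  apply: (@near_affine _ F 2^-1) => //.
  have := posdef_line_near 0 2^-1 0 pd; apply: filterS => x; rewrite !mulr0 !addr0.
  by move=> /HW[].
apply: is_derive_affine => //; move: dv; congr (is_derive _ _ _ _).
by apply/funext => x; rewrite !mulr0 !addr0.
Qed.

Lemma tracks_dG W p q i : (p + q = 2 * i)%N -> tracks W p q i ->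
  tracks (dG W) p (q + 2) i.+1.
Proof.
move=> pq HW E F G pd.
have dirE (u : R * R) : qform 0 0 1 u = u.1 ^+ 0 * u.2 ^+ 2 by rewrite /qform; ring.
have [v dv] := tracks_derive dirE erefl pq HW pd; rewrite addn0 => tv.
suff -> : dG W E F G = v%:C by split.
apply: cderive1_real; last first.
  apply: (@near_affine _ G 1) => //.
  have := posdef_line_near 0 0 1 pd; apply: filterS => x; rewrite !mulr0 !addr0.
  by move=> /HW[].
rewrite -[v]divr1; apply: is_derive_affine => //.
move: dv; congr (is_derive _ _ _ _).
by apply/funext => x; rewrite !mulr0 !addr0.
Qed.

Lemma tracks_iter (D : (R -> R -> R -> C) -> R -> R -> R -> C) (r s : nat) : (r + s = 2)%N ->
  (forall W p q i, (p + q = 2 * i)%N -> tracks W p q i -> tracks (D W) (p + r) (q + s) i.+1) ->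
  forall t W p q i, (p + q = 2 * i)%N -> tracks W p q i ->
    tracks (iter t D W) (p + t * r) (q + t * s) (i + t).
Proof.
move=> rs HD; elim=> [|t IH] W p q i pq HW; first by rewrite !mul0n !addn0.
rewrite iterS addnS !mulSn [(r + _)%N]addnC [(s + _)%N]addnC !addnA.
by apply: HD; [clear -pq rs; nia|exact: IH].
Qed.

End Tracking.

Section ParametersOfZeta.
Context {R : realType}.

(** At a real argument the defects are real, so their convergence also forces [Z] to be real there.
    The relation between [k] and [b] says [- s / 2 = b] at [s = 2 - k]. *)
Lemma tracks_zeta (eta : R * R -> R) (a : R) (M k : nat) (b : R)
    (Z : R -> R -> R -> R[i] -> R[i]) : k%:R = 2 * b + 2 ->
  (forall E F G, posdef E F G ->
    forall t : R, 0 < t -> exists2 h0 : R, 0 < h0 & forall h N, 0 < h -> h < h0 ->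
    a <= N%:R * h ->
    norm1 ((1 - (M%:R ^+ k)%:C) * Z E F G (2 - k%:R : R)%:C -
      zeta_defect eta E F G M N h (2 - k%:R : R)%:C) <= t) ->
  M%:R ^+ k != 1 :> R ->
  tracks eta a M b (1 - M%:R ^+ k) (fun E F G => Z E F G (2 - k%:R : R)%:C) 0 0 0.
Proof.
move=> kb HZ M1 E F G pd.
have s2 : - (2 - k%:R : R)%:C / 2 = b%:C.
  rewrite kb -[2 : R[i]](rmorph_nat (real_complex R)) -rmorphN -fmorphV -rmorphM/=.
  by congr (_%:C); field.
have zE N h : zeta_defect eta E F G M N h (2 - k%:R : R)%:C =
    (lattice_defect M N (at_lattice (summand eta 0 0 E F G b 0 cos h)))%:C.
  rewrite zeta_defectE s2 /=; congr (_ +i* _).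
  have z i : at_lattice (summand eta 0 0 E F G b 0 sin h) i = 0.
    by rewrite /at_lattice /summand mul0r sin0 !mulr0 mul0r; case: ifP.
  by rewrite /lattice_defect !big1 ?mulr0 ?subrr.
have {}HZ t : 0 < t -> exists2 h0 : R, 0 < h0 & forall h, 0 < h -> h < h0 ->
   `|(1 - M%:R ^+ k) * complex.Re (Z E F G (2 - k%:R : R)%:C) - defect eta a M 0 0 b E F G h| <= t /\
   `|(1 - M%:R ^+ k) * complex.Im (Z E F G (2 - k%:R : R)%:C)| <= t.
  move=> t0; have [h0 h00 H] := HZ E F G pd t t0; exists h0 => // h hp hh.
  have := H h _ hp hh (cutoff_sizeP a hp); rewrite zE /norm1.
  case: (Z E F G _) => x y /=.
  rewrite !subr0 !mul0r subr0 addr0 /defect => Hxy.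
  have := normr_ge0 ((1 - M%:R ^+ k) * y) => ?.
  have := normr_ge0 ((1 - M%:R ^+ k) * x - lattice_defect M (cutoff_size a h)
    (at_lattice (summand eta 0 0 E F G b 0 cos h))) => ?.
  by split; lra.
split.
  have k0 : 1 - M%:R ^+ k != 0 :> R by rewrite subr_eq0 eq_sym.
  apply: (mulfI k0); apply/eqP; rewrite mulr0 -normr_le0; apply/ler_addgt0Pr => t t0; rewrite add0r.
  have [h0 h00 H] := HZ t t0; have h2 : 0 < h0 / 2 by rewrite divr_gt0.
  by have [|_] := H _ h2; lra.
rewrite big_ord0 divr1 subr0 => t t0; have [h0 h00 H] := HZ t t0.
by exists h0 => // h hp hh; rewrite distrC; have [] := H h hp hh.
Qed.

End ParametersOfZeta.

(** On divergent families [lim] has a default value; the two convergence claims give the formula its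
    meaning. *)
Theorem theorem4 (R : realType) (E F G : R) (hQ : posdef E F G)
    (Z : R -> R -> R -> R[i] -> R[i]) (hZ : is_epstein_zeta Z)
    (eta : R * R -> R) (a : R) (ha : 0 < a)
    (eta_smooth : smooth eta)
    (eta_supp : closure [set u | eta u != 0] `<=` [set u | `|u| <= a])
    (eta0 : eta (0, 0) = 1)
    (eta_even : forall u, eta u = eta (- u))
    (m d l : nat) (hmd : (3 * m <= 2 * d)%N) (hl : (l <= 2 * d)%N) :
  let f := fun u : R * R => u.1 ^+ (2 * d - l) * u.2 ^+ l in
  let Zs := fun E' F' G' : R => Z E' F' G' (2 * (m%:R - d%:R) + 1) in
  let c := (d`!%:R * gbinom (d%:R - m%:R - 2^-1) d)^-1 in
  [/\ forall h : R, 0 < h -> cvg (wigner_seq E F G eta m f h N @[N --> \oo]),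
      cvg (wigner_h E F G eta m f h @[h --> 0^'+]) &
      (wigner E F G eta m f)%:C =
        if (l <= d)%N
        then c%:C * iter (d - l) dE (iter l half_dF Zs) E F G
        else c%:C * iter (2 * d - l) half_dF (iter (l - d) dG Zs) E F G].
Proof.
move=> f Zs c.
have md : (m <= d)%N by lia.
(* [b] is the exponent of [Q] in the zeta terms at [s = 2 - k = 2 (m - d) + 1], and
   [b - d = - (m + 1/2)] is that of the integrand. *)
set k := (2 * (d - m)).+1; pose b : R := d%:R - m%:R - 2^-1.
have kb : k%:R = 2 * b + 2 by rewrite /k /b -natr1 natrM natrB//; field.
(* [b] is a half-integer, so by parity no factor of the falling factorial vanishes. *)
have bi0 (i : nat) : b - i%:R != 0.
  apply/eqP => E0; have : (2 * d)%:R = (2 * m + 1 + 2 * i)%:R :> R.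
    by rewrite !mul2n -!addnn !natrD; move: E0; rewrite /b; lra.
  by move/eqP; rewrite eqr_nat => /eqP; lia.
have [M [n [M1 n0 cop kn HZ]]] := zeta_defect_cvg eta_smooth eta_supp eta0 (ltn0Sn (2 * (d - m))).
have Mk : M%:R ^+ k != 1 :> R by rewrite gt_eqF// exprn_egt1// ltr1n.
have ka0 : 1 - M%:R ^+ k != 0 :> R by rewrite subr_eq0 eq_sym.
have bK : 2 * b <= (k%:Z - 2)%:~R by rewrite rmorphB/= -pmulrn kb; lra.
have Kn : k%:Z - 2 + 4 <= n%:Z by lia.
have ZsE : Zs = (fun E F G => Z E F G (2 - k%:R : R)%:C).
  rewrite /Zs (_ : 2 * (m%:R - d%:R) + 1 = (2 - k%:R : R)%:C)//.
  rewrite kb /b -[2 : R[i]](rmorph_nat (real_complex R)) -!(rmorph_nat (real_complex R)).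
  rewrite -rmorphB -rmorphM -(rmorph1 (real_complex R)) -rmorphD/=.
  by congr (_%:C); field.
have t0 : tracks eta a M b (1 - M%:R ^+ k) Zs 0 0 0.
  rewrite ZsE; apply: tracks_zeta => // E' F' G' pd; apply: HZ => //; by case: (hZ _ _ _ pd).
have tF := tracks_iter (erefl : (1 + 1 = 2)%N)
  (tracks_half_dF eta_smooth eta_supp n0 M1 cop bi0 ka0 bK Kn).
have tE : forall W p q i, (p + q = 2 * i)%N -> tracks eta a M b (1 - M%:R ^+ k) W p q i ->
    tracks eta a M b (1 - M%:R ^+ k) (dE W) (p + 2) (q + 0) i.+1.
  by move=> *; rewrite addn0; apply: tracks_dE bK Kn _ _ _ _ _ _.
have {tE}tE := tracks_iter (erefl : (2 + 0 = 2)%N) tE.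
have tG : forall W p q i, (p + q = 2 * i)%N -> tracks eta a M b (1 - M%:R ^+ k) W p q i ->
    tracks eta a M b (1 - M%:R ^+ k) (dG W) (p + 0) (q + 2) i.+1.
  by move=> *; rewrite addn0; apply: tracks_dG bK Kn _ _ _ _ _ _.
have {tG}tG := tracks_iter (erefl : (0 + 2 = 2)%N) tG.
set W := (if (l <= d)%N then iter (d - l) dE (iter l half_dF Zs)
  else iter (2 * d - l) half_dF (iter (l - d) dG Zs)).
have tW : tracks eta a M b (1 - M%:R ^+ k) W (2 * d - l) l d.
  rewrite /W; case: leqP => ld.
    have := tE (d - l)%N _ _ _ _ _ (tF l _ 0%N 0%N 0%N erefl t0).
    rewrite !add0n !muln1 muln0 addn0 subnKC// => H.
    by rewrite (_ : (2 * d - l)%N = (l + (d - l) * 2)%N); [apply: H|]; lia.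
  have := tF (2 * d - l)%N _ _ _ _ _ (tG (l - d)%N _ 0%N 0%N 0%N erefl t0).
  rewrite !add0n !muln1 muln0 add0n => H.
  by move: {H}(H ltac:(lia)); congr (tracks _ _ _ _ _ _ _ _ _); lia.
have [Im0 tl] := tW E F G hQ.
have bd : b - d%:R = - (m%:R + 2^-1) by rewrite /b; ring.
rewrite bd in tl; have [wc wl] := wigner_limit ha eta_smooth eta_supp hQ md hl M1 tl.
have {}wl := tends0_cvg wl.
(* Multiplied by [d!], the binomial coefficient is the falling factorial left by [d] derivations;
   the factor [1 - M ^ k] of [tracks] cancels against [wigner_limit]. *)
have cE : c = (\prod_(t < d) (b - t%:R))^-1.
  by rewrite /c /gbinom mulrCA divff ?mulr1// pnatr_eq0 -lt0n fact_gt0.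
split=> //; first by apply/cvg_ex; eexists; exact: wl.
have -> : (if (l <= d)%N then c%:C * iter (d - l) dE (iter l half_dF Zs) E F G
  else c%:C * iter (2 * d - l) half_dF (iter (l - d) dG Zs) E F G) = c%:C * W E F G.
  by rewrite /W; case: ifP.
have -> : W E F G = (complex.Re (W E F G))%:C by move: Im0; case: (W E F G) => x y /= ->.
rewrite /wigner (cvg_lim _ wl)// -rmorphM cE; congr (_%:C).
by move: ka0 (complex.Re _) (_^-1) => /= ka0 x y; field.
Qed.
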